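(* Let $f,f_u,q_0,K,\eta,(\gamma_n),(b_n),(\lambda_n)$ and the random sequences $(X_n)_{n\ge1}$, $(g_n)_{n\ge0}$, $(q_n)_{n\ge0}$ be as in the context (the adaptive sampling recursion). Assume the following. (1) The functions $f_u$ and $q_0$ are bounded, continuous, nonnegative and integrable on $\mathbb{R}^d$; there exist $r>0$, $C_f>0$ such that $\int_{\|x\|>t} f_u(x)\,dx\le C_f t^{-r}$ for all $t\ge 0$ (with $0^{-r}=+\infty$); there exists $c>0$ such that $c f_u\le q_0$. (2) $K$ is bounded and Lipschitz, $K(0)>0$, and there exist $r'>0$, $C_K>0$ such that $(1+\|x\|^{d+r'})K(x)\le C_K$ for all $x\in\mathbb{R}^d$. (3) The sequences $(\gamma_n)_{n\ge1}$, $(b_n)_{n\ge1}$, $(\lambda_n)_{n\ge1}$ are decreasing to $0$; there exist $C_\gamma>0$ and $n_\gamma\ge1$ such that $n^{-1}\le C_\gamma\gamma_n$ for all $n\ge1$ and $\gamma_n-\gamma_{n+1}\le\gamma_n\gamma_{n+1}$ for all $n\ge n_\gamma$; $\sum_{n\ge1}\gamma_n^2<\infty$; if $\eta\ge 1/2$ then $\frac{n\gamma_n^2\log n}{\lambda_n b_n^d}\to0$, and if $\eta<1/2$ then $\frac{n\gamma_n^2\log n}{\lambda_n^{2(1-\eta)}b_n^{2d(1-\eta)}}\to0$. Let $A\subset\mathbb{R}^d$ be a compact set. Then, almost surely, $$\lim_{n\to\infty}\ \sup_{x\in A}|q_n(x)-f(x)|=0 .$$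
   Context: Fix $d\ge1$ and $\eta\in(0,1]$. Let $f:\mathbb{R}^d\to[0,\infty)$ be a probability density (the target) and $f_u=c_u f$ for some constant $c_u>0$ (an unnormalized version of $f$). Let $K:\mathbb{R}^d\to[0,\infty)$ be a probability density and, for $b>0$, $K_b(x)=b^{-d}K(x/b)$. Let $q_0$ be a probability density on $\mathbb{R}^d$, and let $(\gamma_n)_{n\ge1}$, $(b_n)_{n\ge1}$, $(\lambda_n)_{n\ge1}$ be positive deterministic sequences, with $\lambda_n\in(0,1]$. The notation $\int h$ means $\int_{\mathbb{R}^d}h(x)\,dx$, and $0^0=1$. On a probability space, $(X_n)_{n\ge1}$ is a sequence of $\mathbb{R}^d$-valued random variables, $\mathcal{F}_n=\sigma(X_1,\dots,X_n)$, $\mathcal{F}_0$ trivial, and random functions $g_n,q_n$ are defined by $g_0=0$ and, for $n\ge0$: conditionally on $\mathcal{F}_n$, $X_{n+1}$ has density $q_n$; $$w_{n+1}=\frac{f_u(X_{n+1})}{q_n(X_{n+1})},\qquad g_{n+1}(x)=(1-\gamma_{n+1})g_n(x)+\gamma_{n+1}w_{n+1}^{\eta}K_{b_{n+1}}(x-X_{n+1}),$$ $$q_{n+1}(x)=(1-\lambda_{n+1})\frac{g_{n+1}(x)}{\int g_{n+1}}+\lambda_{n+1}q_0(x),\qquad x\in\mathbb{R}^d .$$ The recursion is assumed to be well defined: $g_n\ge0$ for all $n$ and $\int g_n>0$ for $n\ge1$, so that each $q_n$ is a probability density. *)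

(* Defs.v *)
From HB Require Import structures.
From mathcomp Require Import all_boot all_order all_algebra.
From mathcomp Require Import all_classical all_reals all_analysis.
From mathcomp Require Import measurable_realfun.

Set Implicit Arguments.
Unset Strict Implicit.
Unset Printing Implicit Defensive.

Import Order.TTheory GRing.Theory Num.Theory.
Import numFieldNormedType.Exports.

Local Open Scope classical_set_scope.
Local Open Scope ring_scope.

(* Matrices, hence the row vectors 'rV[R]_n modelling R^n, carry their Borel
   sigma-algebra. *)
HB.instance Definition _ (R : realType) (m n : nat) :=
  @isMeasurable.Build (sigma_display (@open 'M[R]_(m, n))) 'M[R]_(m, n)
    <<s @open 'M[R]_(m, n) >>
    (@sigma_algebra0 _ _ _) (@sigma_algebraC _ _) (@sigma_algebra_bigcup _ _ _).

Section borel_row_vectors.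
Context {R : realType} {n : nat}.

Definition row_of_tuple (t : n.-tuple (measurableTypeR R)) : 'rV[R]_n :=
  \row_i tnth t i.

Definition tuple_of_row (v : 'rV[R]_n) : n.-tuple (measurableTypeR R) :=
  [tuple v ord0 i | i < n].

Lemma row_of_tupleK : cancel row_of_tuple tuple_of_row.
Proof. by move=> t; apply: eq_from_tnth => i; rewrite tnth_mktuple mxE. Qed.

Lemma tuple_of_rowK : cancel tuple_of_row row_of_tuple.
Proof. by move=> v; apply/rowP => i; rewrite mxE tnth_mktuple. Qed.

Lemma continuous_measurable_fun_row (f : 'rV[R]_n -> R) :
  continuous f -> measurable_fun setT f.
Proof.
move=> /continuousP cf.
apply: (measurability _ (RGenOpens.measurableE R)) => _ [_ [a [b ->]] <-].
by rewrite setTI; apply: sub_sigma_algebra; exact/cf/interval_open.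
Qed.

Lemma measurable_tuple_of_row : measurable_fun setT tuple_of_row.
Proof.
apply/measurable_fun_tnthP => i.
have -> : (@tnth _ _ ^~ i) \o tuple_of_row = (fun v : 'rV[R]_n => v ord0 i).
  by apply/funext => v /=; rewrite tnth_mktuple.
by apply: continuous_measurable_fun_row; exact: coord_continuous.
Qed.

Let box (p : n.-tuple rat * nat) : set 'rV[R]_n :=
  [set v | forall i, `|v ord0 i - ratr (tnth p.1 i)| < p.2.+1%:R^-1].

Let open_row_bigcup (U : set 'rV[R]_n) : open U ->
  U = \bigcup_(p in [set p | box p `<=` U]) box p.
Proof.
move=> oU; apply/seteqP; split => [v Uv|v [p /= pU]]; last exact: pU.
have [e /= e0 eU] : exists2 e : R, 0 < e & ball v e `<=` U.
  by have /nbhs_ballP[e e0 eU] := open_nbhs_nbhs (conj oU Uv); exists e.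
have [k ke] : exists k : nat, k.+1%:R^-1 < e / 2.
  have [k _ /(_ k (leqnn k)) kP] :=
    near_infty_natSinv_lt (PosNum (divr_gt0 e0 (ltr0n R 2))).
  by exists k.
pose k1 : R := k.+1%:R^-1.
have k10 : 0 < k1 by rewrite invr_gt0 ltr0n.
have q_ i : {q : rat | `|v ord0 i - ratr q| < k1}.
  apply: cid.
  have [q] : exists q, ratr q \in `](v ord0 i - k1), (v ord0 i + k1)[.
    by apply: rat_in_itvoo; rewrite ltrD2l (lt_trans _ k10)// oppr_lt0.
  rewrite in_itv/= => /andP[q1 q2]; exists q.
  by rewrite distrC ltr_distl q1 q2.
exists ([tuple sval (q_ i) | i < n], k) => /= [w wbox|i]; last first.
  by rewrite tnth_mktuple; exact: (svalP (q_ i)).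
apply: eU; split => // i j; rewrite (ord1 i).
have := wbox j; rewrite tnth_mktuple => wj.
have := svalP (q_ j) => vj.
rewrite /ball/= (splitr e) -(subrK (ratr (sval (q_ j))) (v ord0 j)) -addrA.
rewrite (le_lt_trans (ler_normD _ _))// ltrD// ?(lt_trans vj)//.
by rewrite distrC (lt_trans wj).
Qed.

Lemma measurable_row_of_tuple : measurable_fun setT row_of_tuple.
Proof.
apply: (@measurability _ _ _ _ setT _ (@open 'rV[R]_n)) => // _ [U oU <-].
rewrite setTI (open_row_bigcup oU) bigcup_mkcond preimage_bigcup.
apply: countable_bigcupT_measurable => // p; case: ifPn => _; last first.
  by rewrite preimage_set0.
rewrite (_ : _ @^-1` _ = \bigcap_(i in [set: 'I_n]) ((@tnth _ _ ^~ i) @^-1`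
    (ball (ratr (tnth p.1 i) : R) p.2.+1%:R^-1 : set (measurableTypeR R)))).
  apply: fin_bigcap_measurable => // i _; rewrite -[X in measurable X]setTI.
  apply: measurable_tnth => //; apply: open_measurable; exact: ball_open.
apply/seteqP; split => t /= tp i; first by move=> _; rewrite /ball/= distrC; have := tp i; rewrite mxE.
by have := tp i I; rewrite /ball/= distrC mxE.
Qed.

End borel_row_vectors.

Section lebesgue_row.
Context {R : realType}.

Fixpoint lebesgue_tuple (n : nat) :
    set (n.-tuple (measurableTypeR R)) -> \bar R :=
  match n with
  | 0 => \d_[tuple]
  | k.+1 => pushforward (lebesgue_measure \x @lebesgue_tuple k)%E
      (fun p : measurableTypeR R * k.-tuple (measurableTypeR R) =>
         [tuple of p.1 :: p.2])
  end.

Let sigma_finite_pack d (T : measurableType d)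
    (mu : {measure set T -> \bar R}) : sigma_finite setT mu ->
  exists m' : {sigma_finite_measure set T -> \bar R},
    (m' : set T -> \bar R) = mu.
Proof.
move=> muT.
pose SF := isSFinite.Build _ _ _ (mu : set T -> \bar R)
  (sfinite_measure_sigma_finite muT).
pose SigmaF := isSigmaFinite.Build _ _ _ (mu : set T -> \bar R) muT.
pose m' := HB.pack_for {sigma_finite_measure set T -> \bar R}
  (Measure.sort mu) SF SigmaF.
by exists m'.
Qed.

Let pushforward_sigma_finite d1 d2 (T1 : measurableType d1)
    (T2 : measurableType d2) (m : {sigma_finite_measure set T1 -> \bar R})
    (f : T1 -> T2) (g : T2 -> T1) :
    measurable_fun setT f -> measurable_fun setT g -> cancel f g ->
  exists m' : {sigma_finite_measure set T2 -> \bar R},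
    (m' : set T2 -> \bar R) = pushforward m f.
Proof.
move=> mf mg fK; pose pm := pushforward m f.
have pmsf : sigma_finite setT pm.
  have [F TF Foo] := sigma_finiteT m.
  exists (fun k => g @^-1` F k); first by rewrite -preimage_bigcup -TF.
  move=> k; have [mF Fk] := Foo k; split.
    by rewrite -[X in measurable X]setTI; exact: mg.
  rewrite /pm /pushforward (_ : _ @^-1` _ = F k)//.
  by apply/seteqP; split => x /=; rewrite fK.
have [m' m'E] := @sigma_finite_pack _ _
  (measure_function_pushforward__canonical__measure_function_Measure m mf) pmsf.
by exists m'.
Qed.

Let product_sigma_finite d1 d2 (T1 : measurableType d1)
    (T2 : measurableType d2) (m1 : {sigma_finite_measure set T1 -> \bar R})
    (m2 : {sigma_finite_measure set T2 -> \bar R}) :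
  sigma_finite setT (m1 \x m2)%E.
Proof.
have /sigma_finiteP[F [TF ndF Foo]] := sigma_finiteT m1.
have /sigma_finiteP[G [TG ndG Goo]] := sigma_finiteT m2.
exists (fun n => F n `*` G n).
  rewrite -setXTT TF TG predeqE => -[x y]; split.
    move=> [/= [n _ Fnx] [k _ Gky]]; exists (maxn n k) => //; split.
    - by move: x Fnx; exact/subsetPset/ndF/leq_maxl.
    - by move: y Gky; exact/subsetPset/ndG/leq_maxr.
  by move=> [n _ []/= ? ?]; split; exists n.
move=> k; have [? ?] := Foo k; have [? ?] := Goo k.
split; first exact: measurableX.
by rewrite product_measure1E// lte_mul_pinfty// ge0_fin_numE.
Qed.

Let lebesgue_tuple_pack (n : nat) :
  exists m : {sigma_finite_measure set n.-tuple (measurableTypeR R) -> \bar R},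
    (m : set _ -> \bar R) = @lebesgue_tuple n.
Proof.
elim: n => [|n [m mE]] /=.
  by apply: (sigma_finite_pack (mu := \d_[tuple])); exact: sigma_finiteT.
have [m2 m2E] := sigma_finite_pack
  (product_sigma_finite (@lebesgue_measure R) m).
rewrite -mE; have -> : (lebesgue_measure \x m)%E = m2 by rewrite m2E.
apply: (@pushforward_sigma_finite _ _ _ _ m2 _
  (fun t => (thead t, [tuple of behead t]))).
- exact: measurable_cons.
- apply: measurable_fun_pair; last exact: measurable_behead.
  exact: measurable_tnth.
- by move=> [x t] /=; congr pair; exact/val_inj.
Qed.

Definition lebesgue_row {n : nat} : set 'rV[R]_n -> \bar R :=
  pushforward (@lebesgue_tuple n) row_of_tuple.

Let lebesgue_row_pack (n : nat) :
  exists m : {sigma_finite_measure set 'rV[R]_n -> \bar R},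
    (m : set _ -> \bar R) = @lebesgue_row n.
Proof.
have [m mE] := lebesgue_tuple_pack n; rewrite /lebesgue_row -mE.
apply: (@pushforward_sigma_finite _ _ _ _ m row_of_tuple tuple_of_row).
- exact: measurable_row_of_tuple.
- exact: measurable_tuple_of_row.
- exact: row_of_tupleK.
Qed.

Section instance.
Variable n : nat.

Let lebesgue_row0 : @lebesgue_row n set0 = 0%E.
Proof. by have [m <-] := lebesgue_row_pack n; exact: measure0. Qed.

Let lebesgue_row_ge0 A : (0 <= @lebesgue_row n A)%E.
Proof. by have [m <-] := lebesgue_row_pack n; exact: measure_ge0. Qed.

Let lebesgue_row_sigma_additive : semi_sigma_additive (@lebesgue_row n).
Proof.
have [m <-] := lebesgue_row_pack n; exact: measure_semi_sigma_additive.
Qed.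

HB.instance Definition _ := isMeasure.Build _ _ _ (@lebesgue_row n)
  lebesgue_row0 lebesgue_row_ge0 lebesgue_row_sigma_additive.

Let lebesgue_row_sigma_finite : sigma_finite setT (@lebesgue_row n).
Proof. by have [m <-] := lebesgue_row_pack n; exact: sigma_finiteT. Qed.

HB.instance Definition _ := isSFinite.Build _ _ _ (@lebesgue_row n)
  (sfinite_measure_sigma_finite lebesgue_row_sigma_finite).

HB.instance Definition _ := isSigmaFinite.Build _ _ _ (@lebesgue_row n)
  lebesgue_row_sigma_finite.

End instance.

Lemma lebesgue_row_box (n : nat) (a b : 'rV[R]_n) :
    (forall i, a ord0 i <= b ord0 i) ->
  lebesgue_row [set v | forall i, a ord0 i < v ord0 i <= b ord0 i] =
  (\prod_(i < n) (b ord0 i - a ord0 i))%:E.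
Proof.
move=> ab; rewrite /lebesgue_row /pushforward.
pose tbox m (u v : 'I_m -> R) := [set t : m.-tuple (measurableTypeR R) |
  forall i, u i < tnth t i <= v i].
rewrite (_ : _ @^-1` _ = tbox n (a ord0) (b ord0)); last first.
  by apply/seteqP; split => t /= tab i; have := tab i; rewrite mxE.
move: (a ord0) (b ord0) ab => u v {a b}; elim: n u v => [|n ih] u v uv.
  rewrite /= big_ord0 diracE mem_set//; by case.
have mtbox m (u' v' : 'I_m -> R) : measurable (tbox m u' v').
  rewrite (_ : tbox m u' v' = \bigcap_(i in [set: 'I_m]) ((@tnth _ _ ^~ i) @^-1`
      (`]u' i, v' i]%classic : set (measurableTypeR R)))).
    apply: fin_bigcap_measurable => // i _; rewrite -[X in measurable X]setTI.
    by apply: measurable_tnth => //; exact: measurable_itv.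
  apply/seteqP; split => t /= tp i; first by move=> _; rewrite /= in_itv/=.
  by have := tp i I; rewrite /= in_itv.
rewrite /= /pushforward (_ : _ @^-1` _ = `]u ord0, v ord0]%classic `*`
    tbox n (u \o lift ord0) (v \o lift ord0)); last first.
  apply/seteqP; split => -[x t] /=.
    move=> xt; split; first by have := xt ord0; rewrite tnth0 in_itv.
    by move=> i; have := xt (lift ord0 i); rewrite tnthS.
  move=> [xuv tuv] i; case: (unliftP ord0 i) => [j|] ->.
    by rewrite tnthS; exact: tuv.
  by move: xuv; rewrite tnth0 in_itv.
have [m mE] := lebesgue_tuple_pack n; rewrite -mE product_measure1E//;
  last exact: mtbox.
rewrite mE ih; last by move=> i; exact: uv.
rewrite [in RHS]big_ord_recl EFinM; congr (_ * _)%E.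
rewrite [LHS]lebesgue_measure_itv/= lte_fin; case: ltgtP (uv ord0) => // -> _.
by rewrite subrr.
Qed.

End lebesgue_row.

Section adaptive_sampling.
Context {R : realType} {d : nat}.
Implicit Types (p g h : 'rV[R]_d -> R).

(* The library norm `|v| of a row vector is the sup norm. *)
Definition euclidean_norm (v : 'rV[R]_d) : R :=
  Num.sqrt (\sum_i v ord0 i ^+ 2).

Definition is_density p : Prop :=
  [/\ measurable_fun setT p, (forall x, 0 <= p x) &
      (\int[lebesgue_row]_x (p x)%:E = 1)%E].

Definition rescaled (K : 'rV[R]_d -> R) (b : R) (x : 'rV[R]_d) : R :=
  b ^- d * K (b^-1 *: x).

(* The supremum is taken in [0, +oo]: it is 0 when A is empty. *)
Definition sup_dist (A : set 'rV[R]_d) g h : \bar R :=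
  ereal_sup (0%E |` [set `|g x - h x|%:E | x in A]).

Section random.
Context {dT : measure_display} {T : measurableType dT} (P : probability T R).

(* Y has density q conditionally on the sigma-algebra F: for every Borel set B,
   the integral of q over B is a version of the conditional probability of
   {Y \in B} given F. *)
Definition conditional_density (F : set (set T)) (Y : T -> 'rV[R]_d)
    (q : T -> 'rV[R]_d -> R) : Prop :=
  forall B : set 'rV[R]_d, measurable B ->
    let pB w := (\int[lebesgue_row]_(x in B) (q w x)%:E)%E in
    (forall C : set \bar R, measurable C -> F (pB @^-1` C)) /\
    (forall E : set T, F E ->
      P (E `&` Y @^-1` B) = (\int[P]_(w in E) pB w)%E).

Variable X : {RV P >-> 'rV[R]_d}^nat.

(* sigma(X_1, ..., X_n); the random variable X 0 is never used. *)
Definition past (n : nat) : set (set T) :=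
  g_sigma_preimage (fun i : 'I_n => X i.+1 : T -> 'rV[R]_d).

(* Sequences indexed from 1 in the mathematics are functions on nat whose value
   at 0 is irrelevant. *)
Record adaptive_sampling (fu q0 K : 'rV[R]_d -> R) (eta : R)
    (gamma b lambda : R^nat) (g q : nat -> T -> 'rV[R]_d -> R) : Prop := {
  as_g0 : forall w x, g 0%N w x = 0 ;
  as_q0 : forall w x, q 0%N w x = q0 x ;
  as_law : forall n, conditional_density (past n) (X n.+1) (q n) ;
  as_gS : forall n w x,
    let weight := fu (X n.+1 w) / q n w (X n.+1 w) in
    g n.+1 w x = (1 - gamma n.+1) * g n w x +
      gamma n.+1 * weight `^ eta * rescaled K (b n.+1) (x - X n.+1 w) ;
  as_qS : forall n w x,
    q n.+1 w x =
      (1 - lambda n.+1) * (g n.+1 w x / \int[lebesgue_row]_y g n.+1 w y) +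
      lambda n.+1 * q0 x ;
  as_well_defined : {ae P, forall w,
    (forall n x, 0 <= g n w x) /\
    (forall n, (0 < n)%N -> 0 < \int[lebesgue_row]_y g n w y)} }.

End random.

End adaptive_sampling.

(* Main.v *)
Require Import Defs.
From HB Require Import structures.
From mathcomp Require Import all_boot all_order all_algebra.
From mathcomp Require Import all_classical all_reals all_analysis.
From mathcomp Require Import measurable_realfun ring lra.

Set Implicit Arguments.
Unset Strict Implicit.
Unset Printing Implicit Defensive.

Import Order.TTheory GRing.Theory Num.Theory.
Import numFieldNormedType.Exports.

Local Open Scope classical_set_scope.
Local Open Scope ring_scope.

(** Let G_n = g_n / c_u^eta, and let D_n follow the same recursion as G_n with
    each increment replaced by its conditional mean, the convolution of
    f^eta q_n^(1 - eta) with K_(b_(n+1)). G_n is a weighted sum of adapted terms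
    of size at most a constant times gamma_n lambda_n^(-eta) b_n^(-d), which is
    o(lambda_n^(1 - eta) / log n) under both rate hypotheses. A multiplicative
    Chernoff bound, over a grid of polynomially many points, therefore gives
    almost surely |G_n - D_n| <= e (D_n + lambda_n^(1 - eta)) for n large,
    uniformly on the cube of half-side n^3. Comparing the noise with the drift
    itself is what makes the case eta < 1/2 no harder than the other one. In the
    same way int G_n <= 1 + e eventually, as int f^eta q_n^(1 - eta) <= 1.

    The rest is deterministic. Exploration gives D_n >= C lambda_n^(1 - eta)
    locally, which absorbs the error term, so that q_n >= (1 - e) D_n; since
    v |-> f^eta v^(1 - eta) is concave with fixed point f, this pushes D_n up to
    f locally uniformly, and int G_n -> 1 follows. Then
    f^eta q_n^(1 - eta) <= eta f + (1 - eta) q_n makes the excess of D_n over f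
    contract, which gives the matching upper bound. Compactness of A concludes. *)

(** * Lebesgue measure on row vectors *)

(** For variables with values in [0, 1] the Chernoff exponent costs only the mean, which dominates
    the variance. Dividing the summands by their maximal size U_n thus gives a deviation e D_n +
    O(U_n log n / e), with no square root, and U_n log n is a constant times (gamma_n log n /
    (lambda_n b_n^d)) lambda_n^(1 - eta). As n gamma_n >= 1 / C_gamma, either rate hypothesis makes
    the first factor vanish. The same ratio yields lambda_n b_n^d >= 1/n, so that all the sizes and
    Lipschitz constants are polynomial in n. The normalization by int G_n dictates the order of the
    proof: its upper bound is a noise estimate, but its lower bound, without which q_n cannot be
    bounded from above, has to come from the lower bound on D_n. Moreover a bound on a ball does not
    pass through the kernel, whose mass leaks across the boundary. Hence comparison functions
    centred at x0: from below an exponential profile, whose decrease compensates the leak; from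
    above a linear one, which also absorbs the points outside the cube, where only G_n <= C n^2 is
    known. *)

Section row_vectors.
Context {R : realType} {d : nat}.
Implicit Types u v x y : 'rV[R]_d.

Lemma measurable_fun_rowP d' (T : measurableType d') (h : T -> 'rV[R]_d) :
  (forall i, measurable_fun setT (fun t => h t ord0 i)) ->
  measurable_fun setT h.
Proof.
move=> mh; rewrite (_ : h = row_of_tuple \o (tuple_of_row \o h)); last first.
  by apply/funext => t /=; rewrite tuple_of_rowK.
apply: measurableT_comp; first exact: measurable_row_of_tuple.
apply/measurable_fun_tnthP => i.
rewrite (_ : _ \o _ = (fun t => h t ord0 i)); first exact: mh.
by apply/funext => t /=; rewrite tnth_mktuple.
Qed.

Lemma measurable_coord i : measurable_fun setT (fun v : 'rV[R]_d => v ord0 i).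
Proof. by apply: continuous_measurable_fun_row; exact: coord_continuous. Qed.

Lemma measurable_fun_rowB d' (T : measurableType d') (g h : T -> 'rV[R]_d) :
  measurable_fun setT g -> measurable_fun setT h ->
  measurable_fun setT (fun t => g t - h t).
Proof.
move=> mg mh; apply: measurable_fun_rowP => i.
under eq_fun do rewrite !mxE.
by apply: measurable_funB; apply: (measurableT_comp (measurable_coord i)).
Qed.

Lemma measurable_fun_rowZ d' (T : measurableType d') (c : R) (h : T -> 'rV[R]_d) :
  measurable_fun setT h -> measurable_fun setT (fun t => c *: h t).
Proof.
move=> mh; apply: measurable_fun_rowP => i.
under eq_fun do rewrite !mxE.
apply: measurable_funM => //.
by apply: (measurableT_comp (measurable_coord i)).
Qed.

Lemma open_measurable_row (U : set 'rV[R]_d) : open U -> measurable U.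
Proof. by move=> oU; apply: sub_sigma_algebra. Qed.

Lemma normr_rowP x (r : R) : 0 <= r ->
  reflect (forall i, `|x ord0 i| <= r) (`|x| <= r).
Proof.
move=> r0; apply: (iffP idP) => [xr i|xr].
  apply: le_trans xr; rewrite {2}/Num.Def.normr/= mx_normE.
  by rewrite -[leLHS]nngE num_le; exact: (le_bigmax _ _ (ord0, i)).
rewrite /Num.Def.normr/=; have [->//|] := eqVneq (mx_norm x) 0.
by move=> /mx_norm_neq0[[i j] ->]; rewrite (ord1 i).
Qed.

Lemma coord_le_normr x i : `|x ord0 i| <= `|x|.
Proof. by move: i; apply/normr_rowP. Qed.

Lemma euclidean_norm_ge0 x : 0 <= euclidean_norm x.
Proof. exact: sqrtr_ge0. Qed.

Lemma normr_le_euclidean_norm x : `|x| <= euclidean_norm x.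
Proof.
apply/normr_rowP; first exact: euclidean_norm_ge0.
move=> i; rewrite -sqrtr_sqr ler_wsqrtr// (bigD1 i)//= lerDl.
by apply: sumr_ge0 => j _; exact: sqr_ge0.
Qed.

Lemma euclidean_norm_le_normr x : euclidean_norm x <= Num.sqrt d%:R * `|x|.
Proof.
rewrite -[X in _ * X](ger0_norm (normr_ge0 x)) -sqrtr_sqr -sqrtrM// ler_wsqrtr//.
have -> : d%:R * `|x| ^+ 2 = \sum_(i < d) `|x| ^+ 2.
  by rewrite sumr_const card_ord mulr_natl.
rewrite ler_sum// => i _.
by rewrite -[leLHS]real_normK ?num_real// ler_sqr ?nnegrE// coord_le_normr.
Qed.

Definition half_open_box u v := [set x : 'rV[R]_d |
  forall i, u ord0 i < x ord0 i <= v ord0 i].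

Let rbox (p : d.-tuple rat * nat) :=
  half_open_box (\row_i (ratr (tnth p.1 i) - p.2.+1%:R^-1))
                (\row_i (ratr (tnth p.1 i) + p.2.+1%:R^-1)).

Let open_bigcup_rbox (U : set 'rV[R]_d) : open U ->
  U = \bigcup_(p in [set p | rbox p `<=` U]) rbox p.
Proof.
move=> oU; apply/seteqP; split => [v Uv|v [p /= pU]]; last exact: pU.
have [e /= e0 eU] : exists2 e : R, 0 < e & ball v e `<=` U.
  by have /nbhs_ballP[e e0 eU] := open_nbhs_nbhs (conj oU Uv); exists e.
have [k ke] : exists k : nat, k.+1%:R^-1 < e / 2.
  have [k _ /(_ k (leqnn k)) kP] :=
    near_infty_natSinv_lt (PosNum (divr_gt0 e0 (ltr0n R 2))).
  by exists k.
pose k1 : R := k.+1%:R^-1.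
have k10 : 0 < k1 by rewrite invr_gt0 ltr0n.
have q_ i : {q : rat | `|v ord0 i - ratr q| < k1}.
  apply: cid.
  have [q] : exists q, ratr q \in `](v ord0 i - k1), (v ord0 i + k1)[.
    by apply: rat_in_itvoo; rewrite ltrD2l (lt_trans _ k10)// oppr_lt0.
  rewrite in_itv/= => /andP[q1 q2]; exists q.
  by rewrite distrC ltr_distl q1 q2.
exists ([tuple sval (q_ i) | i < d], k) => /= [w wbox|i]; last first.
  rewrite !mxE tnth_mktuple; have := svalP (q_ i); rewrite ltr_distl.
  by move=> /andP[-> /ltW].
apply: eU; split => // i j; rewrite (ord1 i).
have := wbox j; rewrite !mxE tnth_mktuple -/k1 => /andP[w1 w2].
have := svalP (q_ j); rewrite ltr_distl => /andP[v1 v2].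
rewrite /ball/= ltr_distl; rewrite -/k1 in ke.
by apply/andP; split; lra.
Qed.

Lemma measurable_half_open_box u v : measurable (half_open_box u v).
Proof.
rewrite (_ : half_open_box u v = \bigcap_(i in [set: 'I_d])
    ((fun x : 'rV[R]_d => x ord0 i) @^-1`
       (`]u ord0 i, v ord0 i]%classic : set (measurableTypeR R)))).
  apply: fin_bigcap_measurable => // i _; rewrite -[X in measurable X]setTI.
  by apply: measurable_coord => //; exact: measurable_itv.
apply/seteqP; split => t /= tp i; first by move=> _; rewrite /= in_itv/=.
by have := tp i I; rewrite /= in_itv.
Qed.

Definition half_open_boxes : set (set 'rV[R]_d) :=
  [set B | exists u v, B = half_open_box u v].

Lemma measurable_rowE :
  @measurable _ 'rV[R]_d = <<s half_open_boxes >>.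
Proof.
apply/seteqP; split.
  apply: smallest_sub; first exact: smallest_sigma_algebra.
  move=> U /open_bigcup_rbox ->.
  rewrite bigcup_mkcond.
  pose T' := g_sigma_algebraType half_open_boxes.
  have : @measurable _ T' (\bigcup_p (if p \in [set p | rbox p `<=` U] then rbox p else set0)).
    apply: countable_bigcupT_measurable => // p; case: ifPn => // _.
    apply: sub_sigma_algebra; rewrite /rbox; eexists; eexists; reflexivity.
  by [].
apply: smallest_sub; first exact: sigma_algebra_measurable.
by move=> _ [u [v ->]]; exact: measurable_half_open_box.
Qed.

Lemma half_open_box_setI : setI_closed half_open_boxes.
Proof.
move=> _ _ [u [v ->]] [u' [v' ->]].
exists (\row_i Num.max (u ord0 i) (u' ord0 i)).
exists (\row_i Num.min (v ord0 i) (v' ord0 i)).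
apply/seteqP; split => x /=.
  move=> [h h'] i; move: (h i) (h' i); rewrite !mxE gt_max le_min.
  by move=> /andP[a1 b1] /andP[a2 b2]; rewrite a1 b1 a2.
move=> h; split => i; move: (h i); rewrite !mxE gt_max le_min;
  by move=> /andP[/andP[a1 a2] /andP[b1 b2]]; apply/andP; split.
Qed.

(** Half-open boxes form a pi-system generating the Borel sets, and the cubes ]-k, k]^d exhaust the
    space. A box with some u_i > v_i is empty, so only ordered corners have to be tested. *)
Lemma measure_row_unique (m1 m2 : {measure set 'rV[R]_d -> \bar R}) :
  (forall u v, (forall i, u ord0 i <= v ord0 i) ->
     m1 (half_open_box u v) = m2 (half_open_box u v)) ->
  (forall u v, (forall i, u ord0 i <= v ord0 i) ->
     (m1 (half_open_box u v) < +oo)%E) ->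
  forall A, measurable A -> m1 A = m2 A.
Proof.
move=> m12 m1oo.
pose c (k : nat) := half_open_box (\row_i - k%:R) (\row_i k%:R).
apply: (measure_unique half_open_boxes c).
- exact: measurable_rowE.
- exact: half_open_box_setI.
- by move=> k; exists (\row_i - k%:R), (\row_i k%:R).
- rewrite -subTset => x _.
  have [n xn] : exists n : nat, `|x| < n%:R.
    by exists (Num.truncn `|x|).+1; exact: truncnS_gt.
  exists n => // i; rewrite !mxE.
  have := le_lt_trans (coord_le_normr x i) xn; rewrite ltr_norml.
  by move=> /andP[-> /ltW].
- move=> _ [u [v ->]].
  have [uv|/existsNP[i /negP]] := pselect (forall i, u ord0 i <= v ord0 i).
    exact: m12.
  rewrite -ltNge => vu; rewrite (_ : half_open_box u v = set0) ?measure0//.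
  rewrite -subset0 => x /(_ i) /andP[ux xv].
  by have := lt_trans (lt_le_trans ux xv) vu; rewrite ltxx.
- by move=> k; apply: m1oo => i; rewrite !mxE; by rewrite (@le_trans _ _ 0)// oppr_le0.
Qed.

Let cvg_prod_row (F : 'I_d -> R^nat) (a : 'I_d -> R) :
  (forall i, F i n @[n --> \oo] --> a i) ->
  \prod_(i < d) F i n @[n --> \oo] --> \prod_(i < d) a i.
Proof.
move=> Fa; apply: cvg_big => //.
by move=> x; apply: (@mul_continuous R).
Qed.

(** An affine map of negative slope turns left-open boxes into right-open ones; hence a statement
    for any [S] between the open and the closed box. Half-open boxes enlarged or shrunk by 1/(n+1)
    squeeze the measure. *)
Lemma lebesgue_row_squeeze u v (S : set 'rV[R]_d) : measurable S ->
  (forall i, u ord0 i <= v ord0 i) ->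
  (forall x, (forall i, u ord0 i < x ord0 i < v ord0 i) -> S x) ->
  (forall x, S x -> forall i, u ord0 i <= x ord0 i <= v ord0 i) ->
  lebesgue_row S = (\prod_(i < d) (v ord0 i - u ord0 i))%:E.
Proof.
move=> mS uv oS Sc; apply/eqP; rewrite eq_le; apply/andP; split.
- have le_n n : (lebesgue_row S <=
      (\prod_(i < d) (v ord0 i - (u ord0 i - n.+1%:R^-1)))%:E)%E.
    rewrite (_ : _%:E = lebesgue_row (half_open_box (\row_i (u ord0 i - n.+1%:R^-1)) v)).
      apply: le_measure; rewrite ?inE//; first exact: measurable_half_open_box.
      move=> x /Sc xS i; rewrite !mxE; have /andP[ux ->] := xS i.
      by rewrite andbT ltrBlDr (le_lt_trans ux)// ltrDl invr_gt0.
    rewrite lebesgue_row_box.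
      by congr EFin; apply: eq_bigr => i _; rewrite !mxE.
    by move=> i; rewrite !mxE lerBlDr (le_trans (uv i))// lerDl invr_ge0.
  have Sfin : lebesgue_row S \is a fin_num.
    by rewrite ge0_fin_numE// (le_lt_trans (le_n 0%N))// ltry.
  rewrite -(fineK Sfin) lee_fin.
  apply: (@cvgr_to_ge _ \oo _ _ (fun n : nat =>
      \prod_(i < d) (v ord0 i - (u ord0 i - n.+1%:R^-1)))).
    apply: (cvg_prod_row (F := fun i n => v ord0 i - (u ord0 i - n.+1%:R^-1))) => i.
    rewrite -[X in _ --> _ - X]subr0.
    apply: cvgB; first exact: cvg_cst.
    by apply: cvgB; [exact: cvg_cst|exact: cvg_harmonic].
  by apply: nearW => n; rewrite -lee_fin fineK.
(* The maximum keeps the corners ordered while 1/(n+1) exceeds a side. *)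
- have ge_n n : ((\prod_(i < d)
      (Num.max (u ord0 i) (v ord0 i - n.+1%:R^-1) - u ord0 i))%:E <=
      lebesgue_row S)%E.
    rewrite (_ : _%:E = lebesgue_row (half_open_box u
        (\row_i Num.max (u ord0 i) (v ord0 i - n.+1%:R^-1)))).
      apply: le_measure; rewrite ?inE//; first exact: measurable_half_open_box.
      move=> x xS; apply: oS => i; have := xS i; rewrite !mxE => /andP[ux].
      rewrite ux /= le_max leNgt ux /= => /le_lt_trans; apply.
      by rewrite ltrBlDr ltrDl invr_gt0.
    rewrite lebesgue_row_box.
      by congr EFin; apply: eq_bigr => i _; rewrite !mxE.
    by move=> i; rewrite !mxE le_max lexx.
  have [Sfin|] := boolP (lebesgue_row S \is a fin_num); last first.
    by rewrite ge0_fin_numE// -leNgt leye_eq => /eqP ->; rewrite leey.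
  rewrite -(fineK Sfin) lee_fin.
  apply: (@cvgr_to_le _ \oo _ _ (fun n : nat => \prod_(i < d)
      (Num.max (u ord0 i) (v ord0 i - n.+1%:R^-1) - u ord0 i))).
    apply: (cvg_prod_row (F := fun i n =>
      Num.max (u ord0 i) (v ord0 i - n.+1%:R^-1) - u ord0 i)) => i; apply: cvgB; last exact: cvg_cst.
    rewrite -[X in _ --> X](max_r (uv i)).
    have vn : v ord0 i - n.+1%:R^-1 @[n --> \oo] --> v ord0 i.
      rewrite -[X in _ --> X]subr0.
      by apply: cvgB; [exact: cvg_cst|exact: cvg_harmonic].
    apply: (cvg_comp _ _ vn).
    by apply: (@continuous_max _ _ (cst (u ord0 i)) idfun); [exact: cvg_cst|exact: cvg_id].
  by apply: nearW => n; rewrite -lee_fin fineK.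
Qed.

(** * Affine changes of variables *)

Lemma measurable_affine_row (c : 'rV[R]_d) (s : R) :
  measurable_fun setT (fun y : 'rV[R]_d => c + s *: y).
Proof.
rewrite (_ : (fun _ => _) = (fun y => c - (- s) *: y)); last first.
  by apply/funext => y; rewrite scaleNr opprK.
apply: measurable_fun_rowB; first exact: measurable_cst.
exact: measurable_fun_rowZ.
Qed.

(** Both signs of [s] matter, since convolutions use y |-> x - y. The two sides are measures in [A],
    so it suffices to compare them on boxes, whose preimages are boxes up to their faces. *)
Lemma lebesgue_row_affine (c : 'rV[R]_d) (s : R) (A : set 'rV[R]_d) :
  s != 0 -> measurable A ->
  lebesgue_row ((fun y => c + s *: y) @^-1` A) =
  ((`|s| ^- d)%:E * lebesgue_row A)%E.
Proof.
move=> s0 mA.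
have k0 : 0 <= `|s| ^- d by rewrite invr_ge0 exprn_ge0.
pose m1 := measure_function_pushforward__canonical__measure_function_Measure
  (@lebesgue_row R d) (measurable_affine_row c s).
pose m2 : {measure set 'rV[R]_d -> \bar R} := mscale (NngNum k0) (@lebesgue_row R d).
have box u v : (forall i, u ord0 i <= v ord0 i) ->
    m1 (half_open_box u v) = (`|s| ^- d * \prod_(i < d) (v ord0 i - u ord0 i))%:E.
  move=> uv; rewrite /m1/= /pushforward.
  pose a i := (u ord0 i - c ord0 i) / s.
  pose b i := (v ord0 i - c ord0 i) / s.
  rewrite (@lebesgue_row_squeeze (\row_i Num.min (a i) (b i)) (\row_i Num.max (a i) (b i))).
  - congr (_%:E); transitivity (\prod_(i < d) (`|s|^-1 * (v ord0 i - u ord0 i))); last first.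
      by rewrite big_split/= prodr_const card_ord exprVn.
    apply: eq_bigr => i _; rewrite !mxE; have := uv i; rewrite /a /b => uvi.
    have [sp|sn] : 0 < s \/ s < 0 by apply/orP; rewrite -neq_lt eq_sym.
      rewrite (gtr0_norm sp) max_r ?min_l ?ler_pM2r ?invr_gt0 ?lerD2r//.
      by field; exact: s0.
    rewrite (ltr0_norm sn) max_l ?min_r ?ler_nM2r ?invr_lt0 ?lerD2r//.
    by field; exact: s0.
  - rewrite -[X in measurable X]setTI; apply: measurable_affine_row => //.
    exact: measurable_half_open_box.
  - by move=> i; rewrite !mxE ge_min le_max lexx.
  - move=> x xab i; have := xab i; rewrite !mxE gt_min lt_max /a /b.
    have [sp|sn] : 0 < s \/ s < 0 by apply/orP; rewrite -neq_lt eq_sym.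
      rewrite !(ltr_pdivrMr _ _ sp) !(ltr_pdivlMr _ _ sp); have := uv i.
      by rewrite ![x _ _ * s]mulrC; lra.
    rewrite !(ltr_ndivrMr _ _ sn) !(ltr_ndivlMr _ _ sn); have := uv i.
    by rewrite ![x _ _ * s]mulrC; lra.
  - move=> x /= xab i; have := xab i; rewrite !mxE ge_min le_max /a /b.
    have [sp|sn] : 0 < s \/ s < 0 by apply/orP; rewrite -neq_lt eq_sym.
      rewrite !(ler_pdivrMr _ _ sp) !(ler_pdivlMr _ _ sp); have := uv i.
      by rewrite ![x _ _ * s]mulrC; lra.
    rewrite !(ler_ndivrMr _ _ sn) !(ler_ndivlMr _ _ sn); have := uv i.
    by rewrite ![x _ _ * s]mulrC; lra.
have := @measure_row_unique m1 m2 _ _ A mA; apply.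
- move=> u v uv; rewrite box// /m2/= /mscale/= EFinM; congr (_ * _)%E.
  by rewrite lebesgue_row_box.
- by move=> u v uv; rewrite box// ltry.
Qed.

Lemma integral_affine_row (c : 'rV[R]_d) (s : R) (phi : 'rV[R]_d -> \bar R) :
  s != 0 -> measurable_fun setT phi -> (forall y, 0 <= phi y)%E ->
  (\int[lebesgue_row]_y phi (c + s *: y)%R =
   (`|s| ^- d)%:E * \int[lebesgue_row]_y phi y)%E.
Proof.
move=> s0 mphi phi0.
have k0 : 0 <= `|s| ^- d by rewrite invr_ge0 exprn_ge0.
rewrite -[LHS](@ge0_integral_pushforward _ _ _ _ R _
  (measurable_affine_row c s) (@lebesgue_row R d) setT phi)//.
rewrite -(ge0_integral_mscale (@lebesgue_row R d) measurableT (NngNum k0))//.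
apply: eq_measure_integral => [|? A mA _]; first exact: measurable_affine_row.
exact: (lebesgue_row_affine c s0 mA).
Qed.

Definition sup_ball x (r : R) := [set y : 'rV[R]_d | `|y - x| <= r].

Lemma measurable_sup_ball x r : measurable (sup_ball x r).
Proof.
have [r0|r0] := ltP r 0.
  rewrite (_ : sup_ball x r = set0) -?subset0// => y /=.
  by move=> /(le_trans (normr_ge0 _)); rewrite leNgt r0.
rewrite (_ : sup_ball x r = \bigcap_(i in [set: 'I_d])
    ((fun y : 'rV[R]_d => y ord0 i - x ord0 i) @^-1`
       (`[- r, r]%classic : set (measurableTypeR R)))).
  apply: fin_bigcap_measurable => // i _; rewrite -[X in measurable X]setTI.
  have : measurable_fun setT (fun y : 'rV[R]_d => y ord0 i - x ord0 i).
    by apply: measurable_funB => //; exact: measurable_coord.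
  by apply => //; exact: measurable_itv.
apply/seteqP; split => y /=.
  by move=> /(normr_rowP _ r0) yx i _; have := yx i; rewrite /= in_itv/= !mxE ler_norml.
move=> yx; apply/(normr_rowP _ r0) => i.
by have := yx i I; rewrite /= in_itv/= !mxE ler_norml.
Qed.

(** The cube of side [h] at the corner [x], in the orthant pointing towards [x0]: each coordinate
    moves towards that of [x0] and overshoots it by at most [h]. So even for [x] on the boundary of
    a ball around [x0] the cube stays in that ball, provided [h] is at most the radius. *)
Lemma orthant_box x x0 (h : R) : 0 < h ->
  exists B : set 'rV[R]_d, [/\ measurable B, lebesgue_row B = (h ^+ d)%:E,
    B `<=` sup_ball x h & B `<=` sup_ball x0 (Num.max `|x - x0| h)].
Proof.
move=> h0.
pose u : 'rV[R]_d := \row_i (if x0 ord0 i <= x ord0 i then x ord0 i - h else x ord0 i).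
pose v : 'rV[R]_d := \row_i (if x0 ord0 i <= x ord0 i then x ord0 i else x ord0 i + h).
exists (half_open_box u v); split.
- exact: measurable_half_open_box.
- rewrite lebesgue_row_box; last by move=> i; rewrite !mxE; case: ifPn => _; lra.
  congr (_%:E); rewrite -[X in _ ^+ X]card_ord -prodr_const; apply: eq_bigr => i _.
  by rewrite !mxE; case: ifPn => _; lra.
- move=> y yuv; apply/normr_rowP; first exact: ltW.
  move=> i; have := yuv i; rewrite !mxE ler_norml.
  by case: ifPn => _ /andP[? ?]; lra.
- move=> y yuv; apply/normr_rowP; first by rewrite le_max normr_ge0.
  move=> i; have := yuv i; rewrite !mxE le_max.
  have := coord_le_normr (x - x0) i; rewrite !mxE => xi.
  case: ifPn => [xx0|]; last rewrite -ltNge => xx0.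
    rewrite ger0_norm in xi; last lra.
    move=> /andP[y1 y2]; have [yx0|yx0] := leP (x0 ord0 i) (y ord0 i).
      by rewrite ger0_norm; [apply/orP; left; lra|lra].
    by rewrite ltr0_norm; [apply/orP; right; lra|lra].
  rewrite ltr0_norm in xi; last lra.
  move=> /andP[y1 y2]; have [yx0|yx0] := leP (x0 ord0 i) (y ord0 i).
    by rewrite ger0_norm; [apply/orP; right; lra|lra].
  by rewrite ltr0_norm; [apply/orP; left; lra|lra].
Qed.

Lemma cvg_integral_sup_ball (p : 'rV[R]_d -> \bar R) :
  measurable_fun setT p -> (forall x, 0 <= p x)%E ->
  (\int[lebesgue_row]_(x in sup_ball 0%R n%:R) p x)%E @[n --> \oo] -->
  (\int[lebesgue_row]_x p x)%E.
Proof.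
move=> mp p0.
under eq_fun do rewrite integral_mkcond.
have -> : (\int[lebesgue_row]_x p x =
    \int[lebesgue_row]_x limn (fun n : nat => (p \_ (sup_ball 0%R n%:R)) x))%E.
  apply: eq_integral => x _; apply/esym/cvg_lim => //.
  apply: cvg_near_cst.
  have [n xn] : exists n : nat, `|x| < n%:R.
    by exists (Num.truncn `|x|).+1; exact: truncnS_gt.
  exists n => // m /= nm; rewrite /patch mem_set//= /sup_ball/= subr0.
  by rewrite (le_trans (ltW xn))// ler_nat.
apply: cvg_monotone_convergence => //.
- by move=> n; apply/(measurable_restrictT _ _).1; [exact: measurable_sup_ball|exact: measurable_funS mp].
- by move=> n x _; rewrite /patch; case: ifPn.
- move=> x _ m n mn; apply: restrict_lee => // y; rewrite /sup_ball /= => /le_trans; apply.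
  by rewrite ler_nat.
Qed.

Lemma density_concentrated (p : 'rV[R]_d -> R) : is_density p ->
  forall e : R, 0 < e -> exists2 M : R, 0 < M &
    ((1 - e)%:E <= \int[lebesgue_row]_(x in sup_ball 0%R M) (p x)%:E)%E.
Proof.
move=> [mp p0 ip] e e0.
have mp' : measurable_fun setT (fun x => (p x)%:E) by exact/measurable_EFinP.
have cvgp := cvg_integral_sup_ball mp' (fun x => p0 x).
have [//|H] := pselect (exists2 M : R, 0 < M &
  ((1 - e)%:E <= \int[lebesgue_row]_(x in sup_ball 0%R M) (p x)%:E)%E).
have : (1 <= (1 - e)%:E)%E.
  rewrite -ip; apply: cvge_le cvgp; near=> n.
  rewrite leNgt; apply/negP => /ltW n1; apply: H; exists n%:R => //.
  by rewrite ltr0n; near: n; exact: nbhs_infty_gt.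
by rewrite leNgt lte_fin ltrBlDr ltrDl e0.
Unshelve. all: by end_near. Qed.

(** * Rescaled kernels *)

Section rescaled.
Variable K : 'rV[R]_d -> R.
Hypothesis hK : is_density K.

Lemma measurable_rescaled (b : R) : measurable_fun setT (rescaled K b).
Proof.
have [mK _ _] := hK; rewrite /rescaled; apply: measurable_funM => //.
by apply: (measurableT_comp mK); apply: measurable_fun_rowZ.
Qed.

Lemma rescaled_ge0 (b : R) x : 0 < b -> 0 <= rescaled K b x.
Proof.
have [_ K0 _] := hK.
by move=> b0; rewrite /rescaled mulr_ge0// invr_ge0 exprn_ge0// ltW.
Qed.

(** Only |s| is fixed, which serves both the mass in x of K_b(x - X) and the mass in y of K_b(x -
    y); the factor b^-d cancels the Jacobian. *)
Lemma integral_rescaled_affine (b s : R) (c : 'rV[R]_d)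
    (A : set 'rV[R]_d) : 0 < b -> `|s| = b^-1 -> measurable A ->
  (\int[lebesgue_row]_(y in (fun y => c + s *: y)%R @^-1` A)
     (b ^- d * K (c + s *: y))%:E =
   \int[lebesgue_row]_(z in A) (K z)%:E)%E.
Proof.
move=> b0 sb mA; have [mK K0 _] := hK.
have s0 : s != 0 by rewrite -normr_eq0 sb gt_eqF// invr_gt0.
have mKE : measurable_fun setT (fun z => (K z)%:E) by exact/measurable_EFinP.
rewrite [LHS]integral_mkcond.
rewrite (_ : _ \_ _ = fun y => ((b ^- d)%:E * ((fun z => (K z)%:E) \_ A) (c + s *: y)%R)%E).
  rewrite ge0_integralZl//.
  - rewrite integral_affine_row//; last 2 first.
    + by apply/(measurable_restrictT _ _).1 => //; exact: measurable_funS mKE.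
    + by move=> y; rewrite /patch; case: ifPn; rewrite ?lee_fin.
    rewrite muleA -EFinM sb exprVn invrK mulVf ?mul1e -?integral_mkcond//.
    by rewrite expf_neq0// gt_eqF.
  - apply: measurableT_comp; last exact: measurable_affine_row.
    by apply/(measurable_restrictT _ _).1 => //; exact: measurable_funS mKE.
  - by move=> y _; rewrite /patch; case: ifPn; rewrite ?lee_fin.
  - by rewrite lee_fin invr_ge0 exprn_ge0// ltW.
apply/funext => y; rewrite /patch /=.
have [yA|yA] := pselect (A (c + s *: y)); first by rewrite !mem_set// EFinM.
by rewrite !memNset// mule0.
Qed.

Lemma integral_rescaled (b : R) (X : 'rV[R]_d) : 0 < b ->
  (\int[lebesgue_row]_x (rescaled K b (x - X))%:E = 1)%E.
Proof.
move=> b0; have [_ _ <-] := hK.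
rewrite -(@integral_rescaled_affine b b^-1 (- (b^-1 *: X)) setT)//.
  by rewrite preimage_setT; apply: eq_integral => y _; rewrite /rescaled scalerBr addrC.
by rewrite gtr0_norm// invr_gt0.
Qed.

Lemma integral_rescaled_sub (b : R) (x : 'rV[R]_d) : 0 < b ->
  (\int[lebesgue_row]_y (rescaled K b (x - y))%:E = 1)%E.
Proof.
move=> b0; have [_ _ <-] := hK.
rewrite -(@integral_rescaled_affine b (- b^-1) (b^-1 *: x) setT)//.
  by rewrite preimage_setT; apply: eq_integral => y _; rewrite /rescaled scalerBr scaleNr.
by rewrite normrN gtr0_norm// invr_gt0.
Qed.

(** A ball of radius [M] carrying all but [e] of the mass of [K] shrinks to radius [b * M], which is
    at most [delta] once [b <= delta / M], whatever [x] is. *)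
Lemma rescaled_concentrated (delta e : R) : 0 < delta -> 0 < e ->
  exists2 beta : R, 0 < beta & forall b x, 0 < b <= beta ->
  ((1 - e)%:E <=
    \int[lebesgue_row]_(y in sup_ball x delta) (rescaled K b (x - y))%:E)%E.
Proof.
move=> d0 e0; have [M M0 HM] := density_concentrated hK e0.
exists (delta / M); first exact: divr_gt0.
move=> b x /andP[b0 bM]; apply: le_trans HM _.
rewrite -(@integral_rescaled_affine b (- b^-1) (b^-1 *: x))//; last 2 first.
- by rewrite normrN gtr0_norm// invr_gt0.
- exact: measurable_sup_ball.
have E y : rescaled K b (x - y) = b ^- d * K (b^-1 *: x + - b^-1 *: y).
  by rewrite /rescaled scalerBr scaleNr.
under [leRHS]eq_integral do rewrite E.
apply: ge0_subset_integral.
- rewrite -[X in measurable X]setTI; apply: measurable_affine_row => //.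
  exact: measurable_sup_ball.
- exact: measurable_sup_ball.
- apply: measurable_funTS; apply/measurable_EFinP.
  have [mK _ _] := hK; apply: measurable_funM => //.
  by apply: (measurableT_comp mK); exact: measurable_affine_row.
- by move=> y _; rewrite -E lee_fin rescaled_ge0.
- move=> y; rewrite /sup_ball /= subr0 scaleNr -scalerBr normrZ.
  rewrite gtr0_norm ?invr_gt0// distrC ler_pdivrMl// => /le_trans; apply.
  by rewrite -ler_pdivlMr.
Qed.

End rescaled.

End row_vectors.

(** * Scalar recursions *)

Section recursive_inequalities.
Context {R : realType}.
Variables (gamma : R^nat) (C : R).
Hypothesis C0 : 0 < C.
Hypothesis gamma_ge : forall n, (1 <= n)%N -> n%:R^-1 <= C * gamma n.

(** Below [L] the increments are at least kappa/(C n), whose sum diverges, so [v] cannot stay below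
    [L]; and once above, it remains there. *)
Lemma eventually_above (v : R^nat) (n0 : nat) (L kappa : R) : 0 < kappa ->
  (forall n, (n0 <= n)%N -> v n < L -> v n + gamma n.+1 * kappa <= v n.+1) ->
  (forall n, (n0 <= n)%N -> L <= v n -> L <= v n.+1) ->
  \forall n \near \oo, L <= v n.
Proof.
move=> k0 vlt vge.
suff [N n0N LN] : exists2 N, (n0 <= N)%N & L <= v N.
  exists N => // n /= Nn; rewrite -(subnK Nn).
  elim: (n - N)%N => [//|k ih]; rewrite addSn; apply: vge => //.
  by rewrite (leq_trans n0N)// leq_addl.
apply: contrapT => H.
have vL n : (n0 <= n)%N -> v n < L.
  by move=> n0n; rewrite ltNge; apply/negP => Ln; apply: H; exists n.
(* [harmonic n] is 1/(n+1), which matches the lower bound on [gamma n.+1]. *)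
have step m : v n0 + kappa / C * (series harmonic (n0 + m)%N - series harmonic n0) <= v (n0 + m)%N.
  elim: m => [|m ih]; first by rewrite addn0 subrr mulr0 addr0.
  rewrite addnS seriesSr; apply: le_trans (vlt _ (leq_addr _ _) (vL _ (leq_addr _ _))).
  rewrite addrAC mulrDr addrA; apply: lerD => //.
  rewrite -mulrA mulrC ler_wpM2r// ?(ltW k0)// /harmonic/= ler_pdivrMl//.
  exact: gamma_ge.
apply: (@dvg_harmonic R); apply: nondecreasing_is_cvgn.
  by apply: nondecreasing_series => n _ _; exact: harmonic_ge0.
exists (series harmonic n0 + C / kappa * (L - v n0)) => _ [n _ <-].
have le_h : series (@harmonic R) n <= series harmonic (n0 + n)%N.
  apply: (@nondecreasing_series _ _ xpredT 0%N) => [k _ _|]; first exact: harmonic_ge0.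
  by rewrite leq_addl.
apply: (le_trans le_h).
have := ltW (le_lt_trans (step n) (vL _ (leq_addr n n0))).
set X := series harmonic _; set Y := series harmonic n0 => H2.
have : kappa / C * (X - Y) <= L - v n0 by lra.
by rewrite mulrC -ler_pdivlMr ?divr_gt0// invf_div; lra.
Qed.

Variable n0 : nat.
Hypothesis gamma01 : forall n, (n0 < n)%N -> 0 < gamma n <= 1.

(** c / (1 - theta) is the fixed point of u |-> theta u + c. Above it by more than [e], the drift is
    at least (1 - theta) e downwards, so [eventually_above] applies to - u. *)
Lemma contraction_le (u : R^nat) (theta c e : R) : 0 <= theta < 1 -> 0 < e ->
  (forall n, (n0 <= n)%N ->
    u n.+1 <= (1 - gamma n.+1) * u n + gamma n.+1 * (theta * u n + c)) ->
  \forall n \near \oo, u n <= c / (1 - theta) + e.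
Proof.
move=> /andP[th0 th1] e0 uS.
have t0 : 0 < 1 - theta by rewrite subr_gt0.
set L := c / (1 - theta) + e.
have LE : c = (1 - theta) * L - (1 - theta) * e.
  by rewrite /L mulrDr mulrCA mulfV ?mulr1 ?addrK// gt_eqF.
have te : 0 < (1 - theta) * e by rewrite mulr_gt0.
suff : \forall n \near \oo, - L <= - u n.
  by apply: filterS => n; rewrite lerN2.
apply: (@eventually_above (fun n => - u n) n0 _ ((1 - theta) * e)) => //.
  move=> n n0n; rewrite ltrN2 => Lu.
  have /andP[g0 g1] := gamma01 (n0n : (n0 < n.+1)%N).
  have := uS n n0n; have : (1 - theta) * L <= (1 - theta) * u n by rewrite ler_wpM2l// ltW.
  rewrite -(ler_pM2l g0); rewrite LE; lra.
move=> n n0n; rewrite !lerN2 => uL.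
have /andP[g0 g1] := gamma01 (n0n : (n0 < n.+1)%N).
apply: (le_trans (uS n n0n)).
have h1 : (1 - gamma n.+1) * u n <= (1 - gamma n.+1) * L by rewrite ler_wpM2l// subr_ge0.
have h2 : gamma n.+1 * (theta * u n) <= gamma n.+1 * (theta * L).
  by rewrite !ler_wpM2l// ltW.
have := mulr_gt0 g0 te; move: h1 h2; rewrite LE; lra.
Qed.

(** The map is v (l / v)^eta, so below [L] it multiplies by at least [r] > 1, while it maps [L, +oo[
    into itself. The gain v (r - 1) is bounded away from 0 because [v] never goes below [m]; a
    positive start is essential, 0 being a fixed point when [eta < 1]. *)
Lemma concave_ge (v : R^nat) (eta l L : R) : 0 < eta <= 1 -> 0 < L < l ->
  0 < v n0 ->
  (forall n, (n0 <= n)%N -> (1 - gamma n.+1) * v n +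
     gamma n.+1 * (l `^ eta * v n `^ (1 - eta)) <= v n.+1) ->
  \forall n \near \oo, L <= v n.
Proof.
move=> /andP[eta0 eta1] /andP[L0 Ll] v0 vS.
have l0 := lt_trans L0 Ll.
pose m := Num.min (v n0) L.
have m0 : 0 < m by rewrite lt_min v0.
pose r := (l / L) `^ eta.
have r1 : 1 < r.
  rewrite /r (_ : 1 = 1 `^ eta); last by rewrite powR1.
  rewrite gt0_ltr_powR// ?nnegrE ?ler01 ?divr_ge0 ?(ltW l0) ?(ltW L0)//.
  by rewrite ltr_pdivlMr// mul1r.
have phiE x : 0 < x -> l `^ eta * x `^ (1 - eta) = x * (l / x) `^ eta.
  move=> x0; rewrite powRM ?(ltW l0) ?invr_ge0 ?(ltW x0)//.
  rewrite -powR_inv1 ?(ltW x0)// -powRrM mulN1r mulrCA; congr (_ * _).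
  by rewrite -{2}[x]powRr1 ?(ltW x0)// -powRD// (gt_eqF x0) implybT.
have phi_low x : 0 < x < L -> x * r <= l `^ eta * x `^ (1 - eta).
  move=> /andP[x0 xL]; rewrite phiE// ler_pM2l// ge0_ler_powR ?nnegrE ?divr_ge0 ?(ltW l0) ?(ltW L0) ?(ltW x0) ?(ltW eta0)//.
  by rewrite ler_pM2l// lef_pV2 ?posrE// ltW.
have phi_high x : L <= x -> L <= l `^ eta * x `^ (1 - eta).
  move=> Lx; apply: (@le_trans _ _ (l `^ eta * L `^ (1 - eta))).
    rewrite phiE//; rewrite -[leLHS]mulr1 ler_pM2l// ltW//.
  rewrite ler_wpM2l ?powR_ge0// ge0_ler_powR ?nnegrE ?subr_ge0 ?(ltW L0)//.
  exact: le_trans (ltW L0) Lx.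
have stepge n : (n0 <= n)%N -> L <= v n -> L <= v n.+1.
  move=> n0n Lv; have /andP[g0 g1] := gamma01 (n0n : (n0 < n.+1)%N).
  apply: le_trans (vS n n0n).
  have h1 : (1 - gamma n.+1) * L <= (1 - gamma n.+1) * v n by rewrite ler_wpM2l// subr_ge0.
  have := phi_high _ Lv; rewrite -(ler_pM2l g0); lra.
have steplt n : (n0 <= n)%N -> m <= v n -> v n < L ->
    v n + gamma n.+1 * (m * (r - 1)) <= v n.+1.
  move=> n0n mv vL; have /andP[g0 g1] := gamma01 (n0n : (n0 < n.+1)%N).
  apply: le_trans (vS n n0n).
  have vp := lt_le_trans m0 mv.
  have := phi_low (v n); rewrite vp vL -(ler_pM2l g0) => /(_ isT).
  have : gamma n.+1 * (m * (r - 1)) <= gamma n.+1 * (v n * (r - 1)).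
    by rewrite ler_pM2l// ler_pM2r// subr_gt0.
  lra.
have mr : 0 < m * (r - 1) by rewrite mulr_gt0// subr_gt0.
have vm n : (n0 <= n)%N -> m <= v n.
  move=> n0n; rewrite -(subnKC n0n); elim: (n - n0)%N => [|k ih].
    by rewrite addn0 ge_min lexx.
  rewrite addnS; have [vL|Lv] := ltP (v (n0 + k)%N) L.
    have := steplt _ (leq_addr _ _) ih vL; apply: le_trans.
    apply: (le_trans ih); rewrite lerDl mulr_ge0// ?(ltW mr)//.
    by have /andP[/ltW] := gamma01 (leq_addr k n0 : (n0 < (n0 + k).+1)%N).
  by rewrite ge_min (stepge _ (leq_addr _ _) Lv) orbT.
apply: (@eventually_above v n0 L (m * (r - 1))) => //.
by move=> n n0n; apply: steplt => //; exact: vm.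
Qed.

End recursive_inequalities.

(** * Mollification *)

Section mollification.
Context {R : realType} {d : nat}.
Implicit Types (x y z : 'rV[R]_d) (p : 'rV[R]_d -> R).
Variable K : 'rV[R]_d -> R.
Hypothesis hK : is_density K.

Let measurable_integrand p (b : R) x : measurable_fun setT p ->
  measurable_fun setT (fun y => p y * rescaled K b (x - y)).
Proof.
move=> mp; apply: measurable_funM => //.
apply: (measurableT_comp (measurable_rescaled hK b)).
by apply: measurable_fun_rowB.
Qed.

(** Giving [D] by an equation between extended reals makes the finiteness of the convolution part of
    the hypothesis. *)
Lemma mollified_ge p (b m kappa D : R) x (S : set 'rV[R]_d) :
  measurable_fun setT p -> (forall y, 0 <= p y) -> measurable S ->
  0 < b -> 0 <= m -> (forall y, S y -> m <= p y) ->
  (kappa%:E <= \int[lebesgue_row]_(y in S) (rescaled K b (x - y))%:E)%E ->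
  (D%:E = \int[lebesgue_row]_y (p y * rescaled K b (x - y))%:E)%E ->
  m * kappa <= D.
Proof.
move=> mp p0 mS b0 m0 mS_p kS DE.
have mr : measurable_fun setT (fun y => (rescaled K b (x - y))%:E).
  apply/measurable_EFinP/(measurableT_comp (measurable_rescaled hK b)).
  exact: measurable_fun_rowB.
rewrite -lee_fin DE EFinM.
apply: (@le_trans _ _ (\int[lebesgue_row]_(y in S) (m%:E * (rescaled K b (x - y))%:E))%E).
  rewrite ge0_integralZl//; first by apply: lee_wpmul2l.
  - exact: measurable_funTS.
  - by move=> y _; rewrite lee_fin rescaled_ge0.
apply: (@le_trans _ _ (\int[lebesgue_row]_(y in S) (p y * rescaled K b (x - y))%:E)%E).
  apply: ge0_le_integral => //.
  - by move=> y _; rewrite mule_ge0// lee_fin// rescaled_ge0.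
  - by apply: measurable_funTS; exact: measurable_funeM.
  - by apply: measurable_funTS; apply/measurable_EFinP; exact: measurable_integrand.
  - by move=> y Sy; rewrite -EFinM lee_fin ler_wpM2r ?rescaled_ge0// mS_p.
apply: ge0_subset_integral => //; first by apply/measurable_EFinP; exact: measurable_integrand.
by move=> y _; rewrite lee_fin mulr_ge0// rescaled_ge0.
Qed.

(** Within distance [delta] of [x], bound [p] by [m] and use that the kernel has mass 1; farther
    away, bound the kernel by [o] and use that [p] has mass at most 1. *)
Lemma mollified_le p (b m o delta D : R) x :
  measurable_fun setT p -> (forall y, 0 <= p y) ->
  (\int[lebesgue_row]_y (p y)%:E <= 1)%E ->
  0 < b -> 0 <= m -> 0 <= o ->
  (forall y, `|y - x| <= delta -> p y <= m) ->
  (forall z, delta <= `|z| -> rescaled K b z <= o) ->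
  (D%:E = \int[lebesgue_row]_y (p y * rescaled K b (x - y))%:E)%E ->
  D <= m + o.
Proof.
move=> mp p0 ip b0 m0 o0 pm ro DE.
have mr : measurable_fun setT (fun y => (rescaled K b (x - y))%:E).
  apply/measurable_EFinP/(measurableT_comp (measurable_rescaled hK b)).
  exact: measurable_fun_rowB.
have r0 z := rescaled_ge0 hK z b0.
have mpE : measurable_fun setT (fun y => (p y)%:E) by exact/measurable_EFinP.
rewrite -lee_fin DE.
apply: (@le_trans _ _ (\int[lebesgue_row]_y
    (m%:E * (rescaled K b (x - y))%:E + o%:E * (p y)%:E))%E).
  apply: ge0_le_integral => //.
  - by move=> y _; rewrite lee_fin mulr_ge0.
  - by apply/measurable_EFinP; exact: measurable_integrand.
  - by apply: emeasurable_funD; exact: measurable_funeM.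
  - move=> y _; rewrite -!EFinM -EFinD lee_fin.
    have [yx|yx] := leP `|y - x| delta.
      rewrite -[leLHS]addr0; apply: lerD; last exact: mulr_ge0.
      by apply: ler_wpM2r; [exact: r0|exact: pm].
    rewrite -[leLHS]add0r; apply: lerD; first exact: mulr_ge0.
    by rewrite mulrC; apply: ler_wpM2r => //; apply: ro; rewrite distrC ltW.
rewrite ge0_integralD//; last 4 first.
- by move=> y _; rewrite -EFinM lee_fin mulr_ge0.
- exact: measurable_funeM.
- by move=> y _; rewrite -EFinM lee_fin mulr_ge0.
- exact: measurable_funeM.
rewrite !ge0_integralZl ?lee_fin//; last 2 first.
- by move=> y _; rewrite lee_fin.
- by move=> y _; rewrite lee_fin.
rewrite integral_rescaled_sub// mule1 EFinD leeD2l//.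
by rewrite -[leRHS]mule1 lee_wpmul2l.
Qed.

(** On the orthant cube of side [b * rho0] the kernel is at least b^-d k0, so its mass there is at
    least k0 rho0^d, independently of [b]. *)
Lemma rescaled_orthant (k0 rho0 b r : R) x x0 : (1 <= d)%N ->
  0 < k0 -> 0 < rho0 -> (forall z, `|z| <= rho0 -> k0 <= K z) ->
  0 < b -> `|x - x0| <= r -> b * rho0 <= r ->
  ((k0 * rho0 ^+ d)%:E <=
     \int[lebesgue_row]_(y in sup_ball x0 r) (rescaled K b (x - y))%:E)%E.
Proof.
move=> d1 k00 rho00 Kk0 b0 xr br.
have h0 : 0 < b * rho0 by rewrite mulr_gt0.
have mr : measurable_fun setT (fun y => (rescaled K b (x - y))%:E).
  apply/measurable_EFinP/(measurableT_comp (measurable_rescaled hK b)).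
  exact: measurable_fun_rowB.
have [B [mB BE Bx Bx0]] := orthant_box x x0 h0.
have BS : B `<=` sup_ball x0 r.
  by move=> y /Bx0 /le_trans; apply; rewrite ge_max xr.
apply: (@le_trans _ _ (\int[lebesgue_row]_(y in B) (rescaled K b (x - y))%:E)%E); last first.
  apply: ge0_subset_integral => //; first exact: measurable_sup_ball.
    exact: measurable_funTS.
  by move=> y _; rewrite lee_fin rescaled_ge0.
apply: (@le_trans _ _ (\int[lebesgue_row]_(y in B) (cst (b ^- d * k0)%:E y))%E).
  rewrite integral_cst//= [in leRHS]BE -EFinM lee_fin exprMn mulrACA mulrA.
  by rewrite mulVf ?mul1r// expf_neq0// gt_eqF.
have bd0 : 0 <= b ^- d by rewrite invr_ge0 exprn_ge0// ltW.
apply: ge0_le_integral => //.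
- by move=> y _; rewrite lee_fin mulr_ge0// ltW.
- exact: measurable_funTS.
- move=> y By; rewrite lee_fin ler_wpM2l// Kk0// normrZ gtr0_norm ?invr_gt0//.
  by rewrite ler_pdivrMl// distrC Bx.
Qed.

(** Since |z|^(d + r') K(z) is bounded by CK, K_b(z) <= CK b^r' |z|^-(d + r'): the power d of b
    cancels and b^r' remains. [beta] solves A beta^r' = o. *)
Lemma rescaled_tail (r' CK delta o : R) : 0 < r' -> 0 < CK ->
  (forall z, `|z| `^ (d%:R + r') * K z <= CK) -> 0 < delta -> 0 < o ->
  exists2 beta : R, 0 < beta & forall b z, 0 < b <= beta -> delta <= `|z| ->
    rescaled K b z <= o.
Proof.
move=> r0 CK0 Ktail delta0 o0.
pose A := CK * (delta `^ (d%:R + r'))^-1.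
have A0 : 0 < A by rewrite mulr_gt0// invr_gt0 powR_gt0.
exists ((o / A) `^ r'^-1); first by rewrite powR_gt0// divr_gt0.
move=> b z /andP[b0 bb] dz.
have z0 : 0 < `|z| by exact: lt_le_trans dz.
have w0 : 0 < `|b^-1 *: z| by rewrite normrZ mulr_gt0// normr_gt0 invr_neq0// gt_eqF.
apply: (@le_trans _ _ (b ^- d * (CK * (`|b^-1 *: z| `^ (d%:R + r'))^-1))).
  rewrite ler_wpM2l ?invr_ge0 ?exprn_ge0 ?(ltW b0)//.
  by rewrite ler_pdivlMr ?powR_gt0// mulrC Ktail.
apply: (@le_trans _ _ (A * b `^ r')).
  rewrite normrZ gtr0_norm ?invr_gt0// powRM ?invr_ge0 ?(ltW b0)//.
  have -> : b^-1 `^ (d%:R + r') = (b `^ (d%:R + r'))^-1.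
    by rewrite -[in LHS]powR_inv1 ?(ltW b0)// -powRrM mulN1r powRN.
  rewrite invfM invrK.
  rewrite powRD; last by rewrite (gt_eqF b0) implybT.
  rewrite powR_mulrn ?(ltW b0)//.
  rewrite (_ : b ^- d * _ = CK * b `^ r' * (`|z| `^ (d%:R + r'))^-1); last first.
    by field; rewrite !gt_eqF ?powR_gt0// exprn_gt0.
  rewrite /A mulrAC ler_wpM2r ?powR_ge0// ler_pM2l// lef_pV2 ?posrE ?powR_gt0//.
  by rewrite ge0_ler_powR ?nnegrE ?(ltW delta0)// addr_ge0// ltW.
rewrite mulrC -ler_pdivlMr//.
rewrite (_ : o / A = ((o / A) `^ r'^-1) `^ r'); last first.
  by rewrite -powRrM mulVf ?gt_eqF// powRr1// divr_ge0// ltW.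
by rewrite ge0_ler_powR ?nnegrE ?powR_ge0 ?(ltW r0) ?(ltW b0).
Qed.

End mollification.

Lemma geometric_mean_le {R : realType} (eta s t : R) : 0 < eta <= 1 ->
  0 <= s -> 0 <= t -> s `^ eta * t `^ (1 - eta) <= eta * s + (1 - eta) * t.
Proof.
move=> /andP[eta0 eta1] s0 t0.
(* Young's inequality with exponents 1/eta and 1/(1 - eta) requires [eta < 1]. *)
have [->|etaN1] := eqVneq eta 1.
  by rewrite subrr powRr0 mulr1 powRr1// mul1r mul0r addr0.
have e1 : 0 < 1 - eta by rewrite subr_gt0 lt_neqAle etaN1.
have := @conjugate_powR R (s `^ eta) (t `^ (1 - eta)) eta^-1 (1 - eta)^-1.
rewrite !invrK -!powRrM !mulfV ?gt_eqF// !powRr1// !invr_gt0 !powR_ge0.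
by move=> /(_ isT isT eta0 e1); rewrite subrKC mulrC [t * _]mulrC [eta * s]mulrC; apply.
Qed.

(** * The deterministic part of the convergence *)

Section deterministic.
Context {R : realType} {d : nat}.
Implicit Types (x y z : 'rV[R]_d).
Hypothesis d1 : (1 <= d)%N.
Variables (eta : R) (f q0 K : 'rV[R]_d -> R) (gamma b lambda : R^nat).
Hypothesis eta01 : 0 < eta <= 1.
Hypotheses (hf : is_density f) (cf : continuous f) (hq0 : is_density q0).
Variables (Mf Mq c0 : R).
Hypotheses (fM : forall x, f x <= Mf) (q0M : forall x, q0 x <= Mq).
Hypotheses (c00 : 0 < c0) (fq0 : forall x, c0 * f x <= q0 x).
Hypothesis hK : is_density K.
Variables (k0 rho0 : R).
Hypotheses (k00 : 0 < k0) (rho00 : 0 < rho0).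
Hypothesis Kk0 : forall z, `|z| <= rho0 -> k0 <= K z.
Variables (r' CK MK : R).
Hypothesis KM : forall z, K z <= MK.
Hypotheses (r'0 : 0 < r') (CK0 : 0 < CK).
Hypothesis Ktail : forall z, `|z| `^ (d%:R + r') * K z <= CK.
Variables (Cg : R) (n0 : nat).
Hypotheses (Cg0 : 0 < Cg)
  (gamma_ge : forall n, (1 <= n)%N -> n%:R^-1 <= Cg * gamma n)
  (gamma01 : forall n, (n0 < n)%N -> 0 < gamma n <= 1).
Hypotheses (b0 : forall n, (n0 <= n)%N -> 0 < b n) (b_cvg : b @ \oo --> 0).
Hypotheses (lambda01 : forall n, (n0 <= n)%N -> 0 < lambda n <= 1)
  (lambda_decr : forall n, (n0 <= n)%N -> lambda n.+1 <= lambda n)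
  (lambda_cvg : lambda @ \oo --> 0).

(* In the application [G n] is g_n / c_u^eta, [I n] its mass, and [D n] follows
   the recursion of [G n] with increments replaced by their conditional means
   [Delta n]; [GD] and [I_le] are the almost sure estimates. *)
Variables (G D Delta q : nat -> 'rV[R]_d -> R) (I : R^nat).
Let p n y := f y `^ eta * q n y `^ (1 - eta).

Hypotheses (G0 : forall n x, (n0 <= n)%N -> 0 <= G n x)
  (mG : forall n, (n0 <= n)%N -> measurable_fun setT (G n))
  (IE : forall n, (n0 <= n)%N ->
    ((I n)%:E = \int[lebesgue_row]_x (G n x)%:E)%E)
  (I0 : forall n, (n0 <= n)%N -> 0 < I n)
  (qE : forall n x, (n0 <= n)%N ->
    q n x = (1 - lambda n) * (G n x / I n) + lambda n * q0 x)
  (Dn0 : exists C : R, forall x, 0 <= D n0 x <= C)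
  (DS : forall n x, (n0 <= n)%N ->
    D n.+1 x = (1 - gamma n.+1) * D n x + gamma n.+1 * Delta n x)
  (DeltaE : forall n x, (n0 <= n)%N ->
    ((Delta n x)%:E =
     \int[lebesgue_row]_y (p n y * rescaled K (b n.+1) (x - y))%:E)%E)
  (GD : forall e : R, 0 < e -> \forall n \near \oo,
    forall x, `|x| <= n%:R ^+ 3 ->
      `|G n x - D n x| <= e * (D n x + lambda n `^ (1 - eta)))
  (I_le : forall e : R, 0 < e -> \forall n \near \oo, I n <= 1 + e)
  (G_le : exists C : R, \forall n \near \oo, forall x, G n x <= C * n%:R ^+ 2).

Let eta0 : 0 < eta. Proof. by case/andP: eta01. Qed.
Let eta1 : 0 <= 1 - eta. Proof. by case/andP: eta01 => _; rewrite subr_ge0. Qed.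
Let f0 x : 0 <= f x. Proof. by have [] := hf. Qed.
Let q00 x : 0 <= q0 x. Proof. by have [] := hq0. Qed.

Let lambda_ge0 n : (n0 <= n)%N -> 0 <= lambda n.
Proof. by move=> /lambda01/andP[/ltW]. Qed.

Let lambda_le1 n : (n0 <= n)%N -> 0 <= 1 - lambda n.
Proof. by move=> /lambda01/andP[_]; rewrite subr_ge0. Qed.

Let q_ge n x : (n0 <= n)%N -> (1 - lambda n) * (G n x / I n) <= q n x.
Proof. by move=> n0n; rewrite qE// lerDl mulr_ge0// lambda_ge0. Qed.

Let q_gef n x : (n0 <= n)%N -> lambda n * (c0 * f x) <= q n x.
Proof.
move=> n0n; rewrite qE//; apply: (@le_trans _ _ (lambda n * q0 x)).
  by rewrite ler_wpM2l// lambda_ge0.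
by rewrite lerDr mulr_ge0 ?lambda_le1// divr_ge0 ?G0// ltW// I0.
Qed.

Let q_ge0 n x : (n0 <= n)%N -> 0 <= q n x.
Proof.
move=> n0n; apply: le_trans (q_gef x n0n).
by rewrite mulr_ge0 ?lambda_ge0// mulr_ge0// ltW.
Qed.

Let mq n : (n0 <= n)%N -> measurable_fun setT (q n).
Proof.
move=> n0n; have -> : q n = fun x =>
  (1 - lambda n) * (G n x / I n) + lambda n * q0 x by apply/funext => x; exact: qE.
have [mq0 _ _] := hq0.
by apply: measurable_funD; apply: measurable_funM => //; apply: measurable_funM => //; exact: mG.
Qed.

Let intq n : (n0 <= n)%N -> (\int[lebesgue_row]_x (q n x)%:E = 1)%E.
Proof.
move=> n0n; have [mq0 _ iq0] := hq0.
transitivity (\int[lebesgue_row]_x (((1 - lambda n) / I n)%:E * (G n x)%:E +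
   (lambda n)%:E * (q0 x)%:E))%E.
  apply: eq_integral => x _; rewrite -!EFinM -EFinD qE//; congr (_%:E).
  by rewrite [in RHS]mulrAC -mulrA.
have mGE : measurable_fun setT (fun x => (G n x)%:E) by apply/measurable_EFinP; exact: mG.
have mqE : measurable_fun setT (fun x => (q0 x)%:E) by exact/measurable_EFinP.
have l1 : 0 <= (1 - lambda n) / I n by rewrite divr_ge0 ?lambda_le1// ltW// I0.
rewrite ge0_integralD//; last 4 first.
- by move=> y _; rewrite -EFinM lee_fin mulr_ge0// G0.
- exact: measurable_funeM.
- by move=> y _; rewrite -EFinM lee_fin mulr_ge0// lambda_ge0.
- exact: measurable_funeM.
rewrite !ge0_integralZl ?lee_fin ?lambda_ge0//; last 2 first.
- by move=> y _; rewrite lee_fin.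
- by move=> y _; rewrite lee_fin G0.
rewrite -IE// iq0 mule1 -EFinM -EFinD divfK ?gt_eqF ?I0//.
by rewrite subrK.
Qed.

Let p_ge0 n y : 0 <= p n y. Proof. by rewrite mulr_ge0// powR_ge0. Qed.

Let mp n : (n0 <= n)%N -> measurable_fun setT (p n).
Proof.
move=> n0n; have [mf _ _] := hf.
exact: (measurable_funM (measurableT_comp (measurable_powR eta) mf)
  (measurableT_comp (measurable_powR (1 - eta)) (mq n0n))).
Qed.

Let p_le n y : (n0 <= n)%N -> p n y <= eta * f y + (1 - eta) * q n y.
Proof. by move=> n0n; apply: geometric_mean_le => //; exact: q_ge0. Qed.

Let intp n : (n0 <= n)%N -> (\int[lebesgue_row]_x (p n x)%:E <= 1)%E.
Proof.
move=> n0n; have [mf _ ifE] := hf.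
have mfE : measurable_fun setT (fun x => (f x)%:E) by exact/measurable_EFinP.
have mqE : measurable_fun setT (fun x => (q n x)%:E) by apply/measurable_EFinP; exact: mq.
apply: (@le_trans _ _ (\int[lebesgue_row]_x (eta%:E * (f x)%:E + (1 - eta)%:E * (q n x)%:E)))%E.
  apply: ge0_le_integral => //.
  - by move=> x _; rewrite lee_fin p_ge0.
  - by apply/measurable_EFinP; exact: mp.
  - by apply: emeasurable_funD; exact: measurable_funeM.
  - by move=> x _; rewrite -!EFinM -EFinD lee_fin p_le.
rewrite ge0_integralD//; last 4 first.
- by move=> y _; rewrite -EFinM lee_fin mulr_ge0// ltW.
- exact: measurable_funeM.
- by move=> y _; rewrite -EFinM lee_fin mulr_ge0// q_ge0.
- exact: measurable_funeM.
rewrite !ge0_integralZl ?lee_fin ?(ltW eta0)//; last 2 first.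
- by move=> y _; rewrite lee_fin q_ge0.
- by move=> y _; rewrite lee_fin.
by rewrite ifE intq// !mule1 -EFinD lee_fin subrKC.
Qed.

Let p_mono n y (s t : R) : 0 <= s -> 0 <= t -> s <= f y -> t <= q n y ->
  s `^ eta * t `^ (1 - eta) <= p n y.
Proof.
move=> s0 t0 sf tq; apply: ler_pM; rewrite ?powR_ge0//.
  by apply: ge0_ler_powR; rewrite ?nnegrE// ltW.
by apply: ge0_ler_powR; rewrite ?nnegrE// (le_trans t0).
Qed.

Let D_ge0 n x : (n0 <= n)%N -> 0 <= D n x.
Proof.
move=> n0n; rewrite -(subnKC n0n); elim: (n - n0)%N => [|k ih].
  by rewrite addn0; have [C /(_ x)/andP[]] := Dn0.
have g01 := gamma01 (leq_addr k n0 : (n0 < (n0 + k).+1)%N).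
rewrite addnS DS ?leq_addr//; case/andP: g01 => g0 g1.
rewrite addr_ge0// mulr_ge0// ?subr_ge0// ?(ltW g0)//.
rewrite -lee_fin DeltaE ?leq_addr//; apply: integral_ge0 => y _.
by rewrite lee_fin mulr_ge0// rescaled_ge0// b0// leqW// leq_addr.
Qed.

Let b_small (beta : R) : 0 < beta -> \forall n \near \oo, b n.+1 <= beta.
Proof.
move=> beta0; have : \forall n \near \oo, b n <= beta by exact: cvgr_le b_cvg _ beta0.
by move=> [N _ HN]; exists N => // n /= Nn; apply: HN; rewrite /= leqW.
Qed.

Let lambda_small (e : R) : 0 < e -> \forall n \near \oo, lambda n <= e.
Proof. by move=> e0; exact: cvgr_le lambda_cvg _ e0. Qed.

Let near_n0 : \forall n \near \oo, (n0 <= n)%N.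
Proof. exact: nbhs_infty_ge. Qed.

Let in_cube (x0 : 'rV[R]_d) (r : R) : \forall n \near \oo,
  forall y : 'rV[R]_d, `|y - x0| <= r -> `|y| <= n%:R ^+ 3.
Proof.
near=> n => y yr.
have : `|x0| + r <= n%:R by near: n; exact: nbhs_infty_ger.
have : (1 : R) <= n%:R by rewrite ler1n; near: n; exact: nbhs_infty_gt.
have := ler_normD (y - x0) x0; rewrite subrK => h n1 hn.
apply: (@le_trans _ _ n%:R); first lra.
by rewrite ler_eXnr.
Unshelve. all: by end_near. Qed.

(** * Local lower bounds *)

Section lower_bound.
Variables (x0 : 'rV[R]_d) (a r : R).
Hypotheses (a0 : 0 < a) (r0 : 0 < r) (fa : forall y, `|y - x0| <= r -> a <= f y).
Let kappa := k0 * rho0 ^+ d.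
Let kappa0 : 0 < kappa. Proof. by rewrite mulr_gt0// exprn_gt0. Qed.

(** On the ball, exploration gives f^eta q_n^(1 - eta) >= a c0^(1 - eta) lambda_n^(1 - eta), and an
    orthant carries kernel mass [kappa]. Half of the product is a level that a sequence relaxing to
    [2 * c1] eventually passes. *)
Let c1 := a * c0 `^ (1 - eta) * kappa / 2.
Let c10 : 0 < c1.
Proof.
by apply: divr_gt0 => //; apply: mulr_gt0 => //; apply: mulr_gt0 => //; exact: powR_gt0.
Qed.

Let aE : a `^ eta * a `^ (1 - eta) = a.
Proof.
by rewrite -powRD ?subrKC ?powRr1 ?(ltW a0)// (gt_eqF a0) implybT.
Qed.

(* The exploration part [lambda n * q0] of the policy alone gives this bound,
   which makes the error term in [GD] negligible with respect to [D n]. *)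
Let D_ge_lambda : \forall n \near \oo,
  forall x, `|x - x0| <= r -> c1 * lambda n `^ (1 - eta) <= D n x.
Proof.
have [N _ HN] : \forall n \near \oo, (n0 <= n)%N /\ b n.+1 <= r / rho0.
  near=> n; split; near: n; [exact: near_n0|apply: b_small; exact: divr_gt0].
pose w := fix w k := if k is k'.+1 then
  (1 - gamma (N + k)%N) * w k' + gamma (N + k)%N * (2 * c1) else 0 : R.
pose u n := w (n - N)%N.
have uS n : (N <= n)%N -> u n.+1 = (1 - gamma n.+1) * u n + gamma n.+1 * (2 * c1).
  by move=> Nn; rewrite /u subSn//= addnS subnKC.
have n0N : (n0 <= N)%N by have [] := HN N (leqnn N).
have uN : u N = 0 by rewrite /u subnn.
have u_ge : \forall n \near \oo, c1 <= u n.
  have := @contraction_le _ gamma Cg Cg0 gamma_ge N _ (fun n => - u n) 0 (- (2 * c1)) c1.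
  rewrite lexx ltr01 subr0 divr1 => /(_ _ isT c10) h.
  have {h} : \forall n \near \oo, - u n <= - (2 * c1) + c1.
    apply: h => [n Nn|n Nn]; first by apply: gamma01; exact: leq_ltn_trans Nn.
    by rewrite uS// mul0r; lra.
  by apply: filterS => n; lra.
have u0 n : (N <= n)%N -> 0 <= u n.
  move=> Nn; rewrite -(subnKC Nn); elim: (n - N)%N => [|k ih]; first by rewrite addn0 uN.
  rewrite addnS uS ?leq_addr//.
  have /andP[g0 g1] := gamma01 (leq_trans n0N (leq_addr k N) : (n0 < (N + k).+1)%N).
  by rewrite addr_ge0// mulr_ge0// ?subr_ge0// ?(ltW g0)// mulr_ge0// ltW.
have Du n : (N <= n)%N -> forall x, `|x - x0| <= r -> u n * lambda n `^ (1 - eta) <= D n x.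
  move=> Nn; rewrite -(subnKC Nn); elim: (n - N)%N => [|k ih] x xr.
    by rewrite addn0 uN mul0r D_ge0.
  have Nk := leq_addr k N; have n0k := leq_trans n0N Nk.
  have [_ bk] := HN _ Nk.
  rewrite addnS uS// DS//.
  have /andP[g0 g1] := gamma01 (n0k : (n0 < (N + k).+1)%N).
  set l := lambda (N + k)%N `^ (1 - eta); set l' := _ `^ (1 - eta).
  (* Monotonicity of lambda lets the factor at time n + 1 be replaced by the larger one at time
     n. *)
  have l'l : l' <= l.
    apply: ge0_ler_powR; rewrite ?nnegrE ?lambda_ge0// ?leqW//; exact: lambda_decr.
  have DeltaL : 2 * c1 * l <= Delta (N + k)%N x.
    rewrite (_ : 2 * c1 * l = (a * c0 `^ (1 - eta) * l) * kappa); last by rewrite /c1; field.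
    apply: (mollified_ge hK (p := p (N + k)%N) (S := sup_ball x0 r) _ _ _ _ _ _ _ (DeltaE x n0k)).
    - exact: mp.
    - exact: p_ge0.
    - exact: measurable_sup_ball.
    - by apply: b0; exact: leqW.
    - by rewrite !mulr_ge0// ?powR_ge0// ltW.
    - move=> y yr; apply: le_trans (p_mono (ltW a0) _ (fa yr) (q_gef y n0k)); last first.
        by rewrite mulr_ge0 ?lambda_ge0// mulr_ge0// ltW.
      apply: (@le_trans _ _ (a `^ eta * (lambda (N + k)%N * (c0 * a)) `^ (1 - eta))).
        rewrite !powRM ?mulr_ge0 ?lambda_ge0 ?(ltW c00) ?(ltW a0)// -[in leLHS]aE.
        by rewrite /l le_eqVlt; apply/orP; left; apply/eqP; ring.
      rewrite ler_wpM2l ?powR_ge0// ge0_ler_powR ?nnegrE ?mulr_ge0 ?lambda_ge0 ?(ltW c00) ?(ltW a0)//.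
      by rewrite ler_wpM2l ?lambda_ge0// ler_pM2l// fa.
    - apply: rescaled_orthant => //; first by apply: b0; exact: leqW.
      by rewrite -ler_pdivlMr.
  have := ih x xr; rewrite -/l => ihx.
  have U0 : 0 <= (1 - gamma (N + k).+1) * u (N + k)%N + gamma (N + k).+1 * (2 * c1).
    by rewrite -uS// u0// leqW.
  apply: (le_trans (ler_wpM2l U0 l'l)).
  rewrite mulrDl; apply: lerD; rewrite -[leLHS]mulrA.
    by rewrite ler_wpM2l// subr_ge0.
  by rewrite ler_pM2l.
near=> n => x xr.
apply: le_trans (Du n _ x xr); last by near: n; exact: nbhs_infty_ge.
by rewrite ler_wpM2r ?powR_ge0//; near: n.
Unshelve. all: by end_near. Qed.

(** By [D_ge_lambda] the additive error lambda_n^(1 - eta) is at most D_n / c1, so the noise becomes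
    purely relative. Only the upper bound on the mass enters. *)
Let q_ge_D (e : R) : 0 < e < 1 -> \forall n \near \oo,
  forall x, `|x - x0| <= r -> (1 - e) * D n x <= q n x.
Proof.
move=> /andP[e0 e1].
(* The losses are e' (1 + 1/c1) from the noise, e' from the factor 1 - lambda_n and e' from the
   mass; they add up to less than [e]. *)
pose e' := e / (4 + c1^-1).
have c1V : 0 < c1^-1 by rewrite invr_gt0.
have e'0 : 0 < e' by rewrite divr_gt0// addr_gt0.
have e'E : e' * (4 + c1^-1) = e by rewrite divfK// gt_eqF// addr_gt0.
near=> n.
have n0n : (n0 <= n)%N by near: n; exact: near_n0.
have In0 := I0 n0n.
have In : I n <= 1 + e' by near: n; exact: I_le.
have ln : lambda n <= e' by near: n; exact: lambda_small.
have HDl : forall x, `|x - x0| <= r -> c1 * lambda n `^ (1 - eta) <= D n x.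
  by near: n; exact: D_ge_lambda.
have Hxn : forall x, `|x - x0| <= r -> `|x| <= n%:R ^+ 3.
  by near: n; exact: in_cube.
have HGD : forall x, `|x| <= n%:R ^+ 3 ->
    `|G n x - D n x| <= e' * (D n x + lambda n `^ (1 - eta)).
  by near: n; exact: GD.
move=> x xr; have Dl := HDl x xr; have GDx := HGD x (Hxn x xr).
have D0 := D_ge0 x n0n.
have lD : lambda n `^ (1 - eta) <= c1^-1 * D n x by rewrite ler_pdivlMl.
have GL : (1 - e' * (1 + c1^-1)) * D n x <= G n x.
  move: GDx; rewrite ler_norml => /andP[+ _].
  have := ler_wpM2l (ltW e'0) lD; lra.
apply: le_trans (q_ge x n0n); rewrite mulrA ler_pdivlMr//.
have G0x := G0 x n0n.
have e'1 : e' < 1.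
  have : e' * 1 <= e' * (4 + c1^-1) by rewrite ler_pM2l//; lra.
  lra.
have h1 : (1 - e) * D n x * I n <= (1 - e) * D n x * (1 + e').
  by rewrite ler_wpM2l// mulr_ge0// subr_ge0 ltW.
have h2 : (1 - e') * G n x <= (1 - lambda n) * G n x by rewrite ler_wpM2r//; lra.
have h3 : (1 - e') * ((1 - e' * (1 + c1^-1)) * D n x) <= (1 - e') * G n x.
  by rewrite ler_wpM2l// subr_ge0 ltW.
apply: (le_trans h1); apply: le_trans h2; apply: le_trans h3.
rewrite mulrAC mulrA ler_wpM2r//.
have h4 : 0 <= e' * (e' * (1 + c1^-1)) by apply/ltW; do 2 apply: mulr_gt0 => //; apply: addr_gt0.
have h5 : 0 <= e * e' by rewrite mulr_ge0// ltW.
move: e'E h4 h5; rewrite !mulrDr; lra.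
Unshelve. all: by end_near. Qed.

(* [v n * a * expR (- s * |x - x0|)] is a subsolution. Well inside the cube the
   kernel has mass almost 1. Near its boundary only the mass [kappa] of one
   orthant is available, but there the exponent [1 - eta] improves the profile by
   a factor [expR (s * eta * |x - x0|)], which is at least [kappa^-1]. *)
Lemma D_ge_loc t : 0 < t < a -> exists2 rho, 0 < rho & \forall n \near \oo,
  forall x, `|x - x0| <= rho -> t <= D n x.
Proof.
move=> /andP[t0 ta].
have ta1 : t / a < 1 by rewrite ltr_pdivrMr// mul1r.
(* The comparison sequence [v] has fixed point [l], hence passes [L]; the gap between [L] and t/a
   pays for the decrease of the profile near [x0]. *)
pose L := (1 + t / a) / 2; pose l := (1 + L) / 2.
have taL : t / a < L by rewrite /L; lra.
have L1 : L < 1 by rewrite /L; lra.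
have l1 : l < 1 by rewrite /l; lra.
have Ll : L < l by rewrite /l; lra.
have L0 : 0 < L by apply: lt_trans taL; exact: divr_gt0.
have l0 := lt_trans L0 Ll.
pose u := l `^ eta.
have u0 : 0 < u by exact: powR_gt0.
have u1 : u < 1.
  have h1 : 1 = 1 `^ eta by rewrite powR1.
  by rewrite /u [ltRHS]h1 gt0_ltr_powR ?nnegrE ?(ltW l0).
(* This makes [s * eta * (r / 2)] the inverse of [kappa], so that exp(x) >= 1 + x gives [ks]: at
   distance r/2 the exponential gain outweighs the mass lost outside the orthant. *)
pose s := 2 / (eta * r * kappa).
have s0 : 0 < s by rewrite /s divr_gt0// !mulr_gt0 ?exprn_gt0.
have ks : 1 <= kappa * expR (s * eta * (r / 2)).
  rewrite -ler_pdivrMl// mulr1.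
  apply: le_trans (expR_ge1Dx _).
  rewrite (_ : s * eta * (r / 2) = kappa^-1); first by rewrite lerDr.
  by rewrite /s; field; rewrite !gt_eqF// mulr_gt0// exprn_gt0.
(* With [delta <= r / 2] the points beyond [r - delta] are at distance at least r/2, where [ks]
   applies; the second bound limits the variation of the profile over a ball of radius [delta]. *)
pose delta := Num.min (r / 2) ((1 - u) / (2 * s)).
have u1' : 0 < 1 - u by rewrite subr_gt0.
have delta0 : 0 < delta by rewrite lt_min !divr_gt0// mulr_gt0.
have deltar : delta <= r / 2 by rewrite ge_min lexx.
have sdelta : s * delta <= (1 - u) / 2.
  rewrite -ler_pdivlMl//.
  by rewrite (_ : s^-1 * _ = (1 - u) / (2 * s)) ?ge_min ?lexx ?orbT//; field; rewrite gt_eqF.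
pose e := (1 - u) / 4.
have e01 : 0 < e < 1 by rewrite /e; apply/andP; split; lra.
have [e0 e1] := andP e01.
(* The three losses come from q_n against D_n, the kernel mass outside the [delta]-ball and the
   variation of the profile. Together they leave at least ((1 + u) / 2)^2, which is at least [u]. *)
have ue : u <= (1 - e) * (1 - e) * expR (- (s * delta)).
  have := expR_ge1Dx (- (s * delta)).
  have h : (1 + u) / 2 <= (1 - e) * (1 - e) by rewrite /e; nra.
  move=> h2; apply: (@le_trans _ _ (((1 + u) / 2) * ((1 + u) / 2))); first nra.
  by apply: ler_pM => //; lra.
pose psi x := a * expR (- (s * `|x - x0|)).
have [beta beta0 Hbeta] := rescaled_concentrated hK delta0 e0.
have [N _ HN] : \forall n \near \oo, [/\ (n0 <= n)%N,
    forall x, `|x - x0| <= r -> (1 - e) * D n x <= q n x,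
    forall x, `|x - x0| <= r -> c1 * lambda n `^ (1 - eta) <= D n x,
    b n.+1 <= beta & b n.+1 <= (r / 2) / rho0].
  near=> n; split; near: n.
  - exact: near_n0.
  - exact: q_ge_D.
  - exact: D_ge_lambda.
  - exact: b_small.
  - by apply: b_small; rewrite divr_gt0// divr_gt0.
(* The positive start is supplied by [D_ge_lambda]; when [eta < 1] a sequence started at 0 would
   stay there. *)
pose w := fix w k := if k is k'.+1 then
  (1 - gamma (N + k)%N) * w k' + gamma (N + k)%N * (u * w k' `^ (1 - eta))
  else c1 * lambda N `^ (1 - eta) / a.
pose v n := w (n - N)%N.
have n0N : (n0 <= N)%N by have [] := HN N (leqnn N).
have vS n : (N <= n)%N ->
    v n.+1 = (1 - gamma n.+1) * v n + gamma n.+1 * (u * v n `^ (1 - eta)).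
  by move=> Nn; rewrite /v subSn//= addnS subnKC.
have vN : v N = c1 * lambda N `^ (1 - eta) / a by rewrite /v subnn.
have vN0 : 0 < v N.
  rewrite vN divr_gt0// mulr_gt0// powR_gt0//.
  by have /andP[] := lambda01 n0N.
have v0 n : (N <= n)%N -> 0 <= v n.
  move=> Nn; rewrite -(subnKC Nn); elim: (n - N)%N => [|k ih]; first by rewrite addn0 ltW.
  rewrite addnS vS ?leq_addr//.
  have /andP[g0 g1] := gamma01 (leq_trans n0N (leq_addr k N) : (n0 < (N + k).+1)%N).
  by rewrite addr_ge0// mulr_ge0// ?subr_ge0// ?(ltW g0)// mulr_ge0// ?powR_ge0// ltW.
have Dv n : (N <= n)%N -> forall x, `|x - x0| <= r -> v n * psi x <= D n x.
  move=> Nn; rewrite -(subnKC Nn); elim: (n - N)%N => [|k ih] x xr.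
    rewrite addn0; have [_ _ + _ _] := HN N (leqnn N) => /(_ x xr); apply: le_trans.
    rewrite vN /psi mulrA divfK ?gt_eqF//; apply: ler_piMr.
      exact: mulr_ge0 (ltW c10) (powR_ge0 _ _).
    by rewrite -expR0 ler_expR oppr_le0 mulr_ge0// ltW.
  have Nk := leq_addr k N; have n0k := leq_trans n0N Nk.
  have [_ qD _ bbeta br] := HN _ Nk.
  rewrite addnS vS// DS//.
  have /andP[g0 g1] := gamma01 (n0k : (n0 < (N + k).+1)%N).
  have vk := v0 _ Nk.
  have bk0 : 0 < b (N + k).+1 by apply: b0; exact: leqW.
  set V := v (N + k)%N `^ (1 - eta).
  have V0 : 0 <= V by exact: powR_ge0.
  have py y : `|y - x0| <= r ->
      (1 - e) * V * (a * expR (- ((1 - eta) * (s * `|y - x0|)))) <= p (N + k)%N y.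
    move=> yr.
    have q1 : (1 - e) * (v (N + k)%N * psi y) <= q (N + k)%N y.
      apply: le_trans (qD y yr); rewrite ler_wpM2l ?subr_ge0 ?(ltW e1)//.
      exact: ih.
    have psi0 : 0 <= psi y by rewrite mulr_ge0 ?expR_ge0// ltW.
    have e1' : 0 <= 1 - e by rewrite subr_ge0 ltW.
    apply: le_trans (p_mono (ltW a0) _ (fa yr) q1); last first.
      by apply: mulr_ge0 => //; exact: mulr_ge0.
    have psiE : psi y `^ (1 - eta) =
        a `^ (1 - eta) * expR (- (s * `|y - x0|) * (1 - eta)).
      by rewrite [psi y]/(a * _) powRM ?expR_ge0 ?(ltW a0)// expRM.
    rewrite (powRM _ e1' (mulr_ge0 vk psi0)) (powRM _ vk psi0) -/V psiE.
    have -> : a `^ eta * ((1 - e) `^ (1 - eta) *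
        (V * (a `^ (1 - eta) * expR (- (s * `|y - x0|) * (1 - eta))))) =
      ((1 - e) `^ (1 - eta)) * (V * ((a `^ eta * a `^ (1 - eta)) *
         expR (- ((1 - eta) * (s * `|y - x0|))))).
      by rewrite mulNr [s * _ * _]mulrC; ring.
    rewrite aE -mulrA ler_wpM2r ?mulr_ge0 ?expR_ge0 ?(ltW a0)//.
    have e1n : 1 - e <= 1 by lra.
    have e1p : 0 < 1 - e by rewrite subr_gt0.
    by apply: ger1_powR; [rewrite e1p|rewrite gerBl ltW].
  have DeltaL : u * V * psi x <= Delta (N + k)%N x.
    have [xr2|xr2] := leP `|x - x0| (r - delta).
      apply: (@le_trans _ _ (((1 - e) * V * (a * expR (- (s * (`|x - x0| + delta))))) * (1 - e))).
        rewrite /psi; have -> : expR (- (s * (`|x - x0| + delta))) =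
            expR (- (s * `|x - x0|)) * expR (- (s * delta)).
          by rewrite -expRD; congr expR; ring.
        have -> : (1 - e) * V * (a * (expR (- (s * `|x - x0|)) * expR (- (s * delta)))) * (1 - e)
          = ((1 - e) * (1 - e) * expR (- (s * delta))) * (V * (a * expR (- (s * `|x - x0|)))) by ring.
        rewrite -mulrA ler_wpM2r// mulr_ge0// mulr_ge0 ?expR_ge0//.
        exact: ltW.
      apply: (mollified_ge hK (p := p (N + k)%N) (S := sup_ball x delta) _ _ _ _ _ _ _ (DeltaE x n0k)) => //.
      - exact: mp.
      - exact: measurable_sup_ball.
      - by rewrite !mulr_ge0 ?expR_ge0// ?subr_ge0 ?(ltW e1)// ltW.
      - move=> y yx; have tri : `|y - x0| <= `|x - x0| + delta.
          have := ler_normD (y - x) (x - x0); rewrite addrA subrK => /le_trans; apply.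
          by rewrite addrC lerD2l.
        apply: le_trans (py y _); last by apply: (le_trans tri); lra.
        rewrite ler_wpM2l ?mulr_ge0// ?subr_ge0 ?(ltW e1)// ler_pM2l// ler_expR lerN2.
        apply: (@le_trans _ _ (s * `|y - x0|)); last by rewrite ler_pM2l.
        by apply: ler_piMl; [rewrite mulr_ge0// ltW|rewrite gerBl ltW].
      - by apply: Hbeta; rewrite bk0.
    apply: (@le_trans _ _ ((1 - e) * V * (a * expR (- ((1 - eta) * (s * `|x - x0|)))) * kappa)).
      have -> : expR (- ((1 - eta) * (s * `|x - x0|))) =
          expR (- (s * `|x - x0|)) * expR (s * eta * `|x - x0|).
        by rewrite -expRD; congr expR; ring.
      have -> : (1 - e) * V * (a * (expR (- (s * `|x - x0|)) * expR (s * eta * `|x - x0|))) * kappa =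
        ((1 - e) * (kappa * expR (s * eta * `|x - x0|))) * (V * psi x) by rewrite /psi; ring.
      rewrite -mulrA; apply: ler_wpM2r.
        by apply: mulr_ge0 => //; apply: mulr_ge0; [exact: ltW|exact: expR_ge0].
      apply: (@le_trans _ _ ((1 - e) * 1)); first by rewrite mulr1 /e; lra.
      rewrite ler_wpM2l ?subr_ge0 ?(ltW e1)//; apply: (le_trans ks).
      by rewrite ler_pM2l// ler_expR (ler_pM2l (mulr_gt0 s0 eta0)); lra.
    (* Points of this smaller ball are no farther from [x0] than [x], so the profile is no smaller
       there, and the orthant at [x] facing [x0] lies inside it. *)
    apply: (mollified_ge hK (p := p (N + k)%N) (S := sup_ball x0 `|x - x0|) _ _ _ _ _ _ _ (DeltaE x n0k)) => //.
    - exact: mp.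
    - exact: measurable_sup_ball.
    - by rewrite !mulr_ge0 ?expR_ge0// ?subr_ge0 ?(ltW e1)// ltW.
    - move=> y yx; apply: le_trans (py y (le_trans yx xr)).
      rewrite ler_wpM2l ?mulr_ge0// ?subr_ge0 ?(ltW e1)// ler_pM2l// ler_expR lerN2.
      by rewrite ler_wpM2l// ler_pM2l.
    - apply: rescaled_orthant => //; rewrite -ler_pdivlMr//; apply: (le_trans br).
      by rewrite ler_pM2r ?invr_gt0//; lra.
  rewrite mulrDl; apply: lerD; rewrite -[leLHS]mulrA.
    by rewrite ler_wpM2l ?subr_ge0// ih.
  by rewrite ler_pM2l.
have vL : \forall n \near \oo, L <= v n.
  apply: (@concave_ge _ gamma Cg Cg0 gamma_ge N _ v eta l L) => //.
  - by move=> n Nn; apply: gamma01; exact: leq_ltn_trans Nn.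
  - by rewrite L0.
  - by move=> n Nn; rewrite vS.
(* [L <= v n] and a profile of at least [a * z] give the level [t]; within distance (1 - z)/s of
   [x0] the exponential is at least [z]. *)
pose z := t / (a * L).
have z1 : z < 1.
  by rewrite /z (ltr_pdivrMr _ _ (mulr_gt0 a0 L0)) mul1r mulrC -ltr_pdivrMr.
exists (Num.min r ((1 - z) / s)).
  by rewrite lt_min r0 divr_gt0// subr_gt0.
near=> n => x; rewrite le_min => /andP[xr xz].
have Nn : (N <= n)%N by near: n; exact: nbhs_infty_ge.
apply: le_trans (Dv n Nn x xr).
have Lv : L <= v n by near: n.
apply: (@le_trans _ _ (L * (a * z))).
  have zE : z * (a * L) = t by rewrite /z divfK// gt_eqF// mulr_gt0.
  by rewrite -[leLHS]zE le_eqVlt; apply/orP; left; apply/eqP; ring.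
have z0 : 0 < z by apply: divr_gt0 => //; exact: mulr_gt0.
apply: ler_pM => //; [exact: ltW|by apply: mulr_ge0; exact: ltW|].
rewrite /psi ler_pM2l//; apply: le_trans (expR_ge1Dx _).
by move: xz; rewrite ler_pdivlMr// mulrC; lra.
Unshelve. all: by end_near. Qed.

End lower_bound.

Let f_near x0 (e : R) : 0 < e ->
  exists2 rho, 0 < rho & forall x, `|x - x0| <= rho -> `|f x - f x0| <= e.
Proof.
move=> e0; have /cvgrPdist_le/(_ e e0)/nbhs_ballP[r /= r0 Hr] := @cf x0.
exists (r / 2); first exact: divr_gt0.
move=> x xr; rewrite distrC; apply: Hr; split => // i j; rewrite (ord1 i).
rewrite /ball/= distrC.
apply: le_lt_trans (_ : r / 2 < r); last by rewrite ltr_pdivrMr// ltr_pMr// ltr1n.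
by apply: le_trans xr; have := coord_le_normr (x - x0) j; rewrite !mxE.
Qed.

Let D_ge_pt x0 t : t < f x0 -> exists2 rho, 0 < rho & \forall n \near \oo,
  forall x, `|x - x0| <= rho -> t <= D n x.
Proof.
move=> tf; have [t0|t0] := leP t 0.
  exists 1 => //; near=> n => x _; apply: (le_trans t0); apply: D_ge0.
  by near: n; exact: near_n0.
have e0 : 0 < (f x0 - t) / 2 by rewrite divr_gt0// subr_gt0.
have [r r0 fr] := f_near x0 e0.
apply: (@D_ge_loc x0 ((t + f x0) / 2) r) => //; first lra.
- by move=> y /fr; rewrite ler_norml => /andP[+ _]; lra.
- by apply/andP; split; lra.
Unshelve. all: by end_near. Qed.

Let Mf0 : 0 <= Mf. Proof. exact: le_trans (f0 0) (fM 0). Qed.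

Let lambda_pow_le1 n : (n0 <= n)%N -> lambda n `^ (1 - eta) <= 1.
Proof.
move=> n0n; have /andP[l0 l1] := lambda01 n0n.
rewrite -[leRHS](powRr0 (lambda n)).
by apply: ger_powR => //; rewrite l0.
Qed.

(** The bound on G feeds the lower bound on the mass, the one on q is half of the conclusion. *)
Let Gq_ge x0 (e : R) : 0 < e -> exists2 rho, 0 < rho & \forall n \near \oo,
  forall x, `|x - x0| <= rho -> f x - e <= G n x /\ f x - e <= q n x.
Proof.
move=> e0; pose e' := Num.min (1 / 4) (e / (4 * (3 * Mf + 1))).
have M1 : 0 < 4 * (3 * Mf + 1) by have := Mf0; lra.
have e'0 : 0 < e' by rewrite lt_min divr_gt0// divr_gt0.
have e'4 : e' <= 1 / 4 by rewrite ge_min lexx.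
have e'e : e' * (4 * (3 * Mf + 1)) <= e by rewrite -ler_pdivlMr// ge_min lexx orbT.
have e40 : 0 < e / 4 by rewrite divr_gt0.
have [r1 r10 Hr1] := f_near x0 e40.
have [r2 r20 Hr2] := @D_ge_pt x0 (f x0 - e / 4) ltac:(lra).
exists (Num.min r1 r2); first by rewrite lt_min r10.
near=> n.
have n0n : (n0 <= n)%N by near: n; exact: near_n0.
have In0 := I0 n0n.
have In : I n <= 1 + e' by near: n; exact: I_le.
have ln : lambda n <= e' by near: n; exact: lambda_small.
have HD : forall x, `|x - x0| <= r2 -> f x0 - e / 4 <= D n x by near: n.
have Hxn : forall x, `|x - x0| <= r2 -> `|x| <= n%:R ^+ 3.
  by near: n; exact: in_cube.
have HGD : forall x, `|x| <= n%:R ^+ 3 ->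
    `|G n x - D n x| <= e' * (D n x + lambda n `^ (1 - eta)).
  by near: n; exact: GD.
move=> x; rewrite le_min => /andP[xr1 xr2].
have := Hr1 x xr1; rewrite ler_norml => /andP[_ fx].
have Dx := HD x xr2; have D0 := D_ge0 x n0n; have G0x := G0 x n0n.
have := HGD x (Hxn x xr2); rewrite ler_norml => /andP[GDx _].
have fM0 := fM x0.
have l1 : e' * lambda n `^ (1 - eta) <= e' by rewrite ler_piMr ?lambda_pow_le1// ltW.
have DM : (1 - e') * (f x0 - e / 4) <= (1 - e') * D n x by rewrite ler_wpM2l//; lra.
have fe : e' * (f x0 - e / 4) <= e' * Mf by rewrite ler_pM2l//; lra.
have Gx : f x0 - e / 4 - e' * (Mf + 1) <= G n x by lra.
have Mfe : 0 <= e' * Mf by rewrite mulr_ge0// ltW.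
split; first by lra.
apply: le_trans (q_ge x n0n).
have qG : (1 - 2 * e') * G n x <= (1 - lambda n) * (G n x / I n).
  rewrite mulrA ler_pdivlMr//.
  have h1 : (1 - 2 * e') * G n x * I n <= (1 - 2 * e') * G n x * (1 + e').
    by rewrite ler_wpM2l// mulr_ge0//; lra.
  have h2 : (1 - e') * G n x <= (1 - lambda n) * G n x by rewrite ler_wpM2r//; lra.
  have h3 : 0 <= e' * G n x by rewrite mulr_ge0// ltW.
  have h4 : 0 <= e' * (e' * G n x) by rewrite mulr_ge0// ltW.
  apply: (le_trans h1); apply: le_trans h2; lra.
apply: le_trans qG.
set t := f x0 - e / 4 - e' * (Mf + 1).
have h5 : (1 - 2 * e') * t <= (1 - 2 * e') * G n x by rewrite ler_wpM2l//; lra.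
have h6 : e' * t <= e' * Mf by rewrite ler_pM2l// /t; lra.
by apply: le_trans h5; rewrite /t in h6 *; lra.
Unshelve. all: by end_near. Qed.

Let near_compact (A : set 'rV[R]_d) (Q : nat -> 'rV[R]_d -> Prop) : compact A ->
  (forall x0, A x0 -> exists2 rho, 0 < rho & \forall n \near \oo,
     forall x, `|x - x0| <= rho -> Q n x) ->
  \forall n \near \oo, forall x, A x -> Q n x.
Proof.
move=> /compact_near_coveringP cA HQ.
apply: (cA nat \oo Q) => x0 Ax0.
have [rho rho0' HN] := HQ x0 Ax0.
exists (ball x0 rho, [set n | forall x, `|x - x0| <= rho -> Q n x]) => /=.
  by split => //; exact: nbhsx_ballx.
move=> [x n] /= [xb]; apply; apply/normr_rowP; first exact: ltW.
move=> i; rewrite !mxE; have [_ /(_ ord0 i)] := xb.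
by rewrite /ball/= distrC => /ltW.
Qed.

Let compact_sup_ball0 (M : R) : compact (sup_ball (0 : 'rV[R]_d) M).
Proof.
have [M0|M0] := leP 0 M; last first.
  rewrite (_ : sup_ball 0 M = set0); first exact: compact0.
  rewrite -subset0 => y /= /(le_trans (normr_ge0 _)); by rewrite leNgt M0.
rewrite (_ : sup_ball 0 M = [set v | forall i, `[- M, M]%classic (v ord0 i)]).
  exact: (@rV_compact R d (fun=> `[- M, M]%classic) (fun=> @segment_compact R (- M) M)).
apply/seteqP; split => y /=.
  by move=> /(normr_rowP _ M0) yM i; have := yM i; rewrite /= in_itv/= !mxE subr0 ler_norml.
move=> yM; apply/(normr_rowP _ M0) => i.
by have := yM i; rewrite /= in_itv/= !mxE subr0 ler_norml.
Qed.

Let lebesgue_sup_ball_fin (M : R) : 0 <= M ->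
  exists2 V : R, 0 <= V & lebesgue_row (sup_ball (0 : 'rV[R]_d) M) = V%:E.
Proof.
move=> M0; exists (\prod_(i < d) (M - - M)).
  by apply: prodr_ge0 => i _; lra.
rewrite (@lebesgue_row_squeeze _ _ (\row_i (- M)) (\row_i M)).
- by congr (_%:E); apply: eq_bigr => i _; rewrite !mxE.
- exact: measurable_sup_ball.
- by move=> i; rewrite !mxE; lra.
- move=> x xM; apply/(normr_rowP _ M0) => i; have := xM i; rewrite !mxE subr0 ler_norml.
  by move=> /andP[/ltW -> /ltW ->].
- by move=> x /(normr_rowP _ M0) xM i; have := xM i; rewrite !mxE subr0 ler_norml.
Qed.

(** All but e/2 of the mass of f lies in a ball of finite volume [V]. This ball is compact, so G_n
    >= f - e' holds eventually on all of it and costs at most e' V. *)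
Let I_ge (e : R) : 0 < e -> \forall n \near \oo, 1 - e <= I n.
Proof.
move=> e0; have e20 : 0 < e / 2 by rewrite divr_gt0.
have [M M0 HM] := density_concentrated hf e20.
have [V V0 VE] := lebesgue_sup_ball_fin (ltW M0).
pose e' := e / (2 * (V + 1)).
have V1 : 0 < 2 * (V + 1) by lra.
have e'0 : 0 < e' by rewrite divr_gt0.
have e'E : e' * (2 * (V + 1)) = e by rewrite divfK// gt_eqF.
near=> n.
have n0n : (n0 <= n)%N by near: n; exact: near_n0.
have HG : forall x, sup_ball 0 M x -> f x - e' <= G n x.
  near: n; apply: near_compact; first exact: compact_sup_ball0.
  move=> x0 _; have [rho rho0' H] := Gq_ge x0 e'0; exists rho => //.
  by apply: filterS H => n H x /H[].
have [mf _ _] := hf.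
have mfE : measurable_fun setT (fun x => (f x)%:E) by exact/measurable_EFinP.
have mGE : measurable_fun setT (fun x => (G n x)%:E) by apply/measurable_EFinP; exact: mG.
have mS := measurable_sup_ball (0 : 'rV[R]_d) M.
have : (\int[lebesgue_row]_(x in sup_ball (0 : 'rV[R]_d) M) (f x)%:E <= (I n)%:E + (e' * V)%:E)%E.
  apply: (@le_trans _ _ (\int[lebesgue_row]_(x in sup_ball (0 : 'rV[R]_d) M) ((G n x)%:E + e'%:E))%E).
    apply: ge0_le_integral => //.
    - by move=> x _; rewrite lee_fin.
    - exact: measurable_funTS.
    - by apply: measurable_funTS; exact: emeasurable_funD.
    - by move=> x /HG; rewrite -EFinD lee_fin; lra.
  rewrite ge0_integralD//; last 3 first.
  - by move=> x _; rewrite lee_fin G0.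
  - exact: measurable_funTS.
  - by move=> x _; rewrite lee_fin ltW.
  rewrite integral_cst//= VE -EFinM leeD2r// IE//.
  apply: ge0_subset_integral => //.
  by move=> x _; rewrite lee_fin G0.
move=> /(le_trans HM); rewrite -EFinD lee_fin => h.
have e'V : e' * (V + 1) = e / 2 by lra.
have : e' * V <= e' * (V + 1) by rewrite ler_pM2l// lerDl.
by lra.
Unshelve. all: by end_near. Qed.

(** * Local upper bounds *)

Let D_bounded n : (n0 <= n)%N -> exists2 C : R, 0 <= C & forall x, D n x <= C.
Proof.
move=> n0n; rewrite -(subnKC n0n); elim: (n - n0)%N => [|k [C C0 ih]].
  rewrite addn0; have [C HC] := Dn0; exists `|C| => // x.
  by have /andP[_ h] := HC x; exact: le_trans h (ler_norm _).
have n0k := leq_addr k n0.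
have /andP[g0 g1] := gamma01 (n0k : (n0 < (n0 + k).+1)%N).
have bk0 : 0 < b (n0 + k).+1 by apply: b0; exact: leqW.
have MK0 : 0 <= MK.
  by apply: le_trans (KM 0); have [_ K0 _] := hK.
have o0 : 0 <= b (n0 + k).+1 ^- d * MK.
  by rewrite mulr_ge0// invr_ge0 exprn_ge0// ltW.
exists (C + b (n0 + k).+1 ^- d * MK); first exact: addr_ge0.
move=> x; rewrite addnS DS//.
have D1 : Delta (n0 + k)%N x <= 0 + b (n0 + k).+1 ^- d * MK.
  (* A negative [delta] makes the near region empty, so only the supremum of the kernel counts. *)
  apply: (mollified_le hK (p := p (n0 + k)%N) (delta := -1) _ _ _ bk0 _ _ _ _ (DeltaE x n0k)) => //.
  - exact: mp.
  - exact: intp.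
  - by move=> y /(le_trans (normr_ge0 _)); rewrite leNgt ltrN10.
  - by move=> z _; rewrite ler_wpM2l// invr_ge0 exprn_ge0// ltW.
rewrite add0r in D1; apply: lerD.
  apply: (@le_trans _ _ ((1 - gamma (n0 + k).+1) * C)); first by rewrite ler_wpM2l ?subr_ge0.
  by rewrite ler_piMl// gerBl ltW.
apply: (@le_trans _ _ (gamma (n0 + k).+1 * (b (n0 + k).+1 ^- d * MK))); first by rewrite ler_pM2l.
by rewrite ler_piMl.
Qed.

Let Mq0 : 0 <= Mq. Proof. exact: le_trans (q00 0) (q0M 0). Qed.

Let G_le_cube x0 (e : R) : 0 < e -> \forall n \near \oo, forall y,
  n%:R ^+ 3 < `|y| -> G n y <= e * `|y - x0|.
Proof.
move=> e0; have [C GC] := G_le.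
near=> n.
have HC : forall x, G n x <= C * n%:R ^+ 2 by near: n; exact: GC.
have n1 : (1 : R) <= n%:R by rewrite ler1n; near: n; exact: nbhs_infty_gt.
have nC : (`|C| + e * `|x0|) / e <= n%:R by near: n; exact: nbhs_infty_ger.
move=> y ny; apply: (le_trans (HC y)).
have h1 : C * n%:R ^+ 2 <= `|C| * n%:R ^+ 2 by rewrite ler_wpM2r ?sqr_ge0 ?ler_norm.
have h2 : (`|C| + e * `|x0|) * n%:R ^+ 2 <= e * n%:R ^+ 3.
  rewrite [n%:R ^+ 3]exprS [leRHS]mulrA; apply: ler_wpM2r; first exact: sqr_ge0.
  by rewrite [leRHS]mulrC -ler_pdivrMr.
have h3 : e * `|x0| <= e * `|x0| * n%:R ^+ 2.
  by rewrite ler_peMr ?mulr_ge0 ?(ltW e0)// exprn_ege1.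
have h4 : e * n%:R ^+ 3 <= e * `|y| by rewrite ler_pM2l// ltW.
have h5 : e * `|y| <= e * (`|y - x0| + `|x0|).
  by rewrite ler_pM2l//; have := ler_normD (y - x0) x0; rewrite subrK.
lra.
Unshelve. all: by end_near. Qed.

(* [F + v n * (tau + |x - x0|)] is a supersolution: in the bound of
   [f^eta q^(1 - eta)] by [eta f + (1 - eta) q] the coefficient [v n] gets
   multiplied by about [1 - eta], which leaves room for the errors. *)
Let D_le_pt x0 (e : R) : 0 < e -> exists2 rho, 0 < rho & \forall n \near \oo,
  forall x, `|x - x0| <= rho -> D n x <= f x0 + e.
Proof.
move=> e0; have [e_0 e_1] := andP eta01.
have MfP := Mf0; have MqP := Mq0.
have e40 : 0 < e / 4 by rewrite divr_gt0.
have [r r0 Hr] := f_near x0 e40.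
pose F := f x0 + e / 4.
have F0 : 0 < F by have := f0 x0; rewrite /F; lra.
(* In [C0], Mf/r bounds f beyond distance [r], and 1 covers the additive errors between q_n and D_n.
   In [C1], the displacement by the kernel costs a factor 1 + zeta <= 2, and 1 covers the kernel
   tail [tau]. *)
pose C0 := Mf / r + 1; pose C1 := 2 * C0 + 1.
have Mfr : 0 <= Mf / r by rewrite divr_ge0// ltW.
have C00 : 0 < C0 by rewrite /C0; lra.
have C10 : 0 < C1 by rewrite /C1; lra.
pose th := 1 - eta / 2.
have th01 : 0 <= th < 1 by rewrite /th; apply/andP; split; lra.
(* [vs] eventually bounds [v] and does not involve [tau], which can thus be chosen after it so that
   vs (2 tau) = e/4. *)
pose vs := C1 / (1 - th) + 1.
have vs0 : 0 < vs by rewrite /vs addr_gt0// divr_gt0// subr_gt0; case/andP: th01.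
pose tau := e / (8 * vs).
have tau0 : 0 < tau by rewrite divr_gt0// mulr_gt0.
have tauE : tau * (8 * vs) = e by rewrite divfK// gt_eqF// mulr_gt0.
(* (1 + zeta)^3 <= 1 + 7 zeta = 1 + eta/2, and (1 - eta)(1 + eta/2) <= 1 - eta/2. The three factors
   stand for the noise, the mass and the displacement by [delta], which is [zeta * tau]. *)
pose zeta := eta / 14.
have zeta0 : 0 < zeta by rewrite divr_gt0.
have zeta1 : zeta <= 1 / 14 by rewrite /zeta; lra.
(* The second bound keeps the constant errors, at most eps (3 F + 4), below tau/2 and hence below
   half of [h]. *)
pose eps := Num.min zeta (tau / (2 * (3 * F + 4))).
have F4 : 0 < 2 * (3 * F + 4) by lra.
have eps0 : 0 < eps by rewrite lt_min zeta0 divr_gt0.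
have epsz : eps <= zeta by rewrite ge_min lexx.
have epsF : eps * (2 * (3 * F + 4)) <= tau by rewrite -ler_pdivlMr// ge_min lexx orbT.
have thE : (1 - eta) * ((1 + eps) * (1 + eps) * (1 + zeta)) <= th.
  have h1 : (1 + eps) * (1 + eps) * (1 + zeta) <= (1 + zeta) * (1 + zeta) * (1 + zeta).
    have e2 : (1 + eps) * (1 + eps) <= (1 + zeta) * (1 + zeta) by apply: ler_pM; lra.
    by apply: ler_pM; [apply: mulr_ge0; lra|lra|exact: e2|lra].
  have h2 : (1 + zeta) * (1 + zeta) * (1 + zeta) <= 1 + 7 * zeta by nra.
  have h3 : (1 - eta) * ((1 + eps) * (1 + eps) * (1 + zeta)) <= (1 - eta) * (1 + 7 * zeta).
    by rewrite ler_wpM2l//; lra.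
  have h4 : 0 <= eta * zeta by rewrite mulr_ge0// ltW.
  by rewrite /th /zeta in h3 h4 *; lra.
pose h y := tau + `|y - x0|.
have htau y : tau <= h y by rewrite /h lerDl.
have h0 y : 0 < h y by exact: lt_le_trans (htau y).
pose delta := zeta * tau.
have delta0 : 0 < delta by rewrite mulr_gt0.
have [beta beta0 Hbeta] := rescaled_tail r'0 CK0 Ktail delta0 tau0.
have eps20 : 0 < eps / 2 by rewrite divr_gt0.
have lam0 : 0 < eps / (Mq + 1) by rewrite divr_gt0//; lra.
have [N _ HN] : \forall n \near \oo, [/\ (n0 <= n)%N,
    forall y, `|y| <= n%:R ^+ 3 -> `|G n y - D n y| <= eps * (D n y + lambda n `^ (1 - eta)),
    forall y, n%:R ^+ 3 < `|y| -> G n y <= eps * `|y - x0|,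
    1 - eps / 2 <= I n /\ lambda n <= eps / (Mq + 1) & b n.+1 <= beta].
  near=> n; split.
  - by near: n; exact: near_n0.
  - by near: n; exact: GD.
  - by near: n; exact: G_le_cube.
  - by split; near: n; [exact: I_ge|exact: lambda_small].
  - by near: n; exact: b_small.
have n0N : (n0 <= N)%N by have [] := HN N (leqnn N).
have [CN CN0 DN] := D_bounded n0N.
(* As [h >= tau], the start dominates the bound [CN] on D_N. It may be huge, but the contraction
   forgets it. *)
pose w := fix w k := if k is k'.+1 then
  (1 - gamma (N + k)%N) * w k' + gamma (N + k)%N * (th * w k' + C1)
  else CN / tau.
pose v n := w (n - N)%N.
have vS n : (N <= n)%N ->
    v n.+1 = (1 - gamma n.+1) * v n + gamma n.+1 * (th * v n + C1).
  by move=> Nn; rewrite /v subSn//= addnS subnKC.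
have vN : v N = CN / tau by rewrite /v subnn.
have [th0 th1] := andP th01.
have zeta2 : 1 + zeta <= 2 by lra.
have eps14 : eps <= 14^-1 by rewrite (le_trans epsz)// (le_trans zeta1)// mul1r.
have eps1 : eps <= 1 by apply: le_trans eps14 _; rewrite invf_le1// ler1n.
have Mq1 : 0 < Mq + 1 by rewrite ltr_wpDl.
have v0 n : (N <= n)%N -> 0 <= v n.
  move=> Nn; rewrite -(subnKC Nn); elim: (n - N)%N => [|k ih].
    by rewrite addn0 vN divr_ge0// ltW.
  rewrite addnS vS ?leq_addr//.
  have /andP[g0 g1] := gamma01 (leq_trans n0N (leq_addr k N) : (n0 < (N + k).+1)%N).
  by rewrite addr_ge0// mulr_ge0// ?subr_ge0// ?(ltW g0)// addr_ge0 ?mulr_ge0// ltW.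
have step n (V : R) : (N <= n)%N -> 0 <= V -> (forall x, D n x <= F + V * h x) ->
    forall x, Delta n x <= F + (th * V + C1) * h x.
  move=> Nn V0 DV x; have [n0n HGD HGc [HI Hlam] bb] := HN n Nn.
  have bn0 : 0 < b n.+1 by apply: b0; exact: leqW.
  have Gy y : G n y <= (1 + eps) * (F + V * h y) + eps + eps * h y.
    have eh : 0 <= eps * h y by rewrite mulr_ge0// ltW.
    have eVh : 0 <= (1 + eps) * (F + V * h y).
      by rewrite mulr_ge0 ?addr_ge0 ?mulr_ge0// ltW.
    have [yn|yn] := leP `|y| (n%:R ^+ 3).
      have := HGD y yn; rewrite ler_norml => /andP[_ GDy].
      have l1 : eps * lambda n `^ (1 - eta) <= eps by rewrite ler_piMr ?lambda_pow_le1// ltW.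
      have : (1 + eps) * D n y <= (1 + eps) * (F + V * h y).
        by rewrite ler_wpM2l// addr_ge0// ltW.
      by lra.
    apply: (le_trans (HGc y yn)).
    have : eps * `|y - x0| <= eps * h y by rewrite ler_pM2l// /h lerDr ltW.
    by lra.
  have qy y : q n y <= F + ((1 + eps) * (1 + eps) * V + 1) * h y.
    rewrite qE//.
    have Gyy := Gy y; have G0y := G0 y n0n.
    have In0 := I0 n0n; have /andP[lam0' lam1] := lambda01 n0n.
    have GI : (1 - lambda n) * (G n y / I n) <= (1 + eps) * G n y.
      apply: (@le_trans _ _ (G n y / I n)).
        by rewrite ler_piMl ?divr_ge0// ?gerBl ltW.
      rewrite ler_pdivrMr//.
      have : (1 + eps) * G n y * (1 - eps / 2) <= (1 + eps) * G n y * I n.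
        by rewrite ler_wpM2l// mulr_ge0// addr_ge0// ltW.
      apply: le_trans; rewrite -subr_ge0.
      rewrite (_ : _ - _ = G n y * (eps * (1 - eps) / 2)); last by field.
      by rewrite mulr_ge0// divr_ge0// mulr_ge0 ?subr_ge0// ltW.
    have lq : lambda n * q0 y <= eps.
      apply: (@le_trans _ _ (eps / (Mq + 1) * (Mq + 1))); last by rewrite divfK// gt_eqF.
      by apply: ler_pM => //; [exact: ltW|by rewrite (le_trans (q0M y))// lerDl].
    have eh : 0 <= eps * h y by rewrite mulr_ge0// ltW.
    have G2 : (1 + eps) * G n y <= (1 + eps) * ((1 + eps) * (F + V * h y) + eps + eps * h y).
      by rewrite ler_wpM2l// addr_ge0// ltW.
    have ht := htau y.
    have eF : 0 <= eps * F by rewrite mulr_ge0// ltW.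
    have ee : eps * eps <= eps by rewrite ler_piMr// ltW.
    have eeF : eps * (eps * F) <= eps * F by rewrite ler_piMl.
    have eeh : eps * (eps * h y) <= eps * h y by rewrite ler_piMl.
    have eh1 : eps * h y <= h y / 14 by rewrite mulrC ler_pM2l.
    have e1 : (1 + eps) * ((1 + eps) * (F + V * h y) + eps + eps * h y) =
      (1 + eps) * (1 + eps) * V * h y + (F + 2 * (eps * F) + eps * (eps * F)) +
      eps + eps * eps + eps * h y + eps * (eps * h y) by ring.
    rewrite mulrDl mul1r; lra.
  have fy y : f y <= F + Mf / r * h y.
    have [yr|yr] := leP `|y - x0| r.
      have := Hr y yr; rewrite ler_norml => /andP[_ fyx].
      apply: (@le_trans _ _ F); first by rewrite -lerBlDl.
      by rewrite lerDl mulr_ge0// ltW.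
    have : Mf / r * r <= Mf / r * h y.
      by rewrite ler_wpM2l// (le_trans (ltW yr))// /h lerDr ltW.
    rewrite divfK ?gt_eqF// => MfE; apply: (le_trans (fM y)); apply: (le_trans MfE).
    by rewrite lerDr ltW.
  have py y : p n y <= F + ((1 - eta) * ((1 + eps) * (1 + eps) * V) + C0) * h y.
    apply: (le_trans (p_le y n0n)).
    have h1 : eta * f y <= eta * (F + Mf / r * h y) by rewrite ler_pM2l.
    have h2 : (1 - eta) * q n y <=
        (1 - eta) * (F + ((1 + eps) * (1 + eps) * V + 1) * h y).
      by rewrite ler_wpM2l.
    have h3 : eta * (Mf / r * h y) <= Mf / r * h y.
      by rewrite ler_piMl// mulr_ge0// ltW.
    have h4 : 0 <= eta * h y by rewrite mulr_ge0// ltW.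
    apply: (le_trans (lerD h1 h2)).
    rewrite /C0; set X := (1 + eps) * (1 + eps) * V; set Y := Mf / r in h3 *.
    have -> : F + ((1 - eta) * X + (Y + 1)) * h y =
      eta * (F + Y * h y) + (1 - eta) * (F + (X + 1) * h y) +
      (Y * h y - eta * (Y * h y)) + eta * h y by ring.
    by rewrite -[leRHS]addrA lerDl addr_ge0// subr_ge0.
  set W := (1 - eta) * ((1 + eps) * (1 + eps) * V) + C0 in py.
  have W0 : 0 <= W.
    by rewrite /W addr_ge0 ?(ltW C00)// mulr_ge0// !mulr_ge0// addr_ge0// ltW.
  have W1 : W * (1 + zeta) <= th * V + 2 * C0.
    have -> : W * (1 + zeta) =
        (1 - eta) * ((1 + eps) * (1 + eps) * (1 + zeta)) * V + C0 * (1 + zeta).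
      by rewrite /W; ring.
    by rewrite [2 * C0]mulrC lerD ?ler_wpM2r// ler_pM2l.
  apply: (@le_trans _ _ ((F + W * ((1 + zeta) * h x)) + tau)).
    apply: (mollified_le hK (p := p n) (delta := delta) _ _ _ bn0 _ _ _ _ (DeltaE x n0n)) => //.
    - exact: mp.
    - exact: intp.
    - by rewrite addr_ge0 ?(ltW F0)// !mulr_ge0 ?(ltW (h0 x))// addr_ge0// ltW.
    - exact: ltW.
    - move=> y yx; apply: (le_trans (py y)); rewrite lerD2l ler_wpM2l//.
      have tri : `|y - x0| <= `|y - x| + `|x - x0|.
        by have := ler_normD (y - x) (x - x0); rewrite addrA subrK.
      have zh : zeta * tau <= zeta * h x by rewrite ler_pM2l.
      apply: (@le_trans _ _ (tau + (`|y - x| + `|x - x0|))); first by rewrite lerD2l.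
      rewrite mulrDl mul1r addrCA [leRHS]addrC.
      exact: (lerD (le_trans yx zh) (lexx _)).
    - by move=> z; apply: Hbeta; rewrite bn0.
  rewrite -addrA lerD2l mulrA.
  have : W * (1 + zeta) * h x <= (th * V + 2 * C0) * h x by rewrite ler_wpM2r// ltW.
  by have := htau x; rewrite /C1; lra.
have Dv n : (N <= n)%N -> forall x, D n x <= F + v n * h x.
  move=> Nn; rewrite -(subnKC Nn); elim: (n - N)%N => [|k ih] x.
    rewrite addn0 vN; apply: (le_trans (DN x)).
    have : CN / tau * tau <= CN / tau * h x by rewrite ler_wpM2l// divr_ge0// ltW.
    rewrite divfK ?gt_eqF// => CNE; apply: (le_trans CNE).
    by rewrite lerDr ltW.
  have Nk := leq_addr k N; have n0k := leq_trans n0N Nk.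
  have /andP[g0 g1] := gamma01 (n0k : (n0 < (N + k).+1)%N).
  rewrite addnS vS// DS//.
  have h1 : (1 - gamma (N + k).+1) * D (N + k)%N x <=
      (1 - gamma (N + k).+1) * (F + v (N + k)%N * h x) by rewrite ler_wpM2l ?subr_ge0.
  have h2 : gamma (N + k).+1 * Delta (N + k)%N x <=
      gamma (N + k).+1 * (F + (th * v (N + k)%N + C1) * h x).
    by rewrite ler_pM2l//; apply: step => //; exact: v0.
  by apply: (le_trans (lerD h1 h2)); rewrite le_eqVlt; apply/orP; left; apply/eqP; ring.
have vle : \forall n \near \oo, v n <= vs.
  apply: (@contraction_le _ gamma Cg Cg0 gamma_ge N) => //.
  - by move=> n Nn; apply: gamma01; exact: leq_ltn_trans Nn.
  - by move=> n Nn; rewrite vS.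
exists tau => //; near=> n => x xt.
have Nn : (N <= n)%N by near: n; exact: nbhs_infty_ge.
apply: (le_trans (Dv n Nn x)).
have vn : v n <= vs by near: n.
have : v n * h x <= vs * (2 * tau).
  by apply: ler_pM => //; [exact: v0|exact: ltW|by rewrite /h mulr_natl mulr2n lerD2l].
by rewrite /F; lra.
Unshelve. all: by end_near. Qed.

Lemma q_cvg_locally x0 (e : R) : 0 < e -> exists2 rho, 0 < rho &
  \forall n \near \oo, forall x, `|x - x0| <= rho -> `|q n x - f x| <= e.
Proof.
move=> e0.
have e20 : 0 < e / 2 by rewrite divr_gt0.
have e40 : 0 < e / 4 by rewrite divr_gt0.
have [r1 r10 H1] := Gq_ge x0 e0.
have [r2 r20 H2] := D_le_pt x0 e40.
have [r3 r30 H3] := f_near x0 e40.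
(* Apart from e/4 for continuity and e/4 for D, the errors are at most twice eps (f x0 + e + Mq +
   1), that is e/16. *)
pose eps := Num.min (1 / 4) (e / (32 * (f x0 + e + Mq + 1))).
have fx0 := f0 x0; have MqP := Mq0.
have S0 : 0 < 32 * (f x0 + e + Mq + 1) by lra.
have eps0 : 0 < eps by rewrite lt_min !divr_gt0.
have eps4 : eps <= 1 / 4 by rewrite ge_min lexx.
have epsS : eps * (32 * (f x0 + e + Mq + 1)) <= e by rewrite -ler_pdivlMr// ge_min lexx orbT.
have eps20 : 0 < eps / 2 by rewrite divr_gt0.
exists (Num.min r1 (Num.min r2 r3)); first by rewrite !lt_min r10 r20.
near=> n.
have n0n : (n0 <= n)%N by near: n; exact: near_n0.
have In0 := I0 n0n.
have In : 1 - eps / 2 <= I n by near: n; exact: I_ge.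
have ln : lambda n <= eps by near: n; exact: lambda_small.
have HG : forall x, `|x - x0| <= r1 -> f x - e <= G n x /\ f x - e <= q n x by near: n.
have HD : forall x, `|x - x0| <= r2 -> D n x <= f x0 + e / 4 by near: n.
have Hxn : forall x, `|x - x0| <= r2 -> `|x| <= n%:R ^+ 3.
  by near: n; exact: in_cube.
have HGD : forall x, `|x| <= n%:R ^+ 3 ->
    `|G n x - D n x| <= eps * (D n x + lambda n `^ (1 - eta)).
  by near: n; exact: GD.
move=> x; rewrite !le_min => /and3P[xr1 xr2 xr3].
have [_ qx] := HG x xr1.
have := H3 x xr3; rewrite ler_norml => /andP[fx _].
have Dx := HD x xr2; have G0x := G0 x n0n.
have := HGD x (Hxn x xr2); rewrite ler_norml => /andP[_ GDx].
have l1 : eps * lambda n `^ (1 - eta) <= eps by rewrite ler_piMr ?lambda_pow_le1// ltW.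
have De : eps * D n x <= eps * (f x0 + e) by rewrite ler_pM2l//; lra.
have Gx : G n x <= f x0 + e / 4 + eps * (f x0 + e) + eps by lra.
have eP : 0 <= eps * (f x0 + e) by rewrite mulr_ge0 ?addr_ge0// ltW.
have eQ : 0 <= eps * Mq by rewrite mulr_ge0// ltW.
have G1 : G n x <= f x0 + e by lra.
have eG : eps * G n x <= eps * (f x0 + e) by rewrite ler_pM2l.
have /andP[lam0' lam1] := lambda01 n0n.
have GI : (1 - lambda n) * (G n x / I n) <= (1 + eps) * G n x.
  apply: (@le_trans _ _ (G n x / I n)).
    by rewrite ler_piMl ?divr_ge0// ?gerBl ltW.
  rewrite ler_pdivrMr//.
  have : (1 + eps) * G n x * (1 - eps / 2) <= (1 + eps) * G n x * I n.
    by rewrite ler_wpM2l// mulr_ge0// addr_ge0// ltW.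
  apply: le_trans; rewrite -subr_ge0.
  rewrite (_ : _ - _ = G n x * (eps * (1 - eps) / 2)); last by field.
  rewrite mulr_ge0// divr_ge0// mulr_ge0 ?(ltW eps0)// subr_ge0.
  by apply: le_trans eps4 _; rewrite ler_pdivrMr// mul1r ler1n.
have lq : lambda n * q0 x <= eps * Mq.
  by apply: ler_pM => //; exact: ltW.
rewrite ler_norml; apply/andP; split; first by lra.
rewrite qE//; lra.
Unshelve. all: by end_near. Qed.

Lemma q_cvg_compact (A : set 'rV[R]_d) (e : R) : compact A -> 0 < e ->
  \forall n \near \oo, forall x, A x -> `|q n x - f x| <= e.
Proof.
move=> cA e0; apply: near_compact => // x0 _; exact: q_cvg_locally.
Qed.

End deterministic.

(** * Disintegration *)

Section density_measure.
Context d (T : measurableType d) (R : realType).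
Variables (mu : {measure set T -> \bar R}) (rho : T -> R).
Hypotheses (mrho : measurable_fun setT rho) (rho0 : forall x, 0 <= rho x).

Let mrhoE : measurable_fun setT (fun x => (rho x)%:E).
Proof. exact/measurable_EFinP. Qed.

(** The two proofs are arguments so that the measure structure can be attached to the set
    function. *)
Definition density_measure of measurable_fun setT rho &
    (forall x, 0 <= rho x) := fun A : set T =>
  (\int[mu]_(x in A) (rho x)%:E)%E.

Local Notation dens := (density_measure mrho rho0).

Let density_measure0 : dens set0 = 0%E.
Proof. exact: integral_set0. Qed.

Let density_measure_ge0 A : (0 <= dens A)%E.
Proof. by apply: integral_ge0 => x _; rewrite lee_fin. Qed.

Let density_measure_additive : semi_sigma_additive dens.
Proof.
move=> F mF tF mUF.
have -> : dens (\bigcup_n F n) = (\sum_(n <oo) dens (F n))%E.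
  apply: ge0_integral_bigcup => //; first exact: measurable_funTS.
  by move=> x _; rewrite lee_fin.
by apply: is_cvg_nneseries => n _ _.
Qed.

HB.instance Definition _ := isMeasure.Build _ _ _ dens
  density_measure0 density_measure_ge0 density_measure_additive.

Import HBNNSimple.

Lemma integral_density_measure (g : T -> \bar R) :
  measurable_fun setT g -> (forall x, 0 <= g x)%E ->
  (\int[dens]_x g x = \int[mu]_x (g x * (rho x)%:E))%E.
Proof.
move=> mg g0; pose h := nnsfun_approx measurableT mg.
have cvg_h x : (h n x)%:E @[n --> \oo] --> g x by exact: cvg_nnsfun_approx.
have nd_h x : {homo (fun n => (h n x)%:E) : m n / (m <= n)%N >-> (m <= n)%E}.
  by move=> m n mn; rewrite lee_fin; exact/lefP/nd_nnsfun_approx.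
have mh n : measurable_fun setT (fun x => (h n x)%:E).
  by apply/measurable_EFinP; exact: measurable_funP.
transitivity (limn (fun n => \int[dens]_x (h n x)%:E)%E).
  rewrite -monotone_convergence//=.
  - by apply: eq_integral => x _; apply/esym/cvg_lim.
  - by move=> n x _; rewrite lee_fin.
transitivity (limn (fun n => \int[mu]_x ((h n x)%:E * (rho x)%:E))%E); last first.
  rewrite -monotone_convergence//=.
  - by apply: eq_integral => x _; apply/cvg_lim => //; exact: cvgeZr.
  - by move=> n; exact: emeasurable_funM.
  - by move=> n x _; rewrite mule_ge0// lee_fin.
  - by move=> x _ m n mn; rewrite lee_wpmul2r ?lee_fin ?nd_h// -lee_fin nd_h.
congr (limn _); apply/funext => n.
transitivity (\sum_(y \in range (h n))
    \int[dens]_x (y * \1_(h n @^-1` [set y]) x)%:E)%E.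
  rewrite -ge0_integral_fsum//.
  - by apply: eq_integral => x _; rewrite fimfunE -fsumEFin.
  - by move=> y; apply/measurable_EFinP; exact: measurable_funM.
  - by move=> y x _; exact: nnfun_muleindic_ge0.
transitivity (\sum_(y \in range (h n))
    \int[mu]_x ((y * \1_(h n @^-1` [set y]) x)%:E * (rho x)%:E))%E; last first.
  rewrite -ge0_integral_fsum//.
  - apply: eq_integral => x _; rewrite -ge0_mule_fsuml.
      by rewrite fsumEFin// -fimfunE.
    by move=> y; exact: nnfun_muleindic_ge0.
  - move=> y; apply: emeasurable_funM => //.
    by apply/measurable_EFinP; exact: measurable_funM.
  - by move=> y x _; rewrite mule_ge0 ?lee_fin ?rho0//; exact: nnfun_muleindic_ge0.
apply: eq_fsbigr => r _.
have mr : measurable (h n @^-1` [set r]) by [].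
rewrite integralZl_indic_nnsfun// integral_indic// setIT.
under [RHS]eq_integral do rewrite EFinM -muleA.
have [r0|r0] := ltP r 0.
  have -> : h n @^-1` [set r] = set0.
    rewrite -subset0 => x /= hx; have h0 : 0 <= h n x by [].
    by move: h0; rewrite hx leNgt r0.
  rewrite measure0 mule0; under eq_integral do rewrite indic0 mul0e mule0.
  by rewrite integral0.
rewrite ge0_integralZl//.
- congr (_ * _)%E; rewrite /density_measure [LHS]integral_mkcond.
  apply: eq_integral => x _; rewrite /patch indicE.
  by case: ifPn => xA; rewrite ?mul1e ?mul0e.
- by apply: emeasurable_funM => //; apply/measurable_EFinP.
- by move=> x _; rewrite mule_ge0 ?lee_fin.
Qed.
End density_measure.

Section disintegration.
Context {R : realType} d (T : measurableType d) (P : probability T R)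
  d1 (S : measurableType d1) d2 (V : measurableType d2)
  (leb : {sigma_finite_measure set V -> \bar R}).
Variables (iota : T -> S) (Y : T -> V) (q : S * V -> R).
Hypotheses (miota : measurable_fun setT iota) (mY : measurable_fun setT Y)
  (mq : measurable_fun setT q) (q0 : forall p, 0 <= q p).
Hypothesis qE : forall (E : set S) (B : set V), measurable E -> measurable B ->
  (P (iota @^-1` E `&` Y @^-1` B) =
   \int[P]_(w in iota @^-1` E) \int[leb]_(y in B) (q (iota w, y))%:E)%E.

(** [iota] is meant to be the identity, from T into T with a coarser sigma-algebra; joint
    measurability on [S * V] then says that the first variable is known from the past. Both sides
    integrate [Phi] against finite measures on [S * V] that agree on rectangles by [qE]. *)
Lemma disintegration (Phi : S * V -> \bar R) :
  measurable_fun setT Phi -> (forall p, 0 <= Phi p)%E ->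
  (\int[P]_w Phi (iota w, Y w) =
   \int[P]_w \int[leb]_y (Phi (iota w, y) * (q (iota w, y))%:E))%E.
Proof.
move=> mPhi Phi0.
have mqE : measurable_fun setT (fun p => (q p)%:E) by exact/measurable_EFinP.
have mpair : measurable_fun setT (fun w => (iota w, Y w)).
  exact: measurable_fun_pair.
have mlift : measurable_fun setT (fun p : T * V => (iota p.1, p.2)).
  by apply: measurable_fun_pair => //; exact: measurableT_comp.
pose rho (p : T * V) := q (iota p.1, p.2).
have mrho : measurable_fun setT rho by exact: measurableT_comp.
have rho0 p : 0 <= rho p by exact: q0.
pose dens : {measure set (T * V) -> \bar R} := density_measure (P \x leb)%E mrho rho0.
have densE E B : measurable E -> measurable B ->
    (dens (E `*` B) = \int[P]_(w in E) \int[leb]_(y in B) (q (iota w, y))%:E)%E.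
  move=> mE mB; rewrite /dens/= /density_measure integral_mkcond fubini_tonelli1//; last 2 first.
  - apply/(measurable_restrictT _ _).1; first exact: measurableX.
    by apply: measurable_funTS; exact/measurable_EFinP.
  - by move=> p; rewrite /patch; case: ifPn; rewrite ?lee_fin.
  rewrite [RHS]integral_mkcond; apply: eq_integral => w _; rewrite /fubini_F /patch.
  have [wE|wE] := pselect (E w).
    rewrite mem_set//= [RHS]integral_mkcond; apply: eq_integral => y _.
    rewrite /patch /rho/=; have [yB|yB] := pselect (B y); first by rewrite !mem_set.
    by rewrite !memNset//= => -[].
  rewrite memNset//=; under eq_integral.
    by move=> y _; rewrite memNset; [over|move=> -[]].
  by rewrite integral0.
pose m1 := measure_function_pushforward__canonical__measure_function_Measure P mpair.
pose m2 := measure_function_pushforward__canonical__measure_function_Measure dens mlift.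
have m1E : (\int[P]_w Phi (iota w, Y w) = \int[m1]_p Phi p)%E.
  by rewrite [RHS](@ge0_integral_pushforward _ _ _ _ R _ mpair P setT Phi).
have m2E : (\int[P]_w \int[leb]_y (Phi (iota w, y) * (q (iota w, y))%:E) =
    \int[m2]_p Phi p)%E.
  rewrite [RHS](@ge0_integral_pushforward _ _ _ _ R _ mlift dens setT Phi)//.
  rewrite integral_density_measure//; last 2 first.
  - exact: (measurableT_comp mPhi mlift).
  - by move=> p; exact: Phi0.
  rewrite fubini_tonelli1//.
    apply: emeasurable_funM; last exact/measurable_EFinP.
    exact: (measurableT_comp mPhi mlift).
  by move=> p; apply: mule_ge0; [exact: Phi0|rewrite lee_fin; exact: rho0].
rewrite m1E m2E; apply: eq_measure_integral => A mA _.
pose C : set (set (S * V)) :=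
  [set C | exists A, measurable A /\ exists B, measurable B /\ C = A `*` B].
apply: (measure_unique C (fun=> setT)) => //.
- rewrite measurable_prod_measurableType //; congr (<<s _ >>).
  rewrite predeqE; split => [[E mE [B mB <-]]|[E [mE [B [mB ->]]]]].
    by exists E; split => //; exists B.
  by exists E => //; exists B.
- move=> /= _ _ [X1 [mX1 [X2 [mX2 ->]]]] [Y1 [mY1 [Y2 [mY2 ->]]]].
  rewrite -setXI; exists (X1 `&` Y1); split; first exact: measurableI.
  by exists (X2 `&` Y2); split => //; exact: measurableI.
- by move=> _; exists setT; split => //; exists setT; split => //; rewrite setXTT.
- by rewrite bigcup_const.
- move=> _ [E [mE [B [mB ->]]]].
  rewrite /m1 /m2/= /pushforward.
  rewrite (_ : _ @^-1` _ = iota @^-1` E `&` Y @^-1` B)// qE//.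
  rewrite (_ : _ @^-1` _ = (iota @^-1` E) `*` B)// -densE//.
  by rewrite -[X in measurable X]setTI; exact: miota.
- by move=> _; rewrite /m1/= /pushforward preimage_setT probability_setT ltry.
Qed.
End disintegration.

(** * Concentration of sums of adapted variables *)

Section almost_sure_boundedness.
Context {R : realType} d (T : measurableType d) (P : {measure set T -> \bar R}).

(** Summable expectations make the series of the f_n converge almost surely, so f_n tends to 0. This
    stands for Markov's inequality followed by Borel-Cantelli. *)
Lemma ae_eventually_le1 (f : nat -> T -> R) (c : R^nat) :
  (forall n, measurable_fun setT (f n)) -> (forall n w, 0 <= f n w) ->
  (forall n, \int[P]_w (f n w)%:E <= (c n)%:E)%E -> cvgn (series c) ->
  {ae P, forall w, \forall n \near \oo, f n w <= 1}.
Proof.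
move=> mf f0 fc cc.
have mfE n : measurable_fun setT (fun w => (f n w)%:E) by exact/measurable_EFinP.
pose g w := (\sum_(0 <= n <oo) (f n w)%:E)%E.
have c0 n : 0 <= c n.
  by rewrite -lee_fin; apply: le_trans (fc n); apply: integral_ge0 => w _; rewrite lee_fin.
have mg : measurable_fun setT g.
  by apply: ge0_emeasurable_sum => // n w _ _; rewrite lee_fin.
have g0 w : (0 <= g w)%E by apply: nneseries_ge0 => n _ _; rewrite lee_fin.
have intg : P.-integrable setT g.
  apply/integrableP; split => //.
  under eq_integral do rewrite gee0_abs//.
  rewrite integral_nneseries//; last by move=> n w _; rewrite lee_fin.
  apply: (@le_lt_trans _ _ (\sum_(0 <= n <oo) (c n)%:E)%E).
    by apply: lee_nneseries => // n _ _; apply: integral_ge0 => w _; rewrite lee_fin.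
  rewrite (_ : (fun n => _) = EFin \o series c); last first.
    by apply/funext => n; rewrite /= sumEFin.
  rewrite EFin_lim// ltry//.
have := integrable_ae measurableT intg; apply: filterS => w /(_ I) gfin.
have cvgw : cvgn (series (fun n => f n w)).
  apply: nondecreasing_is_cvgn; first by apply: nondecreasing_series.
  exists (fine (g w)) => _ [n _ <-].
  rewrite -lee_fin fineK// /series/= -sumEFin.
  by apply: nneseries_lim_ge => k _ _; rewrite lee_fin.
exact: cvgr_le (cvg_series_cvg_0 cvgw) _ ltr01.
Qed.

End almost_sure_boundedness.

(** Squaring exp(- x/2) >= 1 - x/2 gives exp(x) <= (1 - x/2)^-2, and (1 + x + x^2)(1 - x/2)^2 - 1 =
    x^2 (1 - 3 x + x^2) / 4 is nonnegative for x <= 1/4. *)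
Lemma expR_le_quadratic {R : realType} (x : R) : `|x| <= 1 / 4 ->
  expR x <= 1 + x + x ^+ 2.
Proof.
rewrite ler_norml => /andP[x1 x2].
have h : 0 < 1 - x / 2 by lra.
have -> : expR x = (expR (- (x / 2)))^-1 ^+ 2.
  by rewrite expRN invrK expr2 -expRD -splitr.
have e1 : (expR (- (x / 2)))^-1 <= (1 - x / 2)^-1.
  by rewrite lef_pV2 ?posrE ?expR_gt0// (le_trans _ (expR_ge1Dx _)).
apply: (@le_trans _ _ ((1 - x / 2)^-1 ^+ 2)).
  by rewrite ler_sqr ?nnegrE ?invr_ge0 ?expR_ge0// ltW.
rewrite exprVn -[leLHS]mul1r ler_pdivrMr ?exprn_gt0//.
have h2 : 0 <= x ^+ 2 * (1 - 3 * x + x ^+ 2).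
  by rewrite mulr_ge0 ?sqr_ge0//; have := sqr_ge0 x; lra.
rewrite -subr_ge0.
have -> : (1 + x + x ^+ 2) * (1 - x / 2) ^+ 2 - 1 = x ^+ 2 * (1 - 3 * x + x ^+ 2) / 4 by field.
by rewrite divr_ge0.
Qed.

Section chernoff.
Context {R : realType} d (T : measurableType d) (P : probability T R)
  d2 (V : measurableType d2) (leb : {sigma_finite_measure set V -> \bar R}).
Variables (F : (set (set T))^nat) (Y : nat -> T -> V) (q : nat -> T -> V -> R).
Local Notation S n := (g_sigma_algebraType (F n)).
Hypotheses (F_measurable : forall n, F n `<=` @measurable _ T)
  (F_incr : forall n, F n `<=` <<s F n.+1 >>)
  (Y_adapted : forall n, measurable_fun setT (Y n : S n.+1 -> V))
  (mq : forall n, measurable_fun setT (fun p : S n * V => q n p.1 p.2))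
  (q0 : forall n w y, 0 <= q n w y)
  (q1 : forall n, {ae P, forall w, \int[leb]_y (q n w y)%:E = 1}%E)
  (law : forall n (E : set T) (B : set V), <<s F n >> E -> measurable B ->
    (P (E `&` Y n @^-1` B) = \int[P]_(w in E) \int[leb]_(y in B) (q n w y)%:E)%E).

Let mid n : measurable_fun setT (idfun : T -> S n).
Proof.
move=> _ E mE; rewrite setTI preimage_id.
by move: E mE; apply: smallest_sub; [exact: sigma_algebra_measurable|exact: F_measurable].
Qed.

Let mid_incr n : measurable_fun setT (idfun : S n.+1 -> S n).
Proof.
move=> _ E mE; rewrite setTI preimage_id.
by move: E mE; apply: smallest_sub; [exact: smallest_sigma_algebra|exact: F_incr].
Qed.

Let mY n : measurable_fun setT (Y n : T -> V).
Proof. exact: (measurableT_comp (@Y_adapted n) (@mid n.+1)). Qed.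

(** The conditional expectation of [zeta n w (Y n w)] given the sigma-algebra generated by [F n]. *)
Definition predictable_mean (zeta : nat -> T -> V -> R) (n : nat) (w : T) : R :=
  fine (\int[leb]_y (zeta n w y * q n w y)%:E)%E.

Variable zeta : nat -> T -> V -> R.
Hypotheses (mzeta : forall n, measurable_fun setT (fun p : S n * V => zeta n p.1 p.2))
  (zeta01 : forall n w y, 0 <= zeta n w y <= 1).

Let A := predictable_mean zeta.

Let zq0 n w y : 0 <= zeta n w y * q n w y.
Proof. by rewrite mulr_ge0//; have /andP[] := zeta01 n w y. Qed.

Lemma measurable_predictable_mean n : measurable_fun setT (A n : S n -> R).
Proof.
apply: measurableT_comp; first exact: fine_measurable.
apply: (@measurable_fun_fubini_tonelli_F _ _ (S n) V R leb
  (fun p => (zeta n p.1 p.2 * q n p.1 p.2)%:E)).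
- by apply/measurable_EFinP; exact: measurable_funM.
- by move=> p; rewrite lee_fin.
Qed.

Variable theta : R.
Hypothesis theta4 : `|theta| <= 1 / 4.

Let M n w := expR (theta * (\sum_(k < n) zeta k w (Y k w)) -
  (theta + theta ^+ 2) * (\sum_(k < n) A k w)).

Let mM n : measurable_fun setT (M n : S n -> R).
Proof.
elim: n => [|n ih].
  rewrite (_ : M 0%N = cst 1); first exact: measurable_cst.
  by apply/funext => w; rewrite /M !big_ord0 !mulr0 subr0 expR0.
have -> : (M n.+1 : S n.+1 -> R) = fun w => M n w *
    expR (theta * zeta n w (Y n w) - (theta + theta ^+ 2) * A n w).
  apply/funext => w; rewrite /M !big_ord_recr/= -expRD; congr expR; ring.
apply: measurable_funM; first exact: (measurableT_comp ih (@mid_incr n)).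
apply: (measurableT_comp (@measurable_expR R)).
apply: measurable_funB; apply: measurable_funM => //.
  exact: (measurableT_comp (@mzeta n) (measurable_fun_pair (@mid_incr n) (@Y_adapted n))).
exact: (measurableT_comp (@measurable_predictable_mean n) (@mid_incr n)).
Qed.

(* For z in [0, 1], E exp (theta z) <= exp ((theta + theta^2) E z), so [M] is a
   supermartingale. *)
Lemma chernoff n : (\int[P]_w (M n w)%:E <= 1)%E.
Proof.
elim: n => [|n ih].
  rewrite (eq_integral (cst 1%E)); last first.
    by move=> w _; rewrite /M !big_ord0 !mulr0 subr0 expR0.
  by rewrite integral_cst// mul1e; exact: probability_le1.
apply: le_trans ih.
pose c := theta + theta ^+ 2.
pose Phi (p : S n * V) := ((M n p.1 * expR (- (c * A n p.1)))%:E *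
  (expR (theta * zeta n p.1 p.2))%:E)%E.
have mfst : measurable_fun setT (fun p : S n * V => (M n p.1 * expR (- (c * A n p.1)))).
  have : measurable_fun setT (fun w : S n => (M n w * expR (- (c * A n w)))).
    apply: measurable_funM => //; apply: (measurableT_comp (@measurable_expR R)).
    apply: measurableT_comp => //; apply: measurable_funM => //.
    exact: measurable_predictable_mean.
  by move=> h; exact: (measurableT_comp h measurable_fst).
have mz : measurable_fun setT (fun p : S n * V => expR (theta * zeta n p.1 p.2)).
  apply: (measurableT_comp (@measurable_expR R)).
  by apply: measurable_funM.
have mPhi : measurable_fun setT Phi.
  by apply: emeasurable_funM; exact/measurable_EFinP.
have Phi0 p : (0 <= Phi p)%E by rewrite /Phi -EFinM lee_fin !mulr_ge0// expR_ge0.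
have -> : (\int[P]_w (M n.+1 w)%:E = \int[P]_w Phi ((w : S n), Y n w))%E.
  apply: eq_integral => w _; rewrite /Phi -EFinM /=; congr (_%:E).
  rewrite /M !big_ord_recr/= -!expRD; congr expR; rewrite /c; ring.
rewrite (@disintegration R d T P _ (S n) _ V leb idfun (Y n)
  (fun p : S n * V => q n p.1 p.2) (@mid n) (@mY n) (@mq n)) //; last first.
  by move=> E B mE mB; rewrite preimage_id law.
have mq' w : measurable_fun setT (q n w).
  exact: (measurableT_comp (@mq n) (measurable_pair1 (w : S n))).
have mz' w : measurable_fun setT (zeta n w).
  exact: (measurableT_comp (@mzeta n) (measurable_pair1 (w : S n))).
apply: ae_ge0_le_integral => //.
- move=> w _; apply: integral_ge0 => y _; rewrite mule_ge0// lee_fin; exact: q0.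
- have mI : measurable_fun setT
      (fun w : S n => \int[leb]_y (Phi (w, y) * (q n w y)%:E))%E.
    apply: (@measurable_fun_fubini_tonelli_F _ _ (S n) V R leb
      (fun p => Phi p * (q n p.1 p.2)%:E)%E).
      by apply: emeasurable_funM => //; exact/measurable_EFinP.
    by move=> p; rewrite mule_ge0// lee_fin.
  exact: (measurableT_comp mI (@mid n)).
- by move=> w _; rewrite lee_fin expR_ge0.
- by apply/measurable_EFinP; exact: (measurableT_comp (@mM n) (@mid n)).
have := q1 n; apply: filterS => w qw _.
have intzq : (\int[leb]_y (zeta n w y * q n w y)%:E = (A n w)%:E)%E.
  rewrite fineK// ge0_fin_numE; last by apply: integral_ge0 => y _; rewrite lee_fin.
  apply: (@le_lt_trans _ _ (\int[leb]_y (q n w y)%:E)%E); last by rewrite qw ltry.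
  apply: ge0_le_integral => //.
  - by move=> y _; rewrite lee_fin.
  - by apply/measurable_EFinP; exact: measurable_funM.
  - exact/measurable_EFinP.
  - by move=> y _; rewrite lee_fin ler_piMl//; have /andP[] := zeta01 n w y.
rewrite /Phi/=.
rewrite (eq_integral (fun y => (M n w * expR (- (c * A n w)))%:E *
  (expR (theta * zeta n w y) * q n w y)%:E)%E); last first.
  by move=> y _; rewrite -!EFinM -mulrA.
rewrite ge0_integralZl_EFin//; last 3 first.
- by move=> y _; rewrite lee_fin mulr_ge0// expR_ge0.
- apply/measurable_EFinP; apply: measurable_funM => //.
  by apply: (measurableT_comp (@measurable_expR R)); exact: measurable_funM.
- by rewrite mulr_ge0// expR_ge0.
rewrite EFinM -muleA -[leRHS]mule1 lee_pmul2l ?lte_fin ?expR_gt0//.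
(* As u^2 <= u, the quadratic term is controlled by the mean; this is what makes the deviation
   relative. *)
have c_le u : 0 <= u <= 1 -> expR (theta * u) <= 1 + c * u.
  move=> /andP[u0 u1]; apply: (le_trans (expR_le_quadratic _)).
    rewrite normrM [`|u|]ger0_norm//; apply: le_trans theta4.
    by rewrite ler_piMr.
  have : theta ^+ 2 * u ^+ 2 <= theta ^+ 2 * u.
    by rewrite ler_wpM2l ?sqr_ge0// expr2 ler_piMr.
  by rewrite exprMn /c; lra.
have mzq : measurable_fun setT (fun y => zeta n w y * q n w y) by exact: measurable_funM.
have intq : leb.-integrable setT (EFin \o q n w).
  apply/integrableP; split; first exact/measurable_EFinP.
  under eq_integral do rewrite /= ger0_norm//.
  by rewrite qw ltry.
have intzqi : leb.-integrable setT (EFin \o (fun y => zeta n w y * q n w y)).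
  apply/integrableP; split; first exact/measurable_EFinP.
  under eq_integral do rewrite /= ger0_norm//.
  by rewrite intzq ltry.
apply: (@le_trans _ _ ((expR (- (c * A n w)))%:E * (1 + c * A n w)%:E)%E); last first.
  by rewrite -EFinM lee_fin expRN mulrC ler_pdivrMr ?expR_gt0// mul1r expR_ge1Dx.
rewrite lee_pmul2l ?lte_fin ?expR_gt0//.
apply: (@le_trans _ _ (\int[leb]_y ((q n w y)%:E + c%:E * (zeta n w y * q n w y)%:E))%E).
  apply: ge0_le_integral => //.
  - by move=> y _; rewrite lee_fin mulr_ge0// expR_ge0.
  - apply/measurable_EFinP; apply: measurable_funM => //.
    by apply: (measurableT_comp (@measurable_expR R)); exact: measurable_funM.
  - by apply: emeasurable_funD; [exact/measurable_EFinP|apply: measurable_funeM; exact/measurable_EFinP].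
  - move=> y _; rewrite -EFinM -EFinD lee_fin.
    rewrite mulrA -[X in X + _]mul1r -mulrDl ler_wpM2r//; exact: c_le.
rewrite integralD//; last exact: integrableZl.
by rewrite qw integralZl// intzq -EFinM -EFinD.
Qed.
End chernoff.

(** Telescoping: 1/x^2 <= 2 (1/x - 1/(x + 1)) for x >= 1. *)
Lemma is_cvg_series_inv_square {R : realType} (C : R) : 0 <= C ->
  cvgn (series (fun n => C * n.+1%:R ^- 2)).
Proof.
move=> C0; apply: nondecreasing_is_cvgn.
  by apply: nondecreasing_series => n _ _; rewrite mulr_ge0// invr_ge0 exprn_ge0.
exists (2 * C) => _ [n _ <-].
apply: (@le_trans _ _ (2 * C * (1 - n.+1%:R^-1))); last first.
  by rewrite ler_piMr ?mulr_ge0// gerBl invr_ge0.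
elim: n => [|n ih]; first by rewrite /series/= big_geq// invr1 subrr mulr0.
rewrite seriesSr; apply: (le_trans (lerD ih (lexx _))).
rewrite -subr_ge0.
have n1 : 0 < n.+1%:R :> R by rewrite ltr0n.
rewrite -[n.+2]addn1 natrD; set x : R := n.+1%:R in n1 *.
rewrite (_ : _ - _ = C * (x - 1) / (x ^+ 2 * (x + 1))).
  rewrite divr_ge0// mulr_ge0//; last by rewrite addr_ge0// ltW.
    by rewrite /x subr_ge0 ler1n.
  by rewrite exprn_ge0// ltW.
by field; rewrite !gt_eqF// addr_gt0.
Qed.

Section concentration.
Context {R : realType} d (T : measurableType d) (P : probability T R)
  d2 (V : measurableType d2) (leb : {sigma_finite_measure set V -> \bar R}).
Variables (F : (set (set T))^nat) (Y : nat -> T -> V) (q : nat -> T -> V -> R).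
Local Notation S n := (g_sigma_algebraType (F n)).
Hypotheses (F_measurable : forall n, F n `<=` @measurable _ T)
  (F_incr : forall n, F n `<=` <<s F n.+1 >>)
  (Y_adapted : forall n, measurable_fun setT (Y n : S n.+1 -> V))
  (mq : forall n, measurable_fun setT (fun p : S n * V => q n p.1 p.2))
  (q0 : forall n w y, 0 <= q n w y)
  (q1 : forall n, {ae P, forall w, \int[leb]_y (q n w y)%:E = 1}%E)
  (law : forall n (E : set T) (B : set V), <<s F n >> E -> measurable B ->
    (P (E `&` Y n @^-1` B) = \int[P]_(w in E) \int[leb]_(y in B) (q n w y)%:E)%E).
Variables (N : nat -> nat) (zeta : nat -> nat -> nat -> T -> V -> R).
Hypotheses (mzeta : forall n j k,
    measurable_fun setT (fun p : S k * V => zeta n j k p.1 p.2))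
  (zeta01 : forall n j k w y, 0 <= zeta n j k w y <= 1).
Variables (C : R) (m : nat).
Hypothesis N_le : forall n, (N n)%:R <= C * n.+1%:R ^+ m.

Let mean n j k := predictable_mean leb q (zeta n j) k.
Let sumS n j w := \sum_(k < n) zeta n j k w (Y k w).
Let sumA n j w := \sum_(k < n) mean n j k w.

(** Union bound over [N n] indices: dividing by (n+1)^(m+2) leaves expectations of order (n+1)^-2.
    The array depends on [n], as the weights of a recursive average do, so there is one
    supermartingale for each [n] and [j], evaluated at time [n] only. *)
Lemma concentration (e : R) : 0 < e <= 1 / 4 ->
  {ae P, forall w, \forall n \near \oo, forall j, (j < N n)%N ->
    `|sumS n j w - sumA n j w| <=
      e * sumA n j w + m.+2%:R / e * ln n.+1%:R}.
Proof.
move=> /andP[e0 e4].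
pose M n j theta w := expR (theta * sumS n j w - (theta + theta ^+ 2) * sumA n j w).
pose f n w := n.+1%:R ^- m.+2 * \sum_(j < N n) (M n j e w + M n j (- e) w).
have mid n : measurable_fun setT (idfun : T -> S n).
  move=> _ E mE; rewrite setTI preimage_id.
  by move: E mE; apply: smallest_sub; [exact: sigma_algebra_measurable|exact: F_measurable].
have mS n j : measurable_fun setT (sumS n j).
  apply: measurable_sum => k.
  have mYk : measurable_fun setT (Y k : T -> V).
    exact: (measurableT_comp (@Y_adapted k) (@mid k.+1)).
  exact: (measurableT_comp (@mzeta n j k) (measurable_fun_pair (@mid k) mYk)).
have mA n j : measurable_fun setT (sumA n j).
  apply: measurable_sum => k.
  have := @measurable_predictable_mean _ _ _ _ _ leb F q mq q0 (zeta n j) (@mzeta n j) (@zeta01 n j) k.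
  by move=> h; exact: (measurableT_comp h (@mid k)).
have mM n j theta : measurable_fun setT (M n j theta).
  apply: (measurableT_comp (@measurable_expR R)).
  by apply: measurable_funB; exact: measurable_funM.
have M0 n j theta w : 0 <= M n j theta w by exact: expR_ge0.
have EM n j theta : `|theta| <= 1 / 4 -> (\int[P]_w (M n j theta w)%:E <= 1)%E.
  move=> th4; exact: (@chernoff _ _ _ P _ _ leb F Y q F_measurable F_incr Y_adapted
    mq q0 q1 law (zeta n j) (@mzeta n j) (@zeta01 n j) theta th4 n).
have C0 : 0 <= C by have := N_le 0%N; rewrite expr1n mulr1; apply: le_trans.
have : {ae P, forall w, \forall n \near \oo, f n w <= 1}.
  apply: (@ae_eventually_le1 _ _ _ P f (fun n => (2 * C) * n.+1%:R ^- 2)).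
  - move=> n; apply: measurable_funM => //; apply: measurable_sum => j.
    exact: measurable_funD.
  - move=> n w; rewrite mulr_ge0 ?invr_ge0 ?exprn_ge0//.
    by apply: sumr_ge0 => j _; rewrite addr_ge0.
  - move=> n; rewrite /f.
    have nm0 : 0 <= n.+1%:R ^- m.+2 :> R by rewrite invr_ge0 exprn_ge0.
    have mMM (j : 'I_(N n)) : measurable_fun setT (fun w => (M n j e w + M n j (- e) w)%:E).
      by apply/measurable_EFinP; exact: measurable_funD.
    rewrite (eq_integral (fun w => (n.+1%:R ^- m.+2)%:E *
      \sum_(j < N n) (M n j e w + M n j (- e) w)%:E)%E); last first.
      by move=> w _; rewrite sumEFin.
    rewrite ge0_integralZl_EFin//; last 2 first.
    + by move=> w _; apply: sume_ge0 => j _; rewrite lee_fin addr_ge0.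
    + exact: emeasurable_sum.
    rewrite ge0_integral_sum//; last by move=> j w _; rewrite lee_fin addr_ge0.
    apply: (@le_trans _ _ ((n.+1%:R ^- m.+2)%:E * \sum_(j < N n) 2%:E)%E).
      apply: lee_wpmul2l; first by rewrite lee_fin.
      apply: lee_sum => j _.
      under eq_integral do rewrite EFinD.
      rewrite ge0_integralD//; first 1 last.
      * by move=> w _; rewrite lee_fin.
      * by apply/measurable_EFinP.
      * by move=> w _; rewrite lee_fin.
      * by apply/measurable_EFinP.
      rewrite (_ : 2%:E = 1 + 1)%E; last by rewrite -EFinD.
      by apply: leeD; apply: EM; rewrite ?normrN gtr0_norm.
    rewrite sumEFin sumr_const card_ord -EFinM lee_fin -[2 *+ _]mulr_natr.
    rewrite /= mulrCA -mulrA ler_pM2l// ler_pdivrMl ?exprn_gt0//.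
    apply: (le_trans (N_le n)); rewrite mulrCA; apply: ler_wpM2l => //.
    by rewrite -[m.+2]addn2 exprD mulfK// expf_neq0// pnatr_eq0.
  - by apply: is_cvg_series_inv_square; rewrite mulr_ge0.
apply: filterS => w; apply: filterS => n fn j jN.
have nm0 : 0 < n.+1%:R ^+ m.+2 :> R by rewrite exprn_gt0.
(* A sum of nonnegative terms bounds each of them; taking logarithms, the two signs of theta give
   the two sides of the deviation. *)
have Mle theta : (theta = e \/ theta = - e) -> theta * sumS n j w -
    (theta + theta ^+ 2) * sumA n j w <= m.+2%:R * ln n.+1%:R.
  move=> th; rewrite mulr_natl -lnXn ?ltr0n// -[leLHS]expRK ler_ln ?posrE ?expR_gt0//.
  rewrite -/(M n j theta w); move: fn; rewrite /f mulrC ler_pdivrMr// mul1r; apply: le_trans.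
  rewrite (bigD1 (Ordinal jN))//= -addrA.
  have [->|->] := th.
    rewrite lerDl addr_ge0//; apply: sumr_ge0 => i _; exact: addr_ge0.
  rewrite addrCA lerDl addr_ge0//; apply: sumr_ge0 => i _; exact: addr_ge0.
have := Mle e (or_introl erefl); have := Mle (- e) (or_intror erefl).
set s := sumS n j w; set a := sumA n j w; set l := ln _ => h1 h2.
have le0 : 0 < e by [].
rewrite -(ler_pM2l e0) mulrDr [e * (m.+2%:R / e * l)](_ : _ = m.+2%:R * l); last first.
  by field; rewrite gt_eqF.
rewrite -[X in X * `|_|](gtr0_norm e0) -normrM ler_norml.
by rewrite sqrrN in h1; apply/andP; split; lra.
Qed.

End concentration.

(** * Recursive averages and rates *)

Section relaxation.
Context {R : realType}.
Variables (gamma : R^nat) (n0 : nat).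

Fixpoint relaxation_from (a : R) (z : R^nat) (k : nat) : R :=
  if k is k'.+1 then
    (1 - gamma (n0 + k)%N) * relaxation_from a z k' + gamma (n0 + k)%N * z (n0 + k')%N
  else a.

Definition relaxation a z n := relaxation_from a z (n - n0).

Lemma relaxation0 a z : relaxation a z n0 = a.
Proof. by rewrite /relaxation subnn. Qed.

Lemma relaxationS a z n : (n0 <= n)%N -> relaxation a z n.+1 =
  (1 - gamma n.+1) * relaxation a z n + gamma n.+1 * z n.
Proof. by move=> n0n; rewrite /relaxation subSn//= addnS subnKC. Qed.

Lemma relaxation_uniq a z (u : R^nat) n : (n0 <= n)%N -> u n0 = a ->
  (forall n, (n0 <= n)%N -> u n.+1 = (1 - gamma n.+1) * u n + gamma n.+1 * z n) ->
  u n = relaxation a z n.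
Proof.
move=> n0n ua uS; rewrite -(subnKC n0n); elim: (n - n0)%N => [|k ih].
  by rewrite addn0 relaxation0.
by rewrite addnS uS ?leq_addr// relaxationS ?leq_addr// ih.
Qed.

(** The coefficient of z_k in the value at time n. Being 0 for [k < n0], it lets sums run over all
    [k < n], the form used by [concentration]. *)
Definition relaxation_weight (n k : nat) : R :=
  if (n0 <= k < n)%N then gamma k.+1 * \prod_(k.+2 <= j < n.+1) (1 - gamma j) else 0.

Lemma relaxation_weightS n k : (k < n)%N ->
  relaxation_weight n.+1 k = (1 - gamma n.+1) * relaxation_weight n k.
Proof.
move=> kn; rewrite /relaxation_weight ltnS kn (ltnW kn) !andbT.
case: ifPn => _; last by rewrite mulr0.
by rewrite big_nat_recr//=; ring.
Qed.

Lemma relaxation_weight_diag n : (n0 <= n)%N -> relaxation_weight n.+1 n = gamma n.+1.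
Proof. by move=> n0n; rewrite /relaxation_weight n0n ltnSn/= big_geq// mulr1. Qed.

Lemma relaxationE a z n : (n0 <= n)%N ->
  relaxation a z n = a * \prod_(n0.+1 <= j < n.+1) (1 - gamma j) +
    \sum_(k < n) relaxation_weight n k * z k.
Proof.
move=> n0n; rewrite -(subnKC n0n); elim: (n - n0)%N => [|m ih].
  rewrite addn0 relaxation0 big_geq// mulr1 big1 ?addr0// => k _.
  by rewrite /relaxation_weight leqNgt ltn_ord/= mul0r.
rewrite addnS relaxationS ?leq_addr// ih big_ord_recr/=.
rewrite relaxation_weight_diag ?leq_addr//.
rewrite mulrDr -addrA; congr (_ + _).
  by rewrite [in RHS]big_nat_recr/= ?ltnS ?leq_addr//; ring.
congr (_ + _); rewrite mulr_sumr; apply: eq_bigr => k _.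
by rewrite relaxation_weightS// mulrA.
Qed.

Hypothesis gamma01 : forall n, (n0 < n)%N -> 0 < gamma n <= 1.
Hypothesis gamma_step : forall n, (n0 <= n)%N ->
  gamma n - gamma n.+1 <= gamma n * gamma n.+1.

Lemma relaxation_weight_ge0 n k : 0 <= relaxation_weight n k.
Proof.
rewrite /relaxation_weight; case: ifPn => // /andP[n0k kn].
rewrite mulr_ge0//; first by have /andP[/ltW] := gamma01 (n0k : (n0 < k.+1)%N).
rewrite big_nat; apply: prodr_ge0 => j /andP[kj _].
have n0j : (n0 < j)%N by apply: leq_trans (ltnW kj); rewrite ltnS.
by have /andP[_] := gamma01 n0j; rewrite subr_ge0.
Qed.

(* The hypothesis on [gamma] says that (1 - gamma_(n+1)) gamma_n <= gamma_(n+1),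
   so the weight of the last term is the largest one. *)
Lemma relaxation_weight_le n k : (n0 < n)%N -> relaxation_weight n k <= gamma n.
Proof.
move=> n0n; have gn : 0 <= gamma n by have /andP[/ltW] := gamma01 n0n.
case: (boolP (n0 <= k < n)%N) => [/andP[n0k kn]|h]; last first.
  by rewrite /relaxation_weight (negPf h).
rewrite -(subnKC kn) addSn; elim: (n - k.+1)%N => [|m ih].
  by rewrite addn0 relaxation_weight_diag.
rewrite addnS relaxation_weightS ?ltnS ?leq_addr//.
have n0km : (n0 <= (k + m).+1)%N by rewrite leqW// (leq_trans n0k)// leq_addr.
have /andP[g0 g1] := gamma01 (n0km : (n0 < (k + m).+2)%N).
apply: (@le_trans _ _ ((1 - gamma (k + m).+2) * gamma (k + m).+1)).
  by rewrite ler_wpM2l ?subr_ge0.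
by have := gamma_step n0km; lra.
Qed.

(** The constant 1 solves the recursion with input 1; expanding it writes 1 as the sum of the
    weights plus a nonnegative product. *)
Lemma sum_relaxation_weight_le1 n : (n0 <= n)%N ->
  \sum_(k < n) relaxation_weight n k <= 1.
Proof.
move=> n0n.
have h : relaxation 1 (fun=> 1) n = 1.
  by rewrite -(@relaxation_uniq 1 (fun=> 1) (fun=> 1) n)// => k _; rewrite !mulr1 subrK.
have := relaxationE 1 (fun=> 1) n0n; rewrite h mul1r.
rewrite -mulr_suml mulr1.
move=> E; rewrite [leRHS]E lerDr big_nat; apply: prodr_ge0 => j /andP[n0j _].
by have /andP[_] := gamma01 n0j; rewrite subr_ge0.
Qed.

End relaxation.

(** * Consequences of the rate hypotheses *)

Section rates.
Context {R : realType} {d : nat}.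
Variables (eta : R) (gamma b lambda : R^nat) (Cg : R).
Hypotheses (d1 : (1 <= d)%N) (eta01 : 0 < eta <= 1) (Cg0 : 0 < Cg)
  (gamma_gt0 : forall n, (1 <= n)%N -> 0 < gamma n)
  (b_gt0 : forall n, (1 <= n)%N -> 0 < b n)
  (lambda_01 : forall n, (1 <= n)%N -> 0 < lambda n <= 1)
  (b_cvg : b @ \oo --> 0)
  (gamma_ge : forall n, (1 <= n)%N -> n%:R^-1 <= Cg * gamma n)
  (rate_large_eta : 1 / 2 <= eta ->
    n%:R * gamma n ^+ 2 * ln n%:R / (lambda n * b n ^+ d) @[n --> \oo] --> 0)
  (rate_small_eta : eta < 1 / 2 ->
    n%:R * gamma n ^+ 2 * ln n%:R /
      (lambda n `^ (2 * (1 - eta)) * b n `^ (2 * d%:R * (1 - eta)))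
      @[n --> \oo] --> 0).

Let b_le1 : \forall n \near \oo, b n <= 1.
Proof. exact: cvgr_le b_cvg _ ltr01. Qed.

Lemma rate_cvg (e : R) : 0 < e -> \forall n \near \oo,
  gamma n * ln n%:R / (lambda n * b n ^+ d) <= e.
Proof.
move=> e0; have [eta0 eta1] := andP eta01.
have eC : 0 < e / Cg by rewrite divr_gt0.
have h : \forall n \near \oo,
    n%:R * gamma n * (gamma n * ln n%:R / (lambda n * b n ^+ d)) <= e / Cg.
  have [eta2|eta2] := leP (1 / 2) eta.
    have : \forall n \near \oo,
        n%:R * gamma n ^+ 2 * ln n%:R / (lambda n * b n ^+ d) <= e / Cg.
      by exact: cvgr_le (rate_large_eta eta2) _ eC.
    apply: filterS => n; apply: le_trans.
    by rewrite le_eqVlt; apply/orP; left; apply/eqP; ring.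
  near=> n.
  have n1 : (1 <= n)%N by near: n; exact: nbhs_infty_gt.
  have : n%:R * gamma n ^+ 2 * ln n%:R /
      (lambda n `^ (2 * (1 - eta)) * b n `^ (2 * d%:R * (1 - eta))) <= e / Cg.
    by near: n; exact: cvgr_le (rate_small_eta eta2) _ eC.
  apply: le_trans.
  have g0 := gamma_gt0 n1; have bn0 := b_gt0 n1; have /andP[l0 l1] := lambda_01 n1.
  have bn1 : b n <= 1 by near: n.
  rewrite (_ : n%:R * gamma n * _ =
    n%:R * gamma n ^+ 2 * ln n%:R * (lambda n * b n ^+ d)^-1); last by ring.
  rewrite ler_wpM2l//.
    by rewrite !mulr_ge0// ?exprn_ge0 ?(ltW g0)// ln_ge0// ler1n.
  rewrite lef_pV2 ?posrE ?mulr_gt0 ?powR_gt0 ?exprn_gt0//.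
  have e1 : 1 <= 2 * (1 - eta) by lra.
  apply: ler_pM; rewrite ?powR_ge0//.
    by apply: ge1r_powR; rewrite ?l0.
  rewrite -powR_mulrn ?(ltW bn0)//; apply: ger_powR; first by rewrite bn0.
  have : d%:R * 1 <= d%:R * (2 * (1 - eta)) :> R by rewrite ler_wpM2l.
  lra.
near=> n.
have n1 : (1 <= n)%N by near: n; exact: nbhs_infty_gt.
have hn : n%:R * gamma n * (gamma n * ln n%:R / (lambda n * b n ^+ d)) <= e / Cg.
  by near: n.
have g0 := gamma_gt0 n1; have bn0 := b_gt0 n1; have /andP[l0 l1] := lambda_01 n1.
have r0 : 0 <= gamma n * ln n%:R / (lambda n * b n ^+ d).
  rewrite divr_ge0// mulr_ge0 ?exprn_ge0 ?(ltW g0) ?(ltW l0) ?(ltW bn0)//.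
  by rewrite ln_ge0// ler1n.
have ng : 1 <= Cg * (n%:R * gamma n).
  rewrite mulrCA -ler_pdivrMl ?ltr0n// mulr1; exact: gamma_ge.
have : 1 * (gamma n * ln n%:R / (lambda n * b n ^+ d)) <=
    Cg * (n%:R * gamma n) * (gamma n * ln n%:R / (lambda n * b n ^+ d)).
  by rewrite ler_wpM2r.
rewrite mul1r => /le_trans; apply.
by rewrite -mulrA mulrC -ler_pdivlMr.
Unshelve. all: by end_near. Qed.

(** Once the ratio of [rate_cvg] is at most 1/Cg and log n >= 1, lambda_n b_n^d >= Cg gamma_n >=
    1/n; each factor is at most 1, hence itself at least 1/n. *)
Lemma polynomial_rates : \forall n \near \oo,
  [/\ n%:R^-1 <= lambda n, n%:R^-1 <= b n ^+ d & n%:R^-1 <= b n].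
Proof.
have eC : 0 < Cg^-1 by rewrite invr_gt0.
have hr := rate_cvg eC.
near=> n.
have n1 : (1 <= n)%N by near: n; exact: nbhs_infty_gt.
have g0 := gamma_gt0 n1; have bn0 := b_gt0 n1; have /andP[l0 l1] := lambda_01 n1.
have bn1 : b n <= 1 by near: n.
have n0 : 0 < n%:R :> R by rewrite ltr0n.
have ln1 : 1 <= ln n%:R :> R.
  rewrite -[leLHS]expRK ler_ln ?posrE ?expR_gt0//.
  by near: n; exact: nbhs_infty_ger.
have hn : gamma n * ln n%:R / (lambda n * b n ^+ d) <= Cg^-1 by near: n.
have lb0 : 0 < lambda n * b n ^+ d by rewrite mulr_gt0// exprn_gt0.
have hlb : n%:R^-1 <= lambda n * b n ^+ d.
  rewrite ler_pdivrMr// in hn.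
  apply: (le_trans (gamma_ge n1)); rewrite -ler_pdivlMl//; apply: le_trans hn.
  by rewrite ler_peMr// ltW.
have bd1 : b n ^+ d <= 1 by rewrite exprn_ile1// ltW.
have hl : n%:R^-1 <= lambda n.
  by apply: (le_trans hlb); rewrite ler_piMr// ltW.
have hb : n%:R^-1 <= b n ^+ d.
  by apply: (le_trans hlb); rewrite ler_piMl// exprn_ge0// ltW.
split => //; apply: (le_trans hb).
by apply: ler_iXnr => //; exact: ltW.
Unshelve. all: by end_near. Qed.

End rates.

(** * The sampling recursion *)

Lemma measurable_fun_Rintegral {R : realType} d1 (S : measurableType d1)
    d2 (V : measurableType d2) (leb : {sigma_finite_measure set V -> \bar R})
    (phi : S * V -> R) : measurable_fun setT phi ->
  measurable_fun setT (fun s => \int[leb]_y phi (s, y)).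
Proof.
move=> mphi.
have mphiE : measurable_fun setT (fun p => (phi p)%:E) by exact/measurable_EFinP.
apply: measurableT_comp; first exact: fine_measurable.
rewrite (_ : (fun _ => _) = fun s => (\int[leb]_y ((fun p => (phi p)%:E)^\+ (s, y)) -
    \int[leb]_y ((fun p => (phi p)%:E)^\- (s, y)))%E); last first.
  apply/funext => s; rewrite [LHS]integralE.
  by congr (_ - _)%E; apply: eq_integral => y _; rewrite ?funeposE ?funenegE.
apply: emeasurable_funB.
  exact: (@measurable_fun_fubini_tonelli_F _ _ S V R leb _ (measurable_funepos mphiE)).
exact: (@measurable_fun_fubini_tonelli_F _ _ S V R leb _ (measurable_funeneg mphiE)).
Qed.

Lemma measurable_invr {R : realType} : measurable_fun setT (@GRing.inv R).
Proof.
rewrite -(setvU [set 0]); apply/measurable_funU => //; first exact: measurableC.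
split; last exact: measurable_fun_set1.
apply: open_continuous_measurable_fun; first exact/closed_openC/closed_eq.
by move=> x; rewrite inE => /eqP x0; exact: inv_continuous.
Qed.

(** Moves a relative deviation bound from a grid point (primed) to a nearby point: [m] bounds the
    oscillation of sum and mean, and costs at most 3 m, which is paid by a second e l. *)
Lemma deviation_shift {R : realType} (e m l s s' a a' : R) : 0 < e <= 1 / 4 ->
  s <= s' + m -> s' <= s + m -> a <= a' + m -> a' <= a + m ->
  `|s' - a'| <= e * (a' + l) -> 3 * m <= e * l ->
  `|s - a| <= e * a + 2 * e * l.
Proof.
move=> /andP[e0 e1] s1 s2 a1 a2; rewrite !ler_norml => /andP[h1 h2] ml.
have m0 : 0 <= m by lra.
have ea : e * a' <= e * (a + m) by rewrite ler_pM2l.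
have em : e * m <= m by rewrite ler_piMl//; lra.
by apply/andP; split; lra.
Qed.

Section adaptive.
Context {R : realType} {d : nat} {dT : measure_display} {T : measurableType dT}
  {P : probability T R}.
Variables (X : {RV P >-> 'rV[R]_d}^nat) (eta : R) (f fu q0 K : 'rV[R]_d -> R)
  (cu c : R) (gamma b lambda : R^nat) (g q : nat -> T -> 'rV[R]_d -> R).
Hypotheses (eta01 : 0 < eta <= 1) (hf : is_density f) (cu0 : 0 < cu)
  (fuE : forall x, fu x = cu * f x) (hK : is_density K) (hq0 : is_density q0)
  (b_gt0 : forall n, (1 <= n)%N -> 0 < b n)
  (lambda_01 : forall n, (1 <= n)%N -> 0 < lambda n <= 1)
  (lambda_decr : forall m n, (1 <= m <= n)%N -> lambda n <= lambda m)
  (hs : adaptive_sampling X fu q0 K eta gamma b lambda g q)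
  (c_gt0 : 0 < c) (fu_le_q0 : forall x, c * fu x <= q0 x).

Local Notation leb := (@lebesgue_row R d).

(** The family that generates [past n]; it increases with n, as required by the Chernoff bound. *)
Definition generators n : set (set T) := \big[setU/set0]_(i < n)
  preimage_set_system setT (X i.+1 : T -> 'rV[R]_d) measurable.
Local Notation S n := (g_sigma_algebraType (generators n)).

Lemma generators_measurable n : generators n `<=` @measurable _ T.
Proof.
rewrite /generators -(bigcup_mkord n (fun i =>
  preimage_set_system setT (X i.+1 : T -> 'rV[R]_d) measurable)).
by move=> E [i /= _ [B mB <-]]; exact: (measurable_funP (X i.+1)).
Qed.

Lemma generators_incr n : generators n `<=` <<s generators n.+1 >>.
Proof.
move=> E nE; apply: sub_sigma_algebra; rewrite /generators big_ord_recr/=.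
by left.
Qed.

Lemma sample_adapted n : measurable_fun setT (X n.+1 : S n.+1 -> 'rV[R]_d).
Proof.
move=> _ B mB; apply: sub_sigma_algebra; rewrite /generators big_ord_recr/=.
by right; exists B.
Qed.

Let mid n : measurable_fun setT (idfun : T -> S n).
Proof.
move=> _ E mE; rewrite setTI preimage_id.
by move: E mE; apply: smallest_sub; [exact: sigma_algebra_measurable|exact: generators_measurable].
Qed.

Let mid_incr n : measurable_fun setT (idfun : S n.+1 -> S n).
Proof.
move=> _ E mE; rewrite setTI preimage_id.
by move: E mE; apply: smallest_sub; [exact: smallest_sigma_algebra|exact: generators_incr].
Qed.

Let mf : measurable_fun setT f. Proof. by case: hf. Qed.
Let mq0 : measurable_fun setT q0. Proof. by case: hq0. Qed.
Let f0 x : 0 <= f x. Proof. by case: hf. Qed.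
Let mfu : measurable_fun setT fu.
Proof. by rewrite (_ : fu = fun x => cu * f x); [exact: measurable_funM|exact/funext]. Qed.

(** A joint induction, as g_(n+1) involves q_n at X_(n+1) and q_(n+1) involves the integral of
    g_(n+1). Measurability in both variables relative to F_n is what the disintegration requires. *)
Let mgq n : measurable_fun setT (fun p : S n * 'rV[R]_d => g n p.1 p.2) /\
  measurable_fun setT (fun p : S n * 'rV[R]_d => q n p.1 p.2).
Proof.
elim: n => [|n [mgn mqn]].
  split.
    rewrite (_ : (fun _ => _) = cst 0); first exact: measurable_cst.
    by apply/funext => p; rewrite (as_g0 hs).
  rewrite (_ : (fun _ => _) = q0 \o snd); first exact: measurableT_comp.
  by apply/funext => p; rewrite (as_q0 hs).
have mlift : measurable_fun setT (fun p : S n.+1 * 'rV[R]_d => (p.1 : S n, p.2)).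
  apply: measurable_fun_pair => //.
  exact: (measurableT_comp (@mid_incr n) measurable_fst).
have mX : measurable_fun setT (fun p : S n.+1 * 'rV[R]_d => X n.+1 p.1).
  exact: (measurableT_comp (@sample_adapted n) measurable_fst).
have mliftX : measurable_fun setT (fun p : S n.+1 * 'rV[R]_d => (p.1 : S n, X n.+1 p.1)).
  apply: measurable_fun_pair => //.
  exact: (measurableT_comp (@mid_incr n) measurable_fst).
have mgS : measurable_fun setT (fun p : S n.+1 * 'rV[R]_d => g n.+1 p.1 p.2).
  rewrite (_ : (fun _ => _) = fun p : S n.+1 * 'rV[R]_d =>
      (1 - gamma n.+1) * g n p.1 p.2 + gamma n.+1 *
        (fu (X n.+1 p.1) / q n p.1 (X n.+1 p.1)) `^ eta *
        rescaled K (b n.+1) (p.2 - X n.+1 p.1)); last first.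
    by apply/funext => p; rewrite (as_gS hs).
  apply: measurable_funD.
    by apply: measurable_funM => //; exact: (measurableT_comp mgn mlift).
  apply: measurable_funM; last first.
    apply: (measurableT_comp (measurable_rescaled hK (b n.+1))).
    exact: measurable_fun_rowB.
  apply: measurable_funM => //.
  apply: (measurableT_comp (measurable_powR eta)).
  apply: measurable_funM; first exact: (measurableT_comp mfu mX).
  by apply: (measurableT_comp measurable_invr); exact: (measurableT_comp mqn mliftX).
split => //.
rewrite (_ : (fun _ => _) = fun p : S n.+1 * 'rV[R]_d =>
    (1 - lambda n.+1) * (g n.+1 p.1 p.2 / \int[leb]_y g n.+1 p.1 y) +
    lambda n.+1 * q0 p.2); last first.
  by apply/funext => p; rewrite (as_qS hs).
apply: measurable_funD; apply: measurable_funM => //; last first.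
  exact: (measurableT_comp mq0 measurable_snd).
apply: measurable_funM => //; apply: (measurableT_comp measurable_invr).
exact: (measurableT_comp (measurable_fun_Rintegral leb mgS) measurable_fst).
Qed.

Let mg n : measurable_fun setT (fun p : S n * 'rV[R]_d => g n p.1 p.2).
Proof. by have [] := mgq n. Qed.

Let mq n : measurable_fun setT (fun p : S n * 'rV[R]_d => q n p.1 p.2).
Proof. by have [] := mgq n. Qed.

Lemma measurable_mixture_density n w : measurable_fun setT (g n w).
Proof. exact: (measurableT_comp (@mg n) (measurable_pair1 (w : S n))). Qed.

Let c0 := c * cu.
Let c00 : 0 < c0. Proof. exact: mulr_gt0. Qed.

Let c0f_le x : c0 * f x <= q0 x.
Proof. by apply: le_trans (fu_le_q0 x); rewrite fuE mulrA. Qed.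

(* The first policy q0 corresponds to the missing value lambda_0 = 1. *)
Let lam n := if n is 0 then 1 else lambda n.

Let lam01 n : 0 < lam n <= 1.
Proof. by case: n => [|n] /=; [rewrite ltr01 lexx|exact: lambda_01]. Qed.

(* The policy density, made nonnegative and bounded below on the null event
   where the recursion is not well defined. *)
Definition safe_density n w y := Num.max (q n w y) (lam n * (c0 * f y)).
Local Notation q' := safe_density.

Let lamf0 n y : 0 <= lam n * (c0 * f y).
Proof. by have /andP[l0 _] := lam01 n; rewrite mulr_ge0 ?(ltW l0)// mulr_ge0// ltW. Qed.

Lemma safe_density_ge0 n w y : 0 <= q' n w y.
Proof. by rewrite le_max lamf0 orbT. Qed.

Lemma measurable_safe_density n :
  measurable_fun setT (fun p : S n * 'rV[R]_d => q' n p.1 p.2).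
Proof.
apply: measurable_maxr => //; apply: measurable_funM => //; apply: measurable_funM => //.
exact: (measurableT_comp mf measurable_snd).
Qed.

Definition well_defined_at (w : T) := (forall n x, 0 <= g n w x) /\
  (forall n, (0 < n)%N -> 0 < \int[leb]_y g n w y).

Lemma ae_well_defined : {ae P, forall w, well_defined_at w}.
Proof. exact: (as_well_defined hs). Qed.

Lemma safe_densityE n w y : well_defined_at w -> q' n w y = q n w y.
Proof.
move=> [g0 I0]; apply/max_idPl; case: n => [|n].
  by rewrite (as_q0 hs) mul1r.
rewrite (as_qS hs) /=; have /andP[l0 l1] := lambda_01 (ltn0Sn n).
apply: (@le_trans _ _ (lambda n.+1 * q0 y)); first by rewrite ler_pM2l.
by rewrite lerDr mulr_ge0 ?subr_ge0// divr_ge0// ltW// I0.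
Qed.

(** The weight w_(n+1)^eta divided by c_u^eta. Where q' vanishes, so does f, and the quotient is 0
    by convention. *)
Definition importance n w y := (f y / q' n w y) `^ eta.

Lemma importance_ge0 n w y : 0 <= importance n w y.
Proof. exact: powR_ge0. Qed.

Lemma importance_le n w y : importance n w y <= (c0 * lam n)^-1 `^ eta.
Proof.
have [eta0 eta1] := andP eta01; have /andP[l0 l1] := lam01 n.
apply: ge0_ler_powR; rewrite ?nnegrE ?(ltW eta0)//.
- by rewrite divr_ge0// safe_density_ge0.
- by rewrite invr_ge0 mulr_ge0// ltW.
have [fy|fy] := eqVneq (f y) 0.
  by rewrite fy mul0r invr_ge0 mulr_ge0// ltW.
have fy0 : 0 < f y by rewrite lt_neqAle eq_sym fy f0.
have q'0 : 0 < q' n w y by rewrite lt_max; apply/orP; right; rewrite !mulr_gt0.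
rewrite ler_pdivrMr// ler_pdivlMl ?mulr_gt0//.
by rewrite le_max; apply/orP; right; rewrite mulrCA mulrA.
Qed.

Lemma measurable_importance n :
  measurable_fun setT (fun p : S n * 'rV[R]_d => importance n p.1 p.2).
Proof.
apply: (measurableT_comp (measurable_powR eta)).
apply: measurable_funM; first exact: (measurableT_comp mf measurable_snd).
exact: (measurableT_comp measurable_invr (@measurable_safe_density n)).
Qed.

(** Where q' = 0 the lower bound built into q' forces f = 0, so both sides vanish, even for
    [eta = 1], when the last factor is 0^0 = 1. *)
Lemma importance_safe_density n w y :
  importance n w y * q' n w y = f y `^ eta * q' n w y `^ (1 - eta).
Proof.
have [eta0 eta1] := andP eta01; have q'0 := safe_density_ge0 n w y.
have [q'E|q'N] := eqVneq (q' n w y) 0.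
  have fy : f y = 0.
    apply/eqP; rewrite eq_le f0 andbT.
    have : lam n * (c0 * f y) <= 0 by rewrite -q'E le_max lexx orbT.
    by have /andP[l0 _] := lam01 n; rewrite pmulr_rle0// pmulr_rle0.
  by rewrite q'E mulr0 fy powR0 ?mul0r// gt_eqF.
rewrite /importance powRM ?invr_ge0// -mulrA; congr (_ * _).
rewrite -powR_inv1// -powRrM mulN1r -{2}[q' n w y]powRr1//.
by rewrite -powRD ?q'N ?implybT// addrC.
Qed.

Let integrable_rescaled_shift (bb : R) (x : 'rV[R]_d) : 0 < bb ->
  leb.-integrable setT (fun y => (rescaled K bb (y - x))%:E).
Proof.
move=> b0; apply/integrableP; split.
  apply/measurable_EFinP/(measurableT_comp (measurable_rescaled hK bb)).
  exact: measurable_fun_rowB.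
under eq_integral do rewrite /= ger0_norm ?rescaled_ge0//.
by rewrite integral_rescaled// ltry.
Qed.

Lemma integrable_mixture n w : leb.-integrable setT (EFin \o g n w).
Proof.
elim: n => [|n ih].
  rewrite (_ : _ \o _ = cst 0%E); first exact: integrable0.
  by apply/funext => x /=; rewrite (as_g0 hs).
rewrite (_ : _ \o _ = fun x => ((1 - gamma n.+1)%:E * (g n w x)%:E +
    (gamma n.+1 * (fu (X n.+1 w) / q n w (X n.+1 w)) `^ eta)%:E *
    (rescaled K (b n.+1) (x - X n.+1 w))%:E)%E); last first.
  by apply/funext => x /=; rewrite (as_gS hs) -!EFinM -EFinD.
apply: integrableD => //; first exact: integrableZl.
by apply: integrableZl => //; apply: integrable_rescaled_shift; exact: b_gt0.
Qed.

Definition mass n w := \int[leb]_y g n w y.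

Lemma massE n w : ((mass n w)%:E = \int[leb]_y (g n w y)%:E)%E.
Proof.
by rewrite /mass /Rintegral fineK//; exact: integrable_fin_num (integrable_mixture n w).
Qed.

Lemma massS n w : mass n.+1 w = (1 - gamma n.+1) * mass n w +
  gamma n.+1 * (fu (X n.+1 w) / q n w (X n.+1 w)) `^ eta.
Proof.
apply: EFin_inj; rewrite massE.
rewrite (eq_integral (fun x => ((1 - gamma n.+1)%:E * (g n w x)%:E +
    (gamma n.+1 * (fu (X n.+1 w) / q n w (X n.+1 w)) `^ eta)%:E *
    (rescaled K (b n.+1) (x - X n.+1 w))%:E)%E)); last first.
  by move=> x _; rewrite (as_gS hs) -!EFinM -EFinD.
have bn := b_gt0 (ltn0Sn n).
have ig := integrable_mixture n w.
have ik := integrable_rescaled_shift (X n.+1 w) bn.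
rewrite integralD//; [|exact: integrableZl|exact: integrableZl].
by rewrite !integralZl// integral_rescaled// mule1 -massE -EFinM -EFinD.
Qed.

Lemma integral_safe_density n w : well_defined_at w ->
  (\int[leb]_y (q' n w y)%:E = 1)%E.
Proof.
move=> wd; under eq_integral do rewrite safe_densityE//.
have [_ _ iq0] := hq0.
case: n => [|n].
  by under eq_integral do rewrite (as_q0 hs).
have iq : leb.-integrable setT (fun y => (q0 y)%:E).
  apply/integrableP; split; first exact/measurable_EFinP.
  have [_ q00 _] := hq0.
  by under eq_integral do rewrite /= ger0_norm//; rewrite iq0 ltry.
have [g0 /(_ n.+1 isT) I0] := wd.
have ig := integrable_mixture n.+1 w.
rewrite (eq_integral (fun y => (((1 - lambda n.+1) / mass n.+1 w)%:E * (g n.+1 w y)%:E +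
   (lambda n.+1)%:E * (q0 y)%:E))%E); last first.
  by move=> y _; rewrite (as_qS hs) -!EFinM -EFinD; congr (_%:E); rewrite mulrAC mulrA.
rewrite integralD//; [|exact: integrableZl|exact: integrableZl].
rewrite !integralZl// -massE iq0 mule1 -EFinM -EFinD divfK ?gt_eqF//.
by rewrite subrK.
Qed.

Lemma law_safe_density n (E : set T) (B : set 'rV[R]_d) :
  <<s generators n >> E -> measurable B ->
  (P (E `&` X n.+1 @^-1` B) =
   \int[P]_(w in E) \int[leb]_(y in B) (q' n w y)%:E)%E.
Proof.
move=> nE mB; have [mp ->//] := as_law hs n mB.
have mE : measurable E.
  by have := @mid n measurableT E nE; rewrite setTI preimage_id.
apply: ae_eq_integral => //.
- apply: measurable_funTS => _ C mC; rewrite setTI.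
  by have := @mid n measurableT _ (mp C mC); rewrite setTI preimage_id.
- apply: measurable_funTS.
  have mI : measurable_fun setT (fun w : S n => \int[leb]_(y in B) (q' n w y)%:E)%E.
    rewrite (_ : (fun _ => _) = fun w : S n =>
        (\int[leb]_y (q' n w y * \1_B y)%:E)%E); last first.
      apply/funext => w; rewrite integral_mkcond; apply: eq_integral => y _.
      by rewrite /patch indicE; case: ifPn => _; rewrite ?mulr1 ?mulr0.
    apply: (@measurable_fun_fubini_tonelli_F _ _ (S n) 'rV[R]_d R leb
      (fun p => (q' n p.1 p.2 * \1_B p.2)%:E)).
      apply/measurable_EFinP; apply: measurable_funM; first exact: measurable_safe_density.
      by apply: (measurableT_comp _ measurable_snd).
    by move=> p; rewrite lee_fin mulr_ge0 ?safe_density_ge0.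
  exact: (measurableT_comp mI (@mid n)).
- have := ae_well_defined; apply: filterS => w wd _.
  by apply: eq_integral => y _; rewrite safe_densityE.
Qed.

(** * Noise estimates *)

Variables (MK LK Cg : R) (n0 : nat).
Hypotheses (d1 : (1 <= d)%N) (KM : forall z, K z <= MK)
  (LK0 : 0 <= LK) (KL : forall x y, `|K x - K y| <= LK * `|x - y|)
  (b_decr : forall m n, (1 <= m <= n)%N -> b n <= b m)
  (n01 : (1 <= n0)%N)
  (gamma01 : forall n, (n0 < n)%N -> 0 < gamma n <= 1)
  (gamma_step : forall n, (n0 <= n)%N -> gamma n - gamma n.+1 <= gamma n * gamma n.+1)
  (b_le1 : forall n, (n0 <= n)%N -> b n <= 1)
  (rate : forall e : R, 0 < e -> \forall n \near \oo,
    gamma n * ln n%:R / (lambda n * b n ^+ d) <= e)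
  (poly : \forall n \near \oo,
    [/\ n%:R^-1 <= lambda n, n%:R^-1 <= b n ^+ d & n%:R^-1 <= b n]).

Let W := relaxation_weight gamma n0.
Let W0 n k : 0 <= W n k. Proof. exact: relaxation_weight_ge0. Qed.

Let K0 z : 0 <= K z. Proof. by case: hK. Qed.
Let MK0 : 0 <= MK. Proof. exact: le_trans (K0 0) (KM 0). Qed.

(** With b_n <= 1, H b_n^-d bounds both kinds of test functions: the constant 1 and the kernels. *)
Let H := Num.max 1 MK.
Let H1 : 1 <= H. Proof. by rewrite le_max lexx. Qed.

Let maxw n := (c0 * lambda n)^-1 `^ eta.

Let maxw_gt0 n : (1 <= n)%N -> 0 < maxw n.
Proof.
by move=> /lambda_01/andP[l0 _]; rewrite powR_gt0// invr_gt0 mulr_gt0.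
Qed.

Let importance_le_maxw n k w y : (n0 <= k < n)%N -> importance k w y <= maxw n.
Proof.
move=> /andP[n0k kn]; apply: (le_trans (importance_le k w y)).
have k1 := leq_trans n01 n0k.
have n1 := leq_trans k1 (ltnW kn).
have -> : lam k = lambda k by case: (k) k1.
have /andP[lk0 _] := lambda_01 k1; have /andP[ln0 _] := lambda_01 n1.
have [eta0 _] := andP eta01.
have p1 : 0 < c0 * lambda k by exact: mulr_gt0.
have p2 : 0 < c0 * lambda n by exact: mulr_gt0.
apply: ge0_ler_powR; rewrite ?nnegrE ?invr_ge0; [exact: ltW..|].
rewrite lef_pV2 ?posrE// ler_pM2l//.
by apply: lambda_decr; rewrite k1 ltnW.
Qed.

Let bV_le n k : (1 <= k <= n)%N -> b k ^- d <= b n ^- d.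
Proof.
move=> /andP[k1 kn]; have bk := b_gt0 k1; have bn := b_gt0 (leq_trans k1 kn).
rewrite lef_pV2 ?posrE ?exprn_gt0//.
by rewrite lerXn2r ?nnegrE ?(ltW bk) ?(ltW bn)//; apply: b_decr; rewrite k1.
Qed.

Let rescaled_le n k z : (n0 <= k < n)%N -> rescaled K (b k.+1) z <= H * b n ^- d.
Proof.
move=> /andP[n0k kn]; rewrite /rescaled mulrC.
apply: ler_pM; rewrite ?K0//.
- by rewrite invr_ge0 exprn_ge0// ltW// b_gt0.
- by rewrite le_max KM orbT.
- exact: bV_le.
Qed.

Let one_le_H n : (n0 <= n)%N -> 1 <= H * b n ^- d.
Proof.
move=> n0n; have bn := b_gt0 (leq_trans n01 n0n).
rewrite -[leLHS]mulr1; apply: ler_pM => //.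
by rewrite -[leLHS]invr1 lef_pV2 ?posrE ?exprn_gt0// exprn_ile1 ?b_le1// ltW.
Qed.

(** Steps per axis of a grid of mesh n^-5 in the cube of side 2 n^3. The cube has to beat the bound
    C n^2 on G_n; the mesh has to beat Lipschitz constants of order n^3, with n^-2 left against
    lambda_n^(1 - eta) >= 1/n. *)
Definition grid_size (n : nat) : nat := (2 * n ^ 8)%N.

Definition grid n : seq 'rV[R]_d :=
  [seq \row_i ((phi i)%:R / n%:R ^+ 5 - n%:R ^+ 3)
    | phi : {ffun 'I_d -> 'I_(grid_size n).+1}].

Definition grid_point n i : 'rV[R]_d := nth 0 (grid n) i.

Let size_grid n : size (grid n) = ((grid_size n).+1 ^ d)%N.
Proof. by rewrite size_map -cardT card_ffun !card_ord. Qed.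

Lemma grid_approx n x : (1 <= n)%N -> `|x| <= n%:R ^+ 3 ->
  exists2 i, (i < size (grid n))%N & `|x - grid_point n i| <= n%:R ^- 5.
Proof.
move=> n1 xn; have n1R : 0 < n%:R :> R by rewrite ltr0n.
pose t i := (x ord0 i + n%:R ^+ 3) * n%:R ^+ 5.
have t0 i : 0 <= t i.
  rewrite mulr_ge0 ?exprn_ge0//.
  by have := le_trans (coord_le_normr x i) xn; rewrite ler_norml => /andP[]; lra.
have tn i : t i <= (grid_size n)%:R.
  rewrite /grid_size natrM natrX (_ : n%:R ^+ 8 = n%:R ^+ 3 * n%:R ^+ 5 :> R); last first.
    by rewrite -exprD.
  rewrite mulrA ler_wpM2r ?exprn_ge0//.
  by have := le_trans (coord_le_normr x i) xn; rewrite ler_norml => /andP[_]; lra.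
have truncn_le i : (Num.truncn (t i))%:R <= t i by rewrite -truncn_ge_nat.
have tk i : (Num.truncn (t i) < (grid_size n).+1)%N.
  by rewrite ltnS -(ler_nat R); exact: le_trans (truncn_le i) (tn i).
pose phi := [ffun i => Ordinal (tk i)].
pose y : 'rV[R]_d := \row_i ((phi i)%:R / n%:R ^+ 5 - n%:R ^+ 3).
have yg : y \in grid n by apply/codomP; exists phi.
exists (index y (grid n)); first by rewrite index_mem.
rewrite /grid_point nth_index//; apply/normr_rowP; first by rewrite invr_ge0 exprn_ge0.
move=> i; rewrite !mxE ffunE/=.
have -> : x ord0 i - ((Num.truncn (t i))%:R / n%:R ^+ 5 - n%:R ^+ 3) =
    (t i - (Num.truncn (t i))%:R) / n%:R ^+ 5.
  by rewrite /t; field; rewrite gt_eqF.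
rewrite ger0_norm ?divr_ge0 ?subr_ge0 ?exprn_ge0//.
rewrite -[leRHS]mul1r ler_wpM2r ?invr_ge0 ?exprn_ge0// lerBlDr addrC natr1.
by apply/ltW; exact: truncnS_gt.
Qed.

(* Index 0 is the total mass, index i + 1 the kernel at the i-th grid point. *)
Let test n j k y : R :=
  if j is i.+1 then rescaled K (b k.+1) (grid_point n i - y) else 1.

Let test_ge0 n j k y : 0 <= test n j k y.
Proof. by case: j => [|j]//=; apply: rescaled_ge0 => //; exact: b_gt0. Qed.

Let test_le n j k y : (n0 <= k < n)%N -> test n j k y <= H * b n ^- d.
Proof.
move=> /[dup] /andP[n0k kn] nk; case: j => [|j] /=; last exact: rescaled_le.
by apply: one_le_H; rewrite (leq_trans n0k)// ltnW.
Qed.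

Let mtest n j k : measurable_fun setT (test n j k).
Proof.
case: j => [|j] /=; first exact: measurable_cst.
apply: (measurableT_comp (measurable_rescaled hK (b k.+1))).
exact: measurable_fun_rowB.
Qed.

(* An upper bound of all the summands, which puts [zeta] below in [0, 1]. *)
Let U n := gamma n * (maxw n * (H * b n ^- d)).

Let U_gt0 n : (n0 < n)%N -> 0 < U n.
Proof.
move=> n0n; have n1 : (1 <= n)%N by apply: leq_trans n01 (ltnW n0n).
have /andP[g0 _] := gamma01 n0n; have bn := b_gt0 n1.
rewrite /U mulr_gt0// mulr_gt0 ?maxw_gt0// mulr_gt0 ?invr_gt0 ?exprn_gt0//.
exact: lt_le_trans H1.
Qed.

Let zeta n j k w y := W n k / U n * (importance k w y * test n j k y).

Let zeta01 n j k w y : 0 <= zeta n j k w y <= 1.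
Proof.
have i0 := importance_ge0 k w y; have t0 := test_ge0 n j k y.
have [/andP[n0k kn]|nk] := boolP (n0 <= k < n)%N; last first.
  by rewrite /zeta /W /relaxation_weight (negPf nk) !mul0r lexx ler01.
have n0n : (n0 < n)%N by exact: leq_ltn_trans kn.
have U0 := U_gt0 n0n.
rewrite /zeta mulrAC divr_ge0 ?(ltW U0) ?mulr_ge0//= ler_pdivrMr// mul1r.
have nk : (n0 <= k < n)%N by rewrite n0k.
apply: ler_pM => //; [exact: mulr_ge0|exact: relaxation_weight_le|].
by apply: ler_pM => //; [exact: importance_le_maxw|exact: test_le].
Qed.

Let mzeta n j k :
  measurable_fun setT (fun p : S k * 'rV[R]_d => zeta n j k p.1 p.2).
Proof.
apply: measurable_funM => //; apply: measurable_funM; first exact: measurable_importance.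
exact: (measurableT_comp (@mtest n j k) measurable_snd).
Qed.

Let mq' k w : measurable_fun setT (q' k w).
Proof. exact: (measurableT_comp (@measurable_safe_density k) (measurable_pair1 (w : S k))). Qed.

Let mimp k w : measurable_fun setT (importance k w).
Proof. exact: (measurableT_comp (@measurable_importance k) (measurable_pair1 (w : S k))). Qed.

Let integrable_policy k w (h : 'rV[R]_d -> R) (B : R) : well_defined_at w ->
  measurable_fun setT h -> (forall y, 0 <= h y <= B) ->
  leb.-integrable setT (EFin \o (fun y => importance k w y * h y * q' k w y)).
Proof.
move=> wd mh h0B; have B0 : 0 <= B by have /andP[h0 hB] := h0B 0; exact: le_trans hB.
have iq : leb.-integrable setT (EFin \o q' k w).
  apply/integrableP; split; first exact/measurable_EFinP.
  under eq_integral do rewrite /= ger0_norm ?safe_density_ge0//.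
  by rewrite integral_safe_density// ltry.
apply: (le_integrable measurableT _ _ (integrableZl measurableT
  ((c0 * lam k)^-1 `^ eta * B) iq)).
  by apply/measurable_EFinP; do 2 apply: measurable_funM => //.
move=> y _; have /andP[hy hyB] := h0B y.
have i0 := importance_ge0 k w y; have q0' := safe_density_ge0 k w y.
rewrite /= lee_fin !ger0_norm ?mulr_ge0 ?powR_ge0//.
by rewrite ler_wpM2r//; apply: ler_pM => //; exact: importance_le.
Qed.

(** The conditional expectation given F_k of importance times [h] at X_(k+1), that is, the integral
    of f^eta q'^(1 - eta) against [h]. *)
Definition policy_mean k w (h : 'rV[R]_d -> R) :=
  \int[leb]_y (importance k w y * h y * q' k w y).

Let sumS n j w := \sum_(k < n) W n k *
  (importance k w (X k.+1 w) * test n j k (X k.+1 w)).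
Let sumA n j w := \sum_(k < n) W n k * policy_mean k w (test n j k).

Let test_bounded n j k : exists B, forall y, 0 <= test n j k y <= B.
Proof.
case: j => [|j]; first by exists 1 => y; rewrite /= ler01 lexx.
exists (b k.+1 ^- d * MK) => y; rewrite test_ge0/=.
by rewrite ler_wpM2l// invr_ge0 exprn_ge0// ltW// b_gt0.
Qed.

Let mean_zeta n j k w : well_defined_at w ->
  predictable_mean leb q' (zeta n j) k w = (W n k * policy_mean k w (test n j k)) / U n.
Proof.
move=> wd; have [B hB] := test_bounded n j k.
rewrite mulrAC -RintegralZl//; last exact: integrable_policy hB.
by congr fine; apply: eq_integral => y _; congr (_%:E); rewrite /zeta; ring.
Qed.

Let grid_number_le n :
  (size (grid n)).+1%:R <= (1 + 3 ^+ d) * n.+1%:R ^+ (8 * d) :> R.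
Proof.
have n1 : (1 : R) <= n.+1%:R by rewrite ler1n.
rewrite size_grid -natr1 natrX addrC mulrDl mul1r; apply: lerD; first exact: exprn_ege1.
rewrite exprM -exprMn; apply: lerXn2r; rewrite ?nnegrE ?mulr_ge0 ?exprn_ge0//.
rewrite /grid_size -natr1 natrM natrX.
have : n%:R ^+ 8 <= n.+1%:R ^+ 8 :> R by rewrite lerXn2r ?nnegrE// ler_nat.
have : (1 : R) <= n.+1%:R ^+ 8 by exact: exprn_ege1.
lra.
Qed.

(** Since lambda^-eta = lambda^(1 - eta) / lambda, U_n log n is a constant times the vanishing ratio
    of [rate], times lambda_n^(1 - eta). *)
Let U_small (e M : R) : 0 < e -> 0 < M -> \forall n \near \oo,
  U n * (M * ln n.+1%:R) <= e * lambda n `^ (1 - eta).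
Proof.
move=> e0 M0.
pose C := c0^-1 `^ eta * H * M * 2.
have H0 : 0 < H by exact: lt_le_trans H1.
have C0 : 0 < C by rewrite !mulr_gt0// powR_gt0// invr_gt0.
have eC : 0 < e / C by rewrite divr_gt0.
have hr := rate eC.
near=> n.
have n2 : (2 <= n)%N by near: n; exact: nbhs_infty_gt.
have n1 : (1 <= n)%N by exact: ltnW.
have n0n : (n0 < n)%N by near: n; exact: nbhs_infty_gt.
have hn : gamma n * ln n%:R / (lambda n * b n ^+ d) <= e / C by near: n.
have /andP[g0 _] := gamma01 n0n; have bn := b_gt0 n1; have /andP[l0 l1] := lambda_01 n1.
(* n + 1 <= n^2 for n >= 2. *)
have lnn : ln n.+1%:R <= 2 * ln n%:R :> R.
  rewrite mulr_natl -lnXn ?ltr0n// ler_ln ?posrE ?exprn_gt0 ?ltr0n//.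
  rewrite -natrX ler_nat; apply: (@leq_trans (n * 2)).
    by rewrite muln2 -addnn -addn1 leq_add2l.
  by rewrite expnS expn1 leq_mul2l n2 orbT.
have maxwE : maxw n = c0^-1 `^ eta * lambda n `^ (1 - eta) * (lambda n)^-1.
  rewrite /maxw invfM powRM ?invr_ge0 ?(ltW c00) ?(ltW l0)// -mulrA; congr (_ * _).
  rewrite -powR_inv1 ?(ltW l0)// -powRrM mulN1r -powRD ?(gt_eqF l0) ?implybT//.
  by congr powR; ring.
rewrite ler_pdivlMr// in hn.
have l'0 : 0 < lambda n `^ (1 - eta) by exact: powR_gt0.
apply: (@le_trans _ _ (U n * (M * (2 * ln n%:R)))).
  by apply: ler_wpM2l; [exact: ltW (U_gt0 n0n)|rewrite ler_pM2l].
rewrite /U maxwE.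
rewrite (_ : _ * _ = gamma n * ln n%:R / (lambda n * b n ^+ d) * C * lambda n `^ (1 - eta)).
  by rewrite ler_pM2r.
by rewrite /C; field; rewrite !gt_eqF ?exprn_gt0.
Unshelve. all: by end_near. Qed.

Let concentration_scaled (e : R) : 0 < e <= 1 / 4 ->
  {ae P, forall w, \forall n \near \oo, forall j, (j < (size (grid n)).+1)%N ->
    `|sumS n j w - sumA n j w| <= e * (sumA n j w + lambda n `^ (1 - eta))}.
Proof.
move=> e04; have [e0 e4] := andP e04.
(* The constant of [concentration] for the exponent 8 d of [grid_number_le]. *)
pose M : R := (8 * d).+2%:R / e.
have M0 : 0 < M by rewrite divr_gt0.
have hU := U_small e0 M0.
have q1 n : {ae P, forall w, \int[leb]_y (q' n w y)%:E = 1}%E.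
  by have := ae_well_defined; apply: filterS => w; exact: integral_safe_density.
have := @concentration R dT T P _ 'rV[R]_d leb generators (fun n => X n.+1) q'
  generators_measurable generators_incr sample_adapted measurable_safe_density
  safe_density_ge0 q1 law_safe_density (fun n => (size (grid n)).+1) zeta
  (@mzeta) zeta01 _ _ grid_number_le e e04.
apply: filterS2 ae_well_defined => w wd conc.
near=> n.
have n0n : (n0 < n)%N by near: n; exact: nbhs_infty_gt.
have U0 := U_gt0 n0n.
have hUn : U n * (M * ln n.+1%:R) <= e * lambda n `^ (1 - eta) by near: n.
have hn : forall j, (j < (size (grid n)).+1)%N ->
    `|\sum_(k < n) zeta n j k w (X k.+1 w) -
      \sum_(k < n) predictable_mean leb q' (zeta n j) k w| <=
    e * (\sum_(k < n) predictable_mean leb q' (zeta n j) k w) + M * ln n.+1%:R.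
  by near: n.
move=> j jn; have := hn j jn.
have -> : \sum_(k < n) zeta n j k w (X k.+1 w) = sumS n j w / U n.
  by rewrite /sumS mulr_suml; apply: eq_bigr => k _; rewrite /zeta mulrAC.
have -> : \sum_(k < n) predictable_mean leb q' (zeta n j) k w = sumA n j w / U n.
  by rewrite /sumA mulr_suml; apply: eq_bigr => k _; rewrite mean_zeta.
rewrite -mulrBl normrM (gtr0_norm (_ : 0 < (U n)^-1)) ?invr_gt0// ler_pdivrMr//.
move=> /le_trans; apply; rewrite mulrDl mulrA divfK ?gt_eqF//.
by rewrite mulrDr lerD2l mulrC.
Unshelve. all: by end_near. Qed.

Let wd_ge0 w n x : well_defined_at w -> 0 <= g n w x.
Proof. by case. Qed.

Let weightE n w y : well_defined_at w ->
  (fu y / q n w y) `^ eta = cu `^ eta * importance n w y.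
Proof.
move=> wd; rewrite /importance safe_densityE// fuE -mulrA powRM ?(ltW cu0)//.
by rewrite divr_ge0// -safe_densityE// safe_density_ge0.
Qed.

Let mixture_scaledS n w x : well_defined_at w -> g n.+1 w x / cu `^ eta =
  (1 - gamma n.+1) * (g n w x / cu `^ eta) + gamma n.+1 *
  (importance n w (X n.+1 w) * rescaled K (b n.+1) (x - X n.+1 w)).
Proof.
move=> wd; rewrite (as_gS hs) weightE//; field.
by rewrite gt_eqF// powR_gt0.
Qed.

Let mass_scaledS n w : well_defined_at w -> mass n.+1 w / cu `^ eta =
  (1 - gamma n.+1) * (mass n w / cu `^ eta) + gamma n.+1 *
  (importance n w (X n.+1 w) * 1).
Proof.
move=> wd; rewrite massS weightE//; field.
by rewrite gt_eqF// powR_gt0.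
Qed.

Let kernel k x y := rescaled K (b k.+1) (x - y).

Let kernel_sum n w x := \sum_(k < n) W n k *
  (importance k w (X k.+1 w) * kernel k x (X k.+1 w)).
Let kernel_mean n w x := \sum_(k < n) W n k * policy_mean k w (kernel k x).

(** The sequence D_n. It starts at time [n0] from the value of G, so that the initial terms cancel
    in G_n - D_n. *)
Definition smoothed n w x := relaxation gamma n0 (g n0 w x / cu `^ eta)
  (fun k => policy_mean k w (fun y => rescaled K (b k.+1) (x - y))) n.
Definition smoothed_mass n w := relaxation gamma n0 (mass n0 w / cu `^ eta)
  (fun k => policy_mean k w (fun=> 1)) n.

Let Pi n := \prod_(n0.+1 <= j < n.+1) (1 - gamma j).

Let Pi01 n : 0 <= Pi n <= 1.
Proof.
apply/andP; split; rewrite /Pi big_nat.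
  apply: prodr_ge0 => j /andP[n0j _].
  by have /andP[_] := gamma01 n0j; rewrite subr_ge0.
apply: prodr_ile1 => j /andP[n0j _].
by have /andP[g0 g1] := gamma01 n0j; rewrite subr_ge0 g1 gerBl ltW.
Qed.

Let mixtureE n w x : (n0 <= n)%N -> well_defined_at w ->
  g n w x / cu `^ eta = g n0 w x / cu `^ eta * Pi n + kernel_sum n w x.
Proof.
move=> n0n wd; transitivity (relaxation gamma n0 (g n0 w x / cu `^ eta)
  (fun k => importance k w (X k.+1 w) * kernel k x (X k.+1 w)) n); last exact: relaxationE.
apply: (relaxation_uniq (u := fun n => g n w x / cu `^ eta)) => // k _.
exact: mixture_scaledS.
Qed.

Let massE' n w : (n0 <= n)%N -> well_defined_at w ->
  mass n w / cu `^ eta = mass n0 w / cu `^ eta * Pi n + sumS n 0 w.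
Proof.
move=> n0n wd; transitivity (relaxation gamma n0 (mass n0 w / cu `^ eta)
  (fun k => importance k w (X k.+1 w) * 1) n); last exact: relaxationE.
apply: (relaxation_uniq (u := fun n => mass n w / cu `^ eta)) => // k _.
exact: mass_scaledS.
Qed.

Let smoothedE n w x : (n0 <= n)%N ->
  smoothed n w x = g n0 w x / cu `^ eta * Pi n + kernel_mean n w x.
Proof. by move=> n0n; exact: relaxationE. Qed.

Let smoothed_massE n w : (n0 <= n)%N ->
  smoothed_mass n w = mass n0 w / cu `^ eta * Pi n + sumA n 0 w.
Proof. by move=> n0n; exact: relaxationE. Qed.

Let rescaled_lipschitz (bb : R) u v : 0 < bb ->
  `|rescaled K bb u - rescaled K bb v| <= LK * bb ^- d.+1 * `|u - v|.
Proof.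
move=> bb0; rewrite /rescaled -mulrBr normrM ger0_norm ?invr_ge0 ?exprn_ge0 ?(ltW bb0)//.
apply: (@le_trans _ _ (bb ^- d * (LK * (bb^-1 * `|u - v|)))).
  rewrite ler_wpM2l ?invr_ge0 ?exprn_ge0 ?(ltW bb0)//; apply: (le_trans (KL _ _)).
  by rewrite -scalerBr normrZ gtr0_norm ?invr_gt0.
by rewrite le_eqVlt; apply/orP; left; apply/eqP; rewrite exprS; field; rewrite !gt_eqF ?exprn_gt0.
Qed.

(** A common Lipschitz constant of [kernel_sum] and [kernel_mean], the total weight being at most
    1. *)
Let lip n := maxw n * (LK * b n ^- d.+1).

Let kernel_lipschitz n k x x' y : (n0 <= k < n)%N ->
  `|kernel k x y - kernel k x' y| <= LK * b n ^- d.+1 * `|x - x'|.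
Proof.
move=> /andP[n0k kn]; have bk := b_gt0 (ltn0Sn k).
have bn := b_gt0 (leq_ltn_trans (leq0n k) kn).
apply: (le_trans (rescaled_lipschitz _ _ bk)).
rewrite (_ : x - y - (x' - y) = x - x'); last by rewrite opprB addrA subrK.
rewrite ler_wpM2r// ler_wpM2l// lef_pV2 ?posrE ?exprn_gt0//.
by rewrite lerXn2r ?nnegrE ?(ltW bk) ?(ltW bn)//; exact: b_decr.
Qed.

Let kernel_bounded k x y : 0 <= kernel k x y <= b k.+1 ^- d * MK.
Proof.
have bk := b_gt0 (ltn0Sn k).
by rewrite rescaled_ge0//= ler_wpM2l// invr_ge0 exprn_ge0// ltW.
Qed.

Let mkernel k x : measurable_fun setT (kernel k x).
Proof.
apply: (measurableT_comp (measurable_rescaled hK (b k.+1))).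
exact: measurable_fun_rowB.
Qed.

Let policy_mean_lipschitz n k w (h h' : 'rV[R]_d -> R) (B s : R) :
  well_defined_at w -> (n0 <= k < n)%N ->
  measurable_fun setT h -> measurable_fun setT h' ->
  (forall y, 0 <= h y <= B) -> (forall y, 0 <= h' y <= B) ->
  (forall y, h y <= h' y + s) -> 0 <= s ->
  policy_mean k w h <= policy_mean k w h' + maxw n * s.
Proof.
move=> wd nk mh mh' hB h'B hh' s0.
have ih := @integrable_policy k w h B wd mh hB.
have ih' := @integrable_policy k w h' B wd mh' h'B.
have iq : leb.-integrable setT (EFin \o q' k w).
  apply/integrableP; split; first exact/measurable_EFinP.
  under eq_integral do rewrite /= ger0_norm ?safe_density_ge0//.
  by rewrite integral_safe_density// ltry.
have -> : maxw n * s = \int[leb]_y (maxw n * s * q' k w y).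
  by rewrite RintegralZl// /Rintegral integral_safe_density// mulr1.
have isq : leb.-integrable setT (EFin \o (fun y => maxw n * s * q' k w y)).
  exact: (integrableZl measurableT (maxw n * s) iq).
rewrite -RintegralD//.
apply: le_Rintegral => //; first exact: (integrableD measurableT ih' isq).
move=> y _; have i0 := importance_ge0 k w y; have qq := safe_density_ge0 k w y.
rewrite -mulrDl ler_wpM2r//.
apply: (@le_trans _ _ (importance k w y * (h' y + s))); first by rewrite ler_wpM2l.
by rewrite mulrDr lerD2l ler_wpM2r// importance_le_maxw.
Qed.

Let lip_ge0 n : (n0 < n)%N -> 0 <= lip n.
Proof.
move=> n0n; have n1 : (1 <= n)%N by exact: leq_trans n01 (ltnW n0n).
have bn := b_gt0 n1.
by rewrite mulr_ge0 ?(ltW (maxw_gt0 n1))// mulr_ge0// invr_ge0 exprn_ge0// ltW.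
Qed.

Let weighted_sum_le n (z : nat -> R) (s : R) : (n0 <= n)%N -> 0 <= s ->
  (forall k, (n0 <= k < n)%N -> z k <= s) -> \sum_(k < n) W n k * z k <= s.
Proof.
move=> n0n s0 zs.
apply: (@le_trans _ _ (\sum_(k < n) W n k * s)).
  apply: ler_sum => k _; have [n0k|kn0] := leqP n0 k.
    by rewrite ler_wpM2l// zs// n0k ltn_ord.
  by rewrite /W /relaxation_weight leqNgt kn0/= !mul0r.
rewrite -mulr_suml -[leRHS]mul1r ler_wpM2r//.
exact: sum_relaxation_weight_le1.
Qed.

Let kernel_sum_lipschitz n w x x' : (n0 < n)%N -> kernel_sum n w x <= kernel_sum n w x' + lip n * `|x - x'|.
Proof.
move=> n0n; rewrite -lerBlDl /kernel_sum -sumrB.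
rewrite (eq_bigr (fun k : 'I_n => W n k * (importance k w (X k.+1 w) *
  (kernel k x (X k.+1 w) - kernel k x' (X k.+1 w))))); last first.
  by move=> k _; rewrite -mulrBr -mulrBr.
apply: (@weighted_sum_le n (fun k => importance k w (X k.+1 w) *
  (kernel k x (X k.+1 w) - kernel k x' (X k.+1 w)))); first exact: ltnW.
  by rewrite mulr_ge0// lip_ge0.
move=> k nk; have i0 := importance_ge0 k w (X k.+1 w).
have kl := le_trans (ler_norm _) (kernel_lipschitz x x' (X k.+1 w) nk).
apply: (le_trans (ler_wpM2l i0 kl)).
rewrite /lip -[leRHS]mulrA; apply: ler_wpM2r; last exact: importance_le_maxw.
exact: le_trans (normr_ge0 _) (kernel_lipschitz x x' (X k.+1 w) nk).
Qed.

Let kernel_mean_lipschitz n w x x' : well_defined_at w -> (n0 < n)%N ->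
  kernel_mean n w x <= kernel_mean n w x' + lip n * `|x - x'|.
Proof.
move=> wd n0n; rewrite -lerBlDl /kernel_mean -sumrB.
rewrite (eq_bigr (fun k : 'I_n => W n k * (policy_mean k w (kernel k x) -
  policy_mean k w (kernel k x')))); last by move=> k _; rewrite -mulrBr.
apply: (@weighted_sum_le n (fun k => policy_mean k w (kernel k x) -
  policy_mean k w (kernel k x'))); first exact: ltnW.
  by rewrite mulr_ge0// lip_ge0.
move=> k nk; rewrite lerBlDl /lip -mulrA.
apply: (policy_mean_lipschitz wd nk _ _ (kernel_bounded k x) (kernel_bounded k x')).
- exact: mkernel.
- exact: mkernel.
- move=> y; rewrite -lerBlDl.
  exact: le_trans (ler_norm _) (kernel_lipschitz x x' y nk).
- exact: le_trans (normr_ge0 _) (kernel_lipschitz x x' 0 nk).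
Qed.

Let maxw_le n : (1 <= n)%N -> n%:R^-1 <= lambda n -> maxw n <= (1 + c0^-1) * n%:R.
Proof.
move=> n1 nl; have [eta0 eta1] := andP eta01.
have n1R : (1 : R) <= n%:R by rewrite ler1n.
have /andP[l0 l1] := lambda_01 n1.
have n0R : 0 < n%:R :> R by exact: lt_le_trans n1R.
have cV : 0 <= c0^-1 by rewrite invr_ge0 ltW.
have x0 : 0 <= (c0 * lambda n)^-1 by rewrite invr_ge0 mulr_ge0// ltW.
apply: (@le_trans _ _ (1 + (c0 * lambda n)^-1)).
  rewrite /maxw; set x := _^-1 in x0 *.
  have [x1|x1] := leP 1 x.
    by apply: (le_trans (ler1_powR x1 eta1)); rewrite lerDr.
  have e1 : 1 `^ eta = 1 :> R by rewrite powR1.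
  apply: (@le_trans _ _ 1); last by rewrite lerDl.
  by rewrite -[leRHS]e1; apply: ge0_ler_powR; rewrite ?nnegrE ?ler01 ?(ltW eta0)// ltW.
rewrite mulrDl mul1r invfM; apply: lerD => //.
by rewrite ler_wpM2l// -[leRHS]invrK lef_pV2 ?posrE// invr_gt0.
Qed.

Let bdV_le n : (1 <= n)%N -> n%:R^-1 <= b n ^+ d -> b n ^- d <= n%:R.
Proof.
move=> n1 nb; have bn := b_gt0 n1.
by rewrite -[leRHS]invrK lef_pV2 ?posrE ?exprn_gt0// invr_gt0 ltr0n.
Qed.

(** By the polynomial rates [lip n] is at most a constant times n^3. Times n^-5 this is O(n^-2),
    below e/n for large n, and 1/n <= lambda_n <= lambda_n^(1 - eta). *)
Let lip_small (e : R) : 0 < e ->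
  \forall n \near \oo, 3 * lip n * n%:R ^- 5 <= e * lambda n `^ (1 - eta).
Proof.
move=> e0; have [eta0 eta1] := andP eta01.
pose C := 3 * ((1 + c0^-1) * LK).
have cV : 0 <= c0^-1 by rewrite invr_ge0 ltW.
have C0 : 0 <= C by rewrite !mulr_ge0// addr_ge0.
near=> n.
have n1 : (1 <= n)%N by near: n; exact: nbhs_infty_gt.
have nC : C / e <= n%:R by near: n; exact: nbhs_infty_ger.
have n0R : 0 < n%:R :> R by rewrite ltr0n.
have [nl nbd nb] : [/\ n%:R^-1 <= lambda n, n%:R^-1 <= b n ^+ d & n%:R^-1 <= b n].
  by near: n.
have /andP[l0 l1] := lambda_01 n1; have bn := b_gt0 n1.
have lipn : lip n <= (1 + c0^-1) * n%:R * (LK * (n%:R * n%:R)).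
  rewrite /lip; apply: ler_pM; rewrite ?(ltW (maxw_gt0 n1)) ?maxw_le//.
    by rewrite mulr_ge0// invr_ge0 exprn_ge0// ltW.
  rewrite ler_wpM2l// exprS invfM; apply: ler_pM; rewrite ?invr_ge0 ?exprn_ge0 ?(ltW bn)//.
    by rewrite -[leRHS]invrK lef_pV2 ?posrE// invr_gt0.
  exact: bdV_le.
apply: (@le_trans _ _ (C * n%:R ^- 2)).
  rewrite ler_pdivrMr ?exprn_gt0//.
  apply: (@le_trans _ _ (3 * ((1 + c0^-1) * n%:R * (LK * (n%:R * n%:R))))).
    by rewrite ler_pM2l.
  rewrite le_eqVlt; apply/orP; left; apply/eqP; rewrite /C.
  by field; rewrite !gt_eqF.
apply: (@le_trans _ _ (e * n%:R^-1)).
  rewrite expr2 invfM mulrA ler_pM2r ?invr_gt0// ler_pdivrMr// mulrC -ler_pdivrMr//.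
rewrite ler_pM2l//; apply: (le_trans nl).
by apply: ger1_powR; [rewrite l0|rewrite gerBl ltW].
Unshelve. all: by end_near. Qed.

Let policy_mean_ge0 k w h : (forall y, 0 <= h y) -> 0 <= policy_mean k w h.
Proof.
move=> h0; apply: Rintegral_ge0 => y _.
by rewrite !mulr_ge0// ?importance_ge0// safe_density_ge0.
Qed.

Let kernel_mean_ge0 n w x : 0 <= kernel_mean n w x.
Proof.
apply: sumr_ge0 => k _; rewrite mulr_ge0// policy_mean_ge0// => y.
by have /andP[] := kernel_bounded k x y.
Qed.

Let kernel_mean_le_smoothed n w x : (n0 <= n)%N -> well_defined_at w ->
  kernel_mean n w x <= smoothed n w x.
Proof.
move=> n0n wd; rewrite smoothedE// lerDr mulr_ge0//; last by have /andP[] := Pi01 n.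
by rewrite divr_ge0 ?powR_ge0// wd_ge0.
Qed.

Let mixture_smoothed (e : R) : 0 < e -> {ae P, forall w, \forall n \near \oo,
  forall x, `|x| <= n%:R ^+ 3 ->
  `|g n w x / cu `^ eta - smoothed n w x| <=
    e * (smoothed n w x + lambda n `^ (1 - eta))}.
Proof.
move=> e0.
(* 1/4 is the range of the Chernoff bound, and the passage from the grid to all points doubles the
   additive error. *)
pose e' := Num.min (1 / 4) (e / 2).
have e'0 : 0 < e' by rewrite lt_min !divr_gt0.
have e'4 : e' <= 1 / 4 by rewrite ge_min lexx.
have e'2 : 2 * e' <= e by rewrite mulrC -ler_pdivlMr// ge_min lexx orbT.
have e'04 : 0 < e' <= 1 / 4 by rewrite e'0.
have hl := lip_small e'0.
apply: filterS2 ae_well_defined (concentration_scaled e'04) => w wd conc.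
near=> n.
have n1 : (1 <= n)%N by near: n; exact: nbhs_infty_gt.
have n0n : (n0 < n)%N by near: n; exact: nbhs_infty_gt.
have hln : 3 * lip n * n%:R ^- 5 <= e' * lambda n `^ (1 - eta) by near: n.
have hn : forall j, (j < (size (grid n)).+1)%N ->
    `|sumS n j w - sumA n j w| <= e' * (sumA n j w + lambda n `^ (1 - eta)).
  by near: n.
move=> x xn; have [i i_grid xi] := grid_approx n1 xn.
have -> : g n w x / cu `^ eta - smoothed n w x = kernel_sum n w x - kernel_mean n w x.
  by rewrite (mixtureE x (ltnW n0n) wd) (smoothedE w x (ltnW n0n)); ring.
pose y := grid_point n i.
have hi : `|kernel_sum n w y - kernel_mean n w y| <= e' * (kernel_mean n w y + lambda n `^ (1 - eta)).
  exact: hn i.+1 i_grid.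
have D0 := kernel_mean_le_smoothed x (ltnW n0n) wd.
rewrite -/y in xi.
have xy : lip n * `|x - y| <= lip n * n%:R ^- 5 by rewrite ler_wpM2l// lip_ge0.
have yx : lip n * `|y - x| <= lip n * n%:R ^- 5 by rewrite distrC.
have S1 := le_trans (kernel_sum_lipschitz w x y n0n) (lerD (lexx _) xy).
have S2 := le_trans (kernel_sum_lipschitz w y x n0n) (lerD (lexx _) yx).
have A1 := le_trans (kernel_mean_lipschitz x y wd n0n) (lerD (lexx _) xy).
have A2 := le_trans (kernel_mean_lipschitz y x wd n0n) (lerD (lexx _) yx).
rewrite -mulrA in hln.
apply: (le_trans (deviation_shift e'04 S1 S2 A1 A2 hi hln)).
have h1 : 2 * e' * lambda n `^ (1 - eta) <= e * lambda n `^ (1 - eta).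
  by rewrite ler_wpM2r// powR_ge0.
have h2 : e' * kernel_mean n w x <= e * smoothed n w x.
  have ee : e' <= e by apply: le_trans e'2; rewrite mulr_natl mulr2n lerDl ltW.
  by apply: ler_pM; [exact: ltW|exact: kernel_mean_ge0|exact: ee|exact: D0].
by rewrite mulrDr; exact: lerD.
Unshelve. all: by end_near. Qed.

Let mixture_bounded n w : exists C : R, forall x, `|g n w x| <= C.
Proof.
elim: n => [|n [C HC]]; first by exists 0 => x; rewrite (as_g0 hs) normr0.
set v := gamma n.+1 * (fu (X n.+1 w) / q n w (X n.+1 w)) `^ eta.
exists (`|1 - gamma n.+1| * C + `|v| * (b n.+1 ^- d * MK)) => x.
have bn := b_gt0 (ltn0Sn n).
rewrite (as_gS hs) -/v; apply: (le_trans (ler_normD _ _)).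
apply: lerD; rewrite normrM; apply: ler_wpM2l => //.
rewrite ger0_norm ?rescaled_ge0//.
by have /andP[] := kernel_bounded n x (X n.+1 w).
Qed.

(** An average of terms of size at most lambda_n^-eta b_n^-d up to a constant; each of the two
    factors is O(n) by the polynomial rates. *)
Let mixture_scaled_le w : well_defined_at w ->
  exists C : R, \forall n \near \oo, forall x, g n w x / cu `^ eta <= C * n%:R ^+ 2.
Proof.
move=> wd; have [B HB] := mixture_bounded n0 w.
have cV : 0 <= c0^-1 by rewrite invr_ge0 ltW.
have cue : 0 < cu `^ eta by exact: powR_gt0.
have H0 : 0 <= H by exact: le_trans H1.
exists (B / cu `^ eta + (1 + c0^-1) * H); near=> n => x.
have n1 : (1 <= n)%N by near: n; exact: nbhs_infty_gt.
have n1R : (1 : R) <= n%:R by rewrite ler1n.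
have n0n : (n0 < n)%N by near: n; exact: nbhs_infty_gt.
have [nl nbd nb] : [/\ n%:R^-1 <= lambda n, n%:R^-1 <= b n ^+ d & n%:R^-1 <= b n].
  by near: n.
have bn := b_gt0 n1.
have g0B : 0 <= g n0 w x / cu `^ eta <= B / cu `^ eta.
  rewrite divr_ge0 ?wd_ge0 ?(ltW cue)//= ler_pM2r ?invr_gt0//.
  exact: le_trans (ler_norm _) (HB x).
have [P0 P1] := andP (Pi01 n); have [g00 gB] := andP g0B.
rewrite mixtureE ?(ltnW n0n)// mulrDl; apply: lerD.
  apply: (@le_trans _ _ (B / cu `^ eta)).
    by apply: le_trans gB; rewrite ler_piMr.
  by rewrite ler_peMr ?exprn_ege1// (le_trans g00 gB).
apply: (@le_trans _ _ (maxw n * (H * b n ^- d))).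
  apply: (@weighted_sum_le n (fun k => importance k w (X k.+1 w) * kernel k x (X k.+1 w))).
  - exact: ltnW.
  - by rewrite mulr_ge0 ?(ltW (maxw_gt0 n1))// mulr_ge0// invr_ge0 exprn_ge0// ltW.
  - move=> k nk; apply: ler_pM; rewrite ?importance_ge0 ?importance_le_maxw//.
      by have /andP[] := kernel_bounded k x (X k.+1 w).
    exact: rescaled_le.
apply: (@le_trans _ _ ((1 + c0^-1) * n%:R * (H * n%:R))).
  apply: ler_pM; rewrite ?(ltW (maxw_gt0 n1)) ?maxw_le//.
    by rewrite mulr_ge0// invr_ge0 exprn_ge0// ltW.
  by rewrite ler_wpM2l ?bdV_le.
by rewrite le_eqVlt; apply/orP; left; apply/eqP; ring.
Unshelve. all: by end_near. Qed.

(** The weighted inequality of means bounds f^eta q^(1 - eta) by eta f + (1 - eta) q, whose integral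
    is 1. *)
Let policy_mean1_le1 k w : well_defined_at w -> policy_mean k w (fun=> 1) <= 1.
Proof.
move=> wd; have [_ _ ifE] := hf; have [eta0 eta1] := andP eta01.
have iff : leb.-integrable setT (EFin \o f).
  apply/integrableP; split; first exact/measurable_EFinP.
  by under eq_integral do rewrite /= ger0_norm//; rewrite ifE ltry.
have iq : leb.-integrable setT (EFin \o q' k w).
  apply/integrableP; split; first exact/measurable_EFinP.
  under eq_integral do rewrite /= ger0_norm ?safe_density_ge0//.
  by rewrite integral_safe_density// ltry.
have i1 := integrableZl measurableT eta iff.
have i2 := integrableZl measurableT (1 - eta) iq.
have i1' : leb.-integrable setT (EFin \o (fun y => eta * f y)) by exact: i1.
have i2' : leb.-integrable setT (EFin \o (fun y => (1 - eta) * q' k w y)) by exact: i2.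
have i12 : leb.-integrable setT (EFin \o (fun y => eta * f y + (1 - eta) * q' k w y)).
  exact: (integrableD measurableT i1' i2').
have i12E : \int[leb]_y (eta * f y + (1 - eta) * q' k w y) = 1.
  rewrite RintegralD// !RintegralZl//.
  by rewrite /Rintegral ifE integral_safe_density//= !mulr1 subrKC.
have h01 : 'rV[R]_d -> (0 : R) <= (1 : R) <= 1 by move=> _; rewrite ler01 lexx.
have m1 : measurable_fun setT (fun _ : 'rV[R]_d => 1 : R) by exact: measurable_cst.
have ip := @integrable_policy k w (fun=> 1) 1 wd m1 h01.
rewrite -[leRHS]i12E; apply: (le_Rintegral measurableT ip i12).
move=> y _; rewrite mulr1 importance_safe_density.
by apply: geometric_mean_le => //; exact: safe_density_ge0.
Qed.

Hypotheses (Cg0 : 0 < Cg) (gamma_ge : forall n, (1 <= n)%N -> n%:R^-1 <= Cg * gamma n).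

Let mass_le (e : R) : 0 < e -> {ae P, forall w, \forall n \near \oo,
  mass n w / cu `^ eta <= 1 + e}.
Proof.
(* One e' is for the relaxation of the drift towards 1, two are for the noise, which is relative to
   a quantity at most 2. *)
move=> e0; pose e' := Num.min (1 / 4) (e / 3).
have e'0 : 0 < e' by rewrite lt_min !divr_gt0.
have e'4 : e' <= 1 / 4 by rewrite ge_min lexx.
have e'3 : 3 * e' <= e by rewrite mulrC -ler_pdivlMr// ge_min lexx orbT.
have e'04 : 0 < e' <= 1 / 4 by rewrite e'0.
apply: filterS2 ae_well_defined (concentration_scaled e'04) => w wd conc.
have J : \forall n \near \oo, smoothed_mass n w <= 1 / (1 - 0) + e'.
  apply: (@contraction_le _ gamma Cg Cg0 gamma_ge n0 gamma01 (smoothed_mass ^~ w)) => //.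
    by rewrite lexx ltr01.
  move=> n n0n; rewrite /smoothed_mass relaxationS// mul0r add0r.
  have /andP[g0 g1] := gamma01 (n0n : (n0 < n.+1)%N).
  by rewrite lerD2l ler_pM2l// policy_mean1_le1.
near=> n.
have n1 : (1 <= n)%N by near: n; exact: nbhs_infty_gt.
have n0n : (n0 < n)%N by near: n; exact: nbhs_infty_gt.
have Jn : smoothed_mass n w <= 1 / (1 - 0) + e' by near: n.
have hn : forall j, (j < (size (grid n)).+1)%N ->
    `|sumS n j w - sumA n j w| <= e' * (sumA n j w + lambda n `^ (1 - eta)).
  by near: n.
have := hn 0%N (ltn0Sn _); rewrite ler_norml => /andP[_ h2].
have A1 : sumA n 0 w <= 1.
  apply: (@weighted_sum_le n (fun k => policy_mean k w (fun=> 1))) => //; first exact: ltnW.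
  by move=> k _; exact: policy_mean1_le1.
have /andP[l0 l1] := lambda_01 n1.
have l'1 : lambda n `^ (1 - eta) <= 1.
  rewrite -[leRHS](powRr0 (lambda n)); apply: ger_powR; first by rewrite l0.
  by have [_ eta1] := andP eta01; rewrite subr_ge0.
have h3 : e' * (sumA n 0 w + lambda n `^ (1 - eta)) <= e' * 2.
  by rewrite ler_pM2l//; lra.
rewrite massE' ?(ltnW n0n)//; move: Jn; rewrite smoothed_massE ?(ltnW n0n)// subr0 divr1; lra.
Unshelve. all: by end_near. Qed.

(** * Pathwise convergence *)

Variables (Mf Mq k0 rho0 r' CK : R).
Hypotheses (cf : continuous f) (fM : forall x, f x <= Mf) (q0M : forall x, q0 x <= Mq)
  (k00 : 0 < k0) (rho00 : 0 < rho0) (Kk0 : forall z, `|z| <= rho0 -> k0 <= K z)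
  (r'0 : 0 < r') (CK0 : 0 < CK) (Ktail : forall z, `|z| `^ (d%:R + r') * K z <= CK)
  (b_cvg : b @ \oo --> 0) (lambda_cvg : lambda @ \oo --> 0).

Lemma policy_cvg_compact : {ae P, forall w, forall (A : set 'rV[R]_d) (e : R),
  compact A -> 0 < e -> \forall n \near \oo, forall x, A x -> `|q n w x - f x| <= e}.
Proof.
have small (e : R) : 0 < e -> exists j : nat, j.+1%:R^-1 <= e.
  move=> e0; have [j _ /(_ j (leqnn j)) hj] := near_infty_natSinv_lt (PosNum e0).
  by exists j; exact: ltW.
have jp (j : nat) : 0 < j.+1%:R^-1 :> R by rewrite invr_gt0.
(* Only the tolerances 1/(j+1) are used, so that one null event serves every [e] and every compact
   set. *)
have h1 := ae_foralln (fun j => mixture_smoothed (jp j)).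
have h2 := ae_foralln (fun j => mass_le (jp j)).
apply: filterS3 ae_well_defined h1 h2 => w wd H1w H2w A e cA e0.
have cue : 0 < cu `^ eta by exact: powR_gt0.
pose G n x := g n w x / cu `^ eta.
pose I n := mass n w / cu `^ eta.
pose Delta n x := policy_mean n w (kernel n x).
apply: (@q_cvg_compact R d d1 eta f q0 K gamma b lambda eta01 hf cf hq0 Mf Mq c0 fM q0M
  c00 c0f_le hK k0 rho0 k00 rho00 Kk0 r' CK MK KM r'0 CK0 Ktail Cg n0 Cg0 gamma_ge gamma01
  _ b_cvg _ _ lambda_cvg G (fun n => smoothed n w) Delta (fun n => q n w) I) => //.
- by move=> n n0n; apply: b_gt0; exact: leq_trans n01 n0n.
- by move=> n n0n; apply: lambda_01; exact: leq_trans n01 n0n.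
- by move=> n n0n; apply: lambda_decr; rewrite (leq_trans n01 n0n) leqnSn.
- by move=> n x _; rewrite /G divr_ge0 ?(ltW cue)// wd_ge0.
- move=> n _; apply: measurable_funM => //; exact: measurable_mixture_density.
- move=> n _; rewrite /I mulrC EFinM massE -integralZl//.
    by apply: eq_integral => x _; rewrite -EFinM mulrC.
  exact: integrable_mixture.
- move=> n n0n; rewrite /I divr_gt0//; have [_ I0] := wd; apply: I0.
  exact: leq_trans n01 n0n.
- move=> n x n0n; have := leq_trans n01 n0n; case: (n) => [//|m] _.
  rewrite (as_qS hs) /G /I; congr (_ * _ + _).
  by rewrite invf_div mulrA divfK// gt_eqF.
- have [C HC] := mixture_bounded n0 w; exists (C / cu `^ eta) => x.
  rewrite /smoothed relaxation0 divr_ge0 ?(ltW cue) ?wd_ge0//= ler_pM2r ?invr_gt0//.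
  exact: le_trans (ler_norm _) (HC x).
- by move=> n x n0n; rewrite /smoothed relaxationS.
- move=> n x n0n; rewrite /Delta /policy_mean /Rintegral fineK.
    apply: eq_integral => y _; congr (_%:E).
    by rewrite mulrAC importance_safe_density safe_densityE.
  apply: integrable_fin_num => //.
  exact: (@integrable_policy n w (kernel n x) _ wd (@mkernel n x) (kernel_bounded n x)).
- move=> e1 e10; have [j hj] := small e1 e10.
  have := H1w j; apply: filterS2 (nbhs_infty_ge n0) => n n0n Hn x xn.
  apply: (le_trans (Hn x xn)); rewrite ler_wpM2r// addr_ge0 ?powR_ge0//.
  exact: le_trans (kernel_mean_ge0 n w x) (kernel_mean_le_smoothed x n0n wd).
- move=> e1 e10; have [j hj] := small e1 e10.
  have := H2w j; apply: filterS => n Hn; apply: (le_trans Hn).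
  by rewrite lerD2l.
- exact: mixture_scaled_le.
Qed.

End adaptive.

(** * Uniform convergence on compact sets *)

Section sup_distance.
Context {R : realType} {d : nat}.
Implicit Types (A : set 'rV[R]_d) (p : 'rV[R]_d -> R).

Lemma sup_dist_ge0 A p p' : (0 <= sup_dist A p p')%E.
Proof. by apply: ereal_sup_ubound; left. Qed.

Lemma sup_dist_le A p p' (e : R) : 0 <= e -> (forall x, A x -> `|p x - p' x| <= e) ->
  (sup_dist A p p' <= e%:E)%E.
Proof.
move=> e0 h; apply: ge_ereal_sup => _ [->|[x Ax <-]]; first by rewrite lee_fin.
by rewrite lee_fin; exact: h.
Qed.

Lemma cvg_sup_dist A (p_ : nat -> 'rV[R]_d -> R) p :
  (forall e : R, 0 < e -> \forall n \near \oo, forall x, A x -> `|p_ n x - p x| <= e) ->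
  sup_dist A (p_ n) p @[n --> \oo] --> 0%E.
Proof.
move=> h; apply/fine_cvgP; split.
  apply: filterS (h 1 ltr01) => n hn.
  apply/fin_real; rewrite (lt_le_trans (ltNyr 0) (sup_dist_ge0 _ _ _))//=.
  exact: le_lt_trans (sup_dist_le ler01 hn) (ltry 1).
apply/cvgrPdist_le => e e0; apply: filterS (h e e0) => n hn.
have s0 := sup_dist_ge0 A (p_ n) p; have se := sup_dist_le (ltW e0) hn.
rewrite sub0r normrN /= ger0_norm ?fine_ge0//.
rewrite -lee_fin fineK// ge0_fin_numE//; exact: le_lt_trans se (ltry e).
Qed.

Lemma bounded_fun_le p : bounded_fun p -> exists M, forall x, `|p x| <= M.
Proof.
move=> [M [Mr hM]]; exists (M + 1) => x; apply: (hM (M + 1)) => //.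
by rewrite ltrDl.
Qed.

End sup_distance.

Theorem theorem1 (R : realType) (d : nat) (hd : (1 <= d)%N)
  (eta : R) (heta : 0 < eta <= 1)
  (f fu q0 K : 'rV[R]_d -> R) (cu : R)
  (hf : is_density f) (hcu : 0 < cu) (hfu : forall x, fu x = cu * f x)
  (hK : is_density K) (hq0 : is_density q0)
  (gamma b lambda : R^nat)
  (gamma_gt0 : forall n, (1 <= n)%N -> 0 < gamma n)
  (b_gt0 : forall n, (1 <= n)%N -> 0 < b n)
  (lambda_01 : forall n, (1 <= n)%N -> 0 < lambda n <= 1)
  (dT : measure_display) (T : measurableType dT) (P : probability T R)
  (X : {RV P >-> 'rV[R]_d}^nat) (g q : nat -> T -> 'rV[R]_d -> R)
  (hsampling : adaptive_sampling X fu q0 K eta gamma b lambda g q)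
  (* (1) *)
  (fu_bounded : bounded_fun fu) (fu_continuous : continuous fu)
  (fu_ge0 : forall x, 0 <= fu x)
  (fu_integrable : lebesgue_row.-integrable setT (EFin \o fu))
  (q0_bounded : bounded_fun q0) (q0_continuous : continuous q0)
  (q0_ge0 : forall x, 0 <= q0 x)
  (q0_integrable : lebesgue_row.-integrable setT (EFin \o q0))
  (fu_tail : exists r Cf : R, [/\ 0 < r, 0 < Cf &
    forall t, 0 < t -> (* the bound is +oo at t = 0 *)
      (\int[lebesgue_row]_(x in [set x | (t < euclidean_norm x)%R]) (fu x)%:E
        <= (Cf * t `^ (- r))%:E)%E])
  (fu_le_q0 : exists2 c : R, 0 < c & forall x, c * fu x <= q0 x)
  (* (2) *)
  (K_bounded : bounded_fun K)
  (K_lipschitz : exists L : R,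
    forall x y, `|K x - K y| <= L * euclidean_norm (x - y))
  (K0_gt0 : 0 < K 0)
  (K_tail : exists r' CK : R, [/\ 0 < r', 0 < CK &
    forall x, (1 + euclidean_norm x `^ (d%:R + r')) * K x <= CK])
  (* (3) *)
  (gamma_decr : forall m n, (1 <= m <= n)%N -> gamma n <= gamma m)
  (gamma_cvg : gamma @ \oo --> 0)
  (b_decr : forall m n, (1 <= m <= n)%N -> b n <= b m)
  (b_cvg : b @ \oo --> 0)
  (lambda_decr : forall m n, (1 <= m <= n)%N -> lambda n <= lambda m)
  (lambda_cvg : lambda @ \oo --> 0)
  (gamma_rate : exists (Cgamma : R) (ngamma : nat),
    [/\ 0 < Cgamma, (1 <= ngamma)%N,
        (forall n, (1 <= n)%N -> n%:R^-1 <= Cgamma * gamma n) &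
        (forall n, (ngamma <= n)%N ->
          gamma n - gamma n.+1 <= gamma n * gamma n.+1)])
  (gamma_sq : (\sum_(1 <= n <oo) (gamma n ^+ 2)%:E < +oo)%E)
  (rate_large_eta : 1 / 2 <= eta ->
    n%:R * gamma n ^+ 2 * ln n%:R / (lambda n * b n ^+ d) @[n --> \oo] --> 0)
  (rate_small_eta : eta < 1 / 2 ->
    n%:R * gamma n ^+ 2 * ln n%:R /
      (lambda n `^ (2 * (1 - eta)) * b n `^ (2 * d%:R * (1 - eta)))
      @[n --> \oo] --> 0)
  (A : set 'rV[R]_d) (hA : compact A) :
  {ae P, forall w, sup_dist A (q n w) f @[n --> \oo] --> 0%E}.
Proof.
have [_ K_ge0 _] := hK.
have fE x : f x = cu^-1 * fu x by rewrite hfu mulKf// gt_eqF.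
have [Mfu fuM] := bounded_fun_le fu_bounded.
have [Mq q0M] := bounded_fun_le q0_bounded.
have [MK KM] := bounded_fun_le K_bounded.
have [c c0 cfu_le] := fu_le_q0.
have [Cg [ng [Cg0 ng1 gamma_ge gamma_step]]] := gamma_rate.
have [L hL] := K_lipschitz.
have [r' [CK [r'0 CK0 KCK]]] := K_tail.
(* From the Euclidean to the sup norm the Lipschitz constant gains a factor sqrt d; the maximum
   makes it nonnegative. *)
pose LK := Num.max L 0 * Num.sqrt d%:R.
have LK0 : 0 <= LK by rewrite mulr_ge0// le_max lexx orbT.
have KL (x y : 'rV[R]_d) : `|K x - K y| <= LK * `|x - y|.
  apply: le_trans (hL x y) _.
  apply: (@le_trans _ _ (Num.max L 0 * euclidean_norm (x - y))).
    by rewrite ler_wpM2r ?euclidean_norm_ge0// le_max lexx.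
  by rewrite -mulrA ler_wpM2l ?euclidean_norm_le_normr// le_max lexx orbT.
have LK1 : 0 < LK + 1 by rewrite ltr_wpDl.
(* Within this radius the Lipschitz bound lets [K] drop by at most [K 0 / 2]; adding 1 avoids a
   division by 0. *)
pose rho0 := K 0 / 2 / (LK + 1).
have rho00 : 0 < rho0 by rewrite !divr_gt0.
have Kk0 (z : 'rV[R]_d) : `|z| <= rho0 -> K 0 / 2 <= K z.
  move=> zr; have := KL 0 z; rewrite sub0r normrN ler_norml => /andP[_ h].
  have : LK * `|z| <= K 0 / 2.
    apply: (@le_trans _ _ ((LK + 1) * rho0)).
      by apply: ler_pM => //; rewrite lerDl.
    by rewrite mulrC divfK// gt_eqF.
  lra.
have Ktail (z : 'rV[R]_d) : `|z| `^ (d%:R + r') * K z <= CK.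
  apply: le_trans (KCK z); rewrite ler_wpM2r//.
  apply: (@le_trans _ _ (euclidean_norm z `^ (d%:R + r'))); last by rewrite lerDr.
  apply: ge0_ler_powR; rewrite ?nnegrE ?euclidean_norm_ge0 ?addr_ge0 ?(ltW r'0)//.
  exact: normr_le_euclidean_norm.
have [ng' _ gamma_le1] : \forall n \near \oo, gamma n <= 1 by exact: cvgr_le gamma_cvg _ ltr01.
have [nb _ b_le1] : \forall n \near \oo, b n <= 1 by exact: cvgr_le b_cvg _ ltr01.
(* From this index on, [gamma <= 1], [b <= 1] and the step condition on gamma hold together. *)
pose n0 := maxn ng (maxn ng' nb).
have n0ng : (ng <= n0)%N by rewrite leq_maxl.
have n0ng' : (ng' <= n0)%N by rewrite /n0 maxnCA leq_maxl.
have n0nb : (nb <= n0)%N by rewrite /n0 maxnA leq_maxr.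
have n01 : (1 <= n0)%N by exact: leq_trans n0ng.
have gamma01 n : (n0 < n)%N -> 0 < gamma n <= 1.
  move=> n0n; rewrite gamma_gt0 ?(leq_trans _ n0n)//=.
  by apply: gamma_le1; exact: leq_trans n0ng' (ltnW n0n).
have rate := rate_cvg heta Cg0 gamma_gt0 b_gt0 lambda_01 b_cvg gamma_ge
  rate_large_eta rate_small_eta.
have poly := polynomial_rates hd heta Cg0 gamma_gt0 b_gt0 lambda_01 b_cvg gamma_ge
  rate_large_eta rate_small_eta.
have f_cont : continuous f.
  rewrite (_ : f = fun x => cu^-1 * fu x); last exact/funext.
  by move=> x; exact: (cvgM (cvg_cst cu^-1) (fu_continuous x)).
have fM x : f x <= cu^-1 * Mfu.
  by rewrite fE ler_pM2l ?invr_gt0// (le_trans (ler_norm _)).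
have := policy_cvg_compact heta hf hcu hfu hK hq0 b_gt0 lambda_01 lambda_decr hsampling
  c0 cfu_le hd (fun z => le_trans (ler_norm _) (KM z)) LK0 KL b_decr n01 gamma01
  (fun n hn => gamma_step n (leq_trans n0ng hn)) (fun n hn => b_le1 n (leq_trans n0nb hn))
  rate poly Cg0 gamma_ge f_cont fM (fun z => le_trans (ler_norm _) (q0M z))
  (divr_gt0 K0_gt0 (ltr0n R 2)) rho00 Kk0 r'0 CK0 Ktail b_cvg lambda_cvg.
apply: filterS => w hw; apply: cvg_sup_dist => e e0; exact: hw.
Qed.
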